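(* Let $s>1/2$, $T>0$ and $v^0\in\dot H^s$. Then the system $$\partial_t v_k=\tfrac12 ik\sum_{k_1+k_2=k}e^{3ikk_1k_2t}v_{k_1}v_{k_2},\qquad k\in\mathbb{Z}_0,\qquad v(0)=v^0,$$ has a solution $v$ on $[0,T]$ (in the sense described in the context) which is the unique solution on $[0,T]$; it belongs to $C([0,T];\dot H^s)$ and satisfies $\|v(t)\|_{\dot H^0}=\|v^0\|_{\dot H^0}$ for all $t\in[0,T]$. Moreover the solution depends Lipschitz continuously on the data: there is a function $L(s,T,r)$ such that for any $v^0,w^0\in\dot H^s$ with corresponding solutions $v,w$, $$\|w(t)-v(t)\|_{\dot H^s}\le L\big(s,T,\|v^0\|_{\dot H^s}+\|w^0\|_{\dot H^s}\big)\,\|w^0-v^0\|_{\dot H^s},\qquad t\in[0,T].$$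
   Context: Write $\mathbb{Z}_0=\mathbb{Z}\setminus\{0\}$. For $s\in\mathbb{R}$, $\dot H^s$ denotes the Hilbert space of sequences $v=(v_k)_{k\in\mathbb{Z}_0}$ of complex numbers with $v_{-k}=\overline{v_k}$ and $\|v\|_{\dot H^s}^2=\sum_{k\in\mathbb{Z}_0}|k|^{2s}|v_k|^2<\infty$. The system above is the periodic KdV equation $\partial_tu=u\partial_xu+\partial_x^3u$ written for $v_k(t)=e^{ik^3t}u_k(t)$, $u_k$ the Fourier coefficients of $u$; sums are over $k_1,k_2\in\mathbb{Z}_0$. A function $v$ is a solution on $[0,T]$ with $v(0)=v^0$ if $v\in L_\infty([0,T];\dot H^0)$ and for every $k\in\mathbb{Z}_0$ and $t\in[0,T]$, $$v_k(t)-v^0_k=\tfrac12 ik\int_0^t\sum_{k_1+k_2=k}e^{3ikk_1k_2\tau}v_{k_1}(\tau)v_{k_2}(\tau)\,d\tau.$$ *)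

(* Defs.v *)
From HB Require Import structures.
From mathcomp Require Import all_boot all_order all_algebra.
From mathcomp Require Import all_classical all_reals all_analysis.
From mathcomp Require Import complex.
Set Implicit Arguments. Unset Strict Implicit. Unset Printing Implicit Defensive.
Import Order.TTheory GRing.Theory Num.Theory.
Import numFieldNormedType.Exports.
Local Open Scope classical_set_scope.
Local Open Scope ring_scope.

Section KdV.
Variable R : realType.

(* a Fourier sequence indexed by Z (the value at index 0 is required to be 0,
   i.e. the sequence really lives on Z_0 = Z \ {0}) *)
Definition fseq := int -> R[i].

Definition cabs2 (z : R[i]) : R := (complex.Re z) ^+ 2 + (complex.Im z) ^+ 2.

Definition hs_term (s : R) (v : fseq) (k : int) : \bar R :=
  (((`|k|%:~R : R) `^ (2 * s)) * cabs2 (v k))%:E.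

Definition hs_norm2 (s : R) (v : fseq) : \bar R :=
  (\esum_(k in [set k : int | k != 0%R]) hs_term s v k)%E.

Definition inHs (s : R) (v : fseq) : Prop :=
  v 0 = 0 /\ (forall k : int, v (- k) = conjc (v k)) /\ (hs_norm2 s v < +oo)%E.

(* the \dot H^s norm (meaningful for elements of \dot H^s) *)
Definition hs_norm (s : R) (v : fseq) : R := Num.sqrt (fine (hs_norm2 s v)).

Definition fsub (w v : fseq) : fseq := fun k => w k - v k.

(* sum over Z of a complex sequence, as the limit of the symmetric partial
   sums (all sums we use are absolutely convergent) *)
Definition psumZ (f : int -> R) (N : nat) : R :=
  \sum_(j < (2 * N).+1) f (j%:Z - N%:Z).
Definition csumZ (f : int -> R[i]) : R[i] :=
  Complex (limn (psumZ (fun j => complex.Re (f j)))) (limn (psumZ (fun j => complex.Im (f j)))).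

Definition cexpi (theta : R) : R[i] := Complex (cos theta) (sin theta).

Definition kdv_nonlin (v : fseq) (k : int) (tau : R) : R[i] :=
  csumZ (fun k1 => if (k1 != 0) && (k - k1 != 0) then
            cexpi ((3 * k * k1 * (k - k1))%:~R * tau) * v k1 * v (k - k1)
          else 0).

Definition cint (t : R) (g : R -> R[i]) : R[i] :=
  Complex (Rintegral lebesgue_measure `[0, t] (fun x => complex.Re (g x)))
          (Rintegral lebesgue_measure `[0, t] (fun x => complex.Im (g x))).

Definition Linf_H0 (T : R) (v : R -> fseq) : Prop :=
  (forall t, 0 <= t <= T -> inHs 0 (v t)) /\
  (forall k : int, measurable_fun `[0, T] (fun t => complex.Re (v t k)) /\
                   measurable_fun `[0, T] (fun t => complex.Im (v t k))) /\
  exists M : R, forall t, 0 <= t <= T -> (hs_norm2 0 (v t) <= M%:E)%E.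

Definition is_solution (T : R) (v0 : fseq) (v : R -> fseq) : Prop :=
  Linf_H0 T v /\
  forall (k : int) (t : R), 0 <= t <= T ->
    v t k - v0 k = Complex 0 (2%:R^-1 * k%:~R) * cint t (fun tau => kdv_nonlin (v tau) k tau).

Definition cont_Hs (s T : R) (v : R -> fseq) : Prop :=
  (forall t, 0 <= t <= T -> inHs s (v t)) /\
  forall t0, 0 <= t0 <= T -> forall eps : R, 0 < eps ->
    exists2 delta : R, 0 < delta &
      forall t, 0 <= t <= T -> `|t - t0| < delta ->
        hs_norm s (fsub (v t) (v t0)) < eps.
End KdV.

(* Main.v *)
(** Put [p = k1 + k2], [q = k1 + k3], [r = k2 + k3].  A cubic interaction [k = k1 + k2 + k3]
    carries the phase [3pqr], so two differentiations by parts in time turn [v_k] into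
    [v_k - B2 + B3], whose derivative consists of the resonant cubic terms ([pq = 0]) and of
    quartic terms with the kernels [1/(pqr)], [1/(k1 q r)], etc.  By duality and
    Cauchy-Schwarz these forms are bounded in l^2, even when one of their arguments is the
    nonlinearity itself, which is only bounded in l^inf, by the square of the H^0 norm.  On the
    frequencies [|k| >= n] the boundary terms [B2], [B3] gain a factor [1/n], and on the others
    the equation itself gives a Lipschitz bound.  Hence over a short time, depending only on
    bounds for the solutions, their difference moves in H^s by at most half of its size;
    for a single solution the H^0 bound suffices.  Iterating this yields the Lipschitz dependence, uniqueness
    ([s = 0]), an a priori bound and equicontinuity in H^s, uniformly for the Galerkin
    truncations, which conserve the H^0 norm.  The latter are obtained as limits of Euler
    polygons, and converge along an ultrafilter; as [s > 0], the H^s bound makes the convergence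
    strong in H^0, which suffices for the nonlinearity and for the conservation law. *)
Require Import Defs.
From HB Require Import structures.
From mathcomp Require Import all_boot all_order all_algebra.
From mathcomp Require Import all_classical all_reals all_analysis.
From mathcomp Require Import measurable_realfun complex.
From mathcomp Require Import zify ring lra.
Import Order.TTheory GRing.Theory Num.Theory.
Import numFieldNormedType.Exports.
Local Open Scope ring_scope.
Set Implicit Arguments. Unset Strict Implicit. Unset Printing Implicit Defensive.
Local Open Scope classical_set_scope.

(** * Weighted sequences and multilinear estimates *)

(** The factor [k] of the equation costs a derivative, and a solution is only known to be bounded in
    H^0. A single differentiation by parts leaves terms with kernel 1/k1 in which one argument, the
    nonlinearity, is merely in l^inf; these are not controlled in l^2, whence the second one. The
    sums are infinite and cannot be differentiated term by term: they are cut at [M] and [M'], all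
    estimates are uniform in the cuts, and the errors vanish by dominated convergence.

    Sizes and differences are recorded separately in H^0 and H^s, as [a], [t], [d], [e]. All bounds
    have the form c(s, a) (e + d t), linear in the H^s quantities, which is why no H^s bound enters
    the time step for a single solution. The predicate [A] of active frequencies lets the same
    estimates serve the full system and its truncations.

    In the limit, the obstacle is equicontinuity in time of the nonlinearity, whose phases 3 k k1 k2
    t are arbitrarily fast; returning to the coefficients of u makes it autonomous up to one
    phase. *)

Section Sums.
Variable R : realType.
Implicit Types (a b c C : R).

(* For nonnegative [f], the statement [sum f <= C]; families indexed by an infinite type
   only enter through their finite sums. *)
Definition sumle (I : eqType) (f : I -> R) C : Prop :=
  forall L : seq I, uniq L -> \sum_(x <- L) f x <= C.

Lemma ler_of_eq (a b : R) : a = b -> a <= b.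
Proof. by move->. Qed.

Lemma sumle_ge0 (I : eqType) (f : I -> R) C : sumle f C -> 0 <= C.
Proof. by move=> /(_ [::] isT); rewrite big_nil. Qed.

Lemma sumle_le (I : eqType) (f g : I -> R) C D :
  (forall x, f x <= g x) -> C <= D -> sumle g C -> sumle f D.
Proof.
move=> fg CD hg L uL; apply: le_trans CD; apply: le_trans (hg L uL).
by apply: ler_sum => i _.
Qed.

Lemma sumle_comp (I J : eqType) (g : I -> J) (f : J -> R) C :
  injective g -> sumle f C -> sumle (fun x => f (g x)) C.
Proof.
by move=> gi hf L uL; rewrite -(big_map g predT f); apply: hf; rewrite map_inj_uniq.
Qed.

Lemma ler_sum_subset (I : eqType) (f : I -> R) (L L' : seq I) :
  (forall x, 0 <= f x) -> uniq L -> {subset L <= L'} ->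
  \sum_(x <- L) f x <= \sum_(x <- L') f x.
Proof.
move=> f0 uL sL.
have : perm_eq L [seq x <- undup L' | x \in L].
  apply: uniq_perm => //; first by rewrite filter_uniq ?undup_uniq.
  by move=> x; rewrite mem_filter mem_undup; case: (boolP (x \in L)) => // /sL.
move=> pL; rewrite (perm_big _ pL) big_filter /=.
apply: (@le_trans _ _ (\sum_(x <- undup L') f x)).
  rewrite [leRHS](bigID (mem L)) /= lerDl; exact: sumr_ge0.
elim: L' {sL pL} => [|x L' IH] //=; case: ifP => _; rewrite !big_cons ?lerD2l //.
by rewrite (le_trans IH) // lerDr.
Qed.

Lemma sumle_prod (I J : eqType) (f : I -> R) (g : J -> R) C D :
  (forall x, 0 <= f x) -> (forall x, 0 <= g x) -> sumle f C -> sumle g D ->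
  sumle (fun p : I * J => f p.1 * g p.2) (C * D).
Proof.
move=> f0 g0 hf hg L uL.
set L1 := undup (map fst L); set L2 := undup (map snd L).
apply: (@le_trans _ _ (\sum_(p <- [seq (x, y) | x <- L1, y <- L2]) f p.1 * g p.2)).
  apply: ler_sum_subset => //; first by move=> x; apply: mulr_ge0.
  move=> [x y] xy; apply/allpairsP; exists (x, y).
  by rewrite !mem_undup; split => //; apply/mapP; exists (x, y).
rewrite big_allpairs /=; under eq_bigr do rewrite -mulr_sumr.
rewrite -mulr_suml; apply: ler_pM => //; rewrite ?sumr_ge0 //.
- by apply: hf; apply: undup_uniq.
- by apply: hg; apply: undup_uniq.
Qed.

Lemma sumr_sqr_eq0 (I : Type) (L : seq I) (X Y : I -> R) :
  \sum_(x <- L) X x ^+ 2 = 0 -> \sum_(x <- L) X x * Y x = 0.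
Proof.
elim: L => [|x L IH]; rewrite ?big_nil ?big_cons //.
have h1 : 0 <= X x ^+ 2 by rewrite sqr_ge0.
have h2 : 0 <= \sum_(x <- L) X x ^+ 2 by apply: sumr_ge0 => i _; rewrite sqr_ge0.
move=> /eqP; rewrite paddr_eq0 // => /andP[]; rewrite sqrf_eq0 => /eqP -> /eqP /IH ->.
by rewrite mul0r addr0.
Qed.

(** The quadratic polynomial in t given by the sum of (X t - Y)^2 is nonnegative; it is evaluated at
    its minimiser [b / a]. *)
Lemma cauchy_schwarz (I : Type) (L : seq I) (X Y : I -> R) :
  (\sum_(x <- L) X x * Y x) ^+ 2 <=
  (\sum_(x <- L) X x ^+ 2) * (\sum_(x <- L) Y x ^+ 2).
Proof.
set a := \sum_(x <- L) X x ^+ 2; set b := \sum_(x <- L) _; set c := \sum_(x <- L) Y x ^+ 2.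
have h t : 0 <= a * t ^+ 2 - (b * t) *+ 2 + c.
  have -> : a * t ^+ 2 - (b * t) *+ 2 + c = \sum_(x <- L) (X x * t - Y x) ^+ 2.
    rewrite /a /b /c !mulr_suml -sumrMnl -sumrB -big_split /=.
    by apply: eq_bigr => i _; ring.
  by apply: sumr_ge0 => i _; rewrite sqr_ge0.
have a0 : 0 <= a by apply: sumr_ge0 => i _; rewrite sqr_ge0.
have [a00|an0] := eqVneq a 0.
  by rewrite {1}/b sumr_sqr_eq0 // a00 mul0r expr0n.
have {a0 an0} a0 : 0 < a by rewrite lt_neqAle eq_sym an0.
have := h (b / a).
have -> : a * (b / a) ^+ 2 - b * (b / a) *+ 2 + c = (a * c - b ^+ 2) / a.
  by field; rewrite gt_eqF.
by rewrite pmulr_lge0 ?invr_gt0 // subr_ge0.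
Qed.

Lemma sum_mul_le (I : eqType) (L : seq I) (f X Y : I -> R) A B :
  0 <= A -> 0 <= B ->
  sumle (fun x => X x ^+ 2) (A ^+ 2) -> sumle (fun x => Y x ^+ 2) (B ^+ 2) ->
  (forall x, f x <= X x * Y x) -> uniq L -> \sum_(x <- L) f x <= A * B.
Proof.
move=> A0 B0 hX hY hf uL.
apply: (@le_trans _ _ (\sum_(x <- L) X x * Y x)); first by apply: ler_sum => i _.
apply: le_trans (ler_norm _) _.
rewrite -(@ler_pXn2r _ 2) ?nnegrE ?mulr_ge0 // real_normK ?num_real //.
rewrite (le_trans (cauchy_schwarz _ _ _)) // exprMn.
by apply: ler_pM; rewrite ?hX ?hY //; apply: sumr_ge0 => i _; rewrite sqr_ge0.
Qed.

Lemma sumle_nat (g : nat -> R) C :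
  (forall n, 0 <= g n) -> (forall m, \sum_(i < m) g i <= C) -> sumle g C.
Proof.
move=> g0 hC L uL.
apply: le_trans (hC (\max_(i <- L) i).+1).
rewrite -(big_mkord predT g); apply: ler_sum_subset => // x xL.
by rewrite mem_index_iota /= ltnS leq_bigmax_seq.
Qed.

(* [iv 0 = 0], by [0^-1 = 0]: the frequency 0 drops out of all kernels. *)
Definition iv (k : int) : R := (`|k|%:~R)^-1.

Lemma iv_ge0 k : 0 <= iv k.
Proof. by rewrite invr_ge0 ler0z. Qed.

Lemma iv0 : iv 0 = 0.
Proof. by rewrite /iv normr0 invr0. Qed.

Lemma iv_le1 k : iv k <= 1.
Proof.
have [->|k0] := eqVneq k 0; first by rewrite iv0.
by rewrite invf_le1 ?ltr0z ?normr_gt0 // ler1z; lia.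
Qed.

Lemma normMiv k : k != 0 -> `|k|%:~R * iv k = 1.
Proof. by move=> k0; rewrite divff // intr_eq0 normr_eq0. Qed.

Lemma ivN k : iv (- k) = iv k.
Proof. by rewrite /iv normrN. Qed.

Lemma sum_inv_sqr_le m : \sum_(i < m) ((i%:R : R)^-1) ^+ 2 <= 2.
Proof.
(* The remainder 1/(m+1) makes the induction work, as 1/(x+1)^2 <= 1/x - 1/(x+1). The range starts
   at [m.+2] because the term i = 0 is zero and i = 1 opens the telescope. *)
suff h : \sum_(i < m.+2) ((i%:R : R)^-1) ^+ 2 <= 2 - m.+1%:R^-1.
  have: \sum_(i < m.+2) ((i%:R : R)^-1) ^+ 2 <= 2.
    by apply: le_trans h _; rewrite gerBl.
  apply: le_trans; rewrite !big_ord_recr /= -addrA lerDl.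
  by rewrite addr_ge0 // sqr_ge0.
elim: m => [|m IH].
  by rewrite !big_ord_recr big_ord0 /= invr0 invr1 expr0n expr1n /=; lra.
rewrite big_ord_recr /= (le_trans (lerD IH (lexx _))) //.
have m0 : 0 < m.+1%:R :> R by rewrite ltr0n.
have -> : m.+2%:R = m.+1%:R + 1 :> R by rewrite -natr1.
move: (m.+1%:R) m0 => x x0.
rewrite -subr_ge0.
have -> : 2 - (x + 1)^-1 - (2 - x^-1 + (x + 1)^-1 ^+ 2) = (x * (x + 1) ^+ 2)^-1 :> R.
  by field; rewrite !gt_eqF //; lra.
by rewrite invr_ge0 mulr_ge0 ?sqr_ge0 // ltW.
Qed.

(** [absz] is injective on each of the half-lines k >= 0 and k < 0, so the bound 2 over the naturals
    is doubled. *)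
Lemma sumle_iv : sumle (fun k => iv k ^+ 2) (2 ^+ 2).
Proof.
have hn : sumle (fun n : nat => ((n%:R : R)^-1) ^+ 2) 2.
  by apply: sumle_nat => [n|m]; rewrite ?sqr_ge0 ?sum_inv_sqr_le.
have key (P : pred int) (L : seq int) : uniq L -> {in P &, injective absz} ->
    \sum_(k <- L | P k) iv k ^+ 2 <= 2.
  move=> uL iP; rewrite -big_filter.
  under eq_bigr do rewrite /iv -abszE -pmulrn.
  rewrite -(big_map absz predT (fun n : nat => ((n%:R : R)^-1) ^+ 2)); apply: hn.
  rewrite map_inj_in_uniq ?filter_uniq // => x y.
  by rewrite !mem_filter => /andP[Px _] /andP[Py _]; apply: iP.
move=> L uL; rewrite (bigID (fun k : int => 0 <= k)) /=.
have -> : 2 ^+ 2 = 2 + 2 :> R by ring.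
by apply: lerD; apply: key => // x y; rewrite /in_mem /=; lia.
Qed.

End Sums.

(** * The real-valued modulus of complex numbers *)

Section ComplexModulus.
Variable R : realType.
Implicit Types (x y z w : R[i]).

Definition cn z : R := Normc.normc z.

Lemma cn_sqr z : cn z ^+ 2 = cabs2 z.
Proof. by case: z => a b; rewrite /cn /Normc.normc /cabs2 /= sqr_sqrtr // addr_ge0 ?sqr_ge0. Qed.

Lemma cn_ge0 z : 0 <= cn z.
Proof. by case: z => a b; exact: sqrtr_ge0. Qed.

Lemma cnM z w : cn (z * w) = cn z * cn w.
Proof. exact: Normc.normcM. Qed.

Lemma cnD z w : cn (z + w) <= cn z + cn w.
Proof. exact: le_normcD. Qed.

Lemma cnN z : cn (- z) = cn z.
Proof. exact: normcN. Qed.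

Lemma cn0 : cn 0 = 0 :> R.
Proof. exact: Normc.normc0. Qed.

Lemma cnV z : cn z^-1 = (cn z)^-1.
Proof. exact: Normc.normcV. Qed.

Lemma cn_eq0 z : cn z = 0 -> z = 0.
Proof. exact: Normc.eq0_normc. Qed.

Lemma cnB z w : cn (z - w) <= cn z + cn w.
Proof. by rewrite -(cnN w) cnD. Qed.

Lemma cnBC z w : cn (z - w) = cn (w - z).
Proof. by rewrite -cnN opprB. Qed.

Lemma cn_distD z x y : cn (x - y) <= cn (x - z) + cn (z - y).
Proof. by rewrite -[x - y](subrKA z) cnD. Qed.

Lemma cn_sum (I : Type) (r : seq I) (P : pred I) (F : I -> R[i]) :
  cn (\sum_(i <- r | P i) F i) <= \sum_(i <- r | P i) cn (F i).
Proof.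
elim: r => [|i r IH]; rewrite ?big_nil ?cn0 // !big_cons; case: ifP => // _.
by rewrite (le_trans (cnD _ _)) // lerD2l.
Qed.

Lemma cn_imag (a : R) : cn (Complex 0 a) = `|a|.
Proof. by rewrite /cn /Normc.normc expr0n add0r sqrtr_sqr. Qed.

Lemma cn_real (a : R) : cn (a%:C)%C = `|a|.
Proof. by rewrite /cn /Normc.normc /= expr0n addr0 sqrtr_sqr. Qed.

Lemma intC (n : int) : (n%:~R : R[i]) = ((n%:~R : R)%:C)%C.
Proof. by rewrite rmorph_int. Qed.

Lemma cn_int (n : int) : cn (n%:~R) = `|n|%:~R.
Proof. by rewrite intC cn_real intr_norm. Qed.

Lemma cn_conj z : cn (conjc z) = cn z.
Proof. by case: z => a b; rewrite /cn /Normc.normc /= sqrrN. Qed.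

Lemma cn_cexpi (t : R) : cn (cexpi t) = 1.
Proof. by rewrite /cn /Normc.normc /cexpi cos2Dsin2 sqrtr1. Qed.

Lemma cn_Re z : `|complex.Re z| <= cn z.
Proof.
case: z => a b /=; rewrite -sqrtr_sqr /cn /Normc.normc.
by rewrite ler_wsqrtr // lerDl sqr_ge0.
Qed.

Lemma cn_Im z : `|complex.Im z| <= cn z.
Proof.
case: z => a b /=; rewrite -sqrtr_sqr /cn /Normc.normc.
by rewrite ler_wsqrtr // lerDr sqr_ge0.
Qed.

Lemma cn_le_ReIm z : cn z <= `|complex.Re z| + `|complex.Im z|.
Proof.
have -> : z = (complex.Re z)%:C%C + Complex 0 (complex.Im z).
  by case: z => a b; apply/eqP; rewrite eq_complex /= addr0 add0r !eqxx.
by rewrite (le_trans (cnD _ _)) // cn_real cn_imag /= addr0 add0r.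
Qed.

Lemma ReD z w : complex.Re (z + w) = complex.Re z + complex.Re w.
Proof. by case: z w => a b [c d]. Qed.

Lemma ImD z w : complex.Im (z + w) = complex.Im z + complex.Im w.
Proof. by case: z w => a b [c d]. Qed.

Lemma ReN z : complex.Re (- z) = - complex.Re z.
Proof. by case: z. Qed.

Lemma ImN z : complex.Im (- z) = - complex.Im z.
Proof. by case: z. Qed.

Lemma ReM z w : complex.Re (z * w) =
  complex.Re z * complex.Re w - complex.Im z * complex.Im w.
Proof. by case: z w => a b [c d]. Qed.

Lemma ImM z w : complex.Im (z * w) =
  complex.Re z * complex.Im w + complex.Im z * complex.Re w.
Proof. by case: z w => a b [c d] /=; rewrite addrC. Qed.

Lemma Re_sum (I : Type) (r : seq I) (P : pred I) (F : I -> R[i]) :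
  complex.Re (\sum_(i <- r | P i) F i) = \sum_(i <- r | P i) complex.Re (F i).
Proof. exact: (big_morph _ ReD). Qed.

Lemma Im_sum (I : Type) (r : seq I) (P : pred I) (F : I -> R[i]) :
  complex.Im (\sum_(i <- r | P i) F i) = \sum_(i <- r | P i) complex.Im (F i).
Proof. exact: (big_morph _ ImD). Qed.

Lemma cexpiD (s t : R) : cexpi (s + t) = cexpi s * cexpi t.
Proof.
apply/eqP; rewrite eq_complex /cexpi /= cosD sinD eqxx /=.
by rewrite addrC [_ * cos t]mulrC mulrC eqxx //= ; apply/eqP; ring.
Qed.

End ComplexModulus.

#[global] Arguments cn : simpl never.

(** * Trilinear forms bounded on l^2 *)

Section Kernels.
Variable R : realType.

Definition l2b (f : int -> R) (A : R) := sumle (fun k => f k ^+ 2) (A ^+ 2).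

(* An argument of a multilinear form, bounded in l^2 or in l^inf. *)
Definition slotb (b : bool) (f : int -> R) (A : R) :=
  if b then l2b f A else forall k, f k <= A.

Lemma l2b_le (f g : int -> R) A B : 0 <= A <= B -> (forall k, 0 <= f k <= g k) ->
  l2b g A -> l2b f B.
Proof.
move=> /andP[A0 AB] fg; apply: sumle_le.
- by move=> k; have /andP[f0 fgk] := fg k; rewrite ler_pXn2r ?nnegrE // (le_trans f0).
- by rewrite ler_pXn2r ?nnegrE // (le_trans A0).
Qed.

Lemma l2b_sup (f : int -> R) A k : 0 <= A -> l2b f A -> f k <= A.
Proof.
move=> A0 /(_ [:: k] isT); rewrite big_seq1 => h.
rewrite (le_trans (ler_norm _)) //.
by rewrite -(@ler_pXn2r _ 2) ?nnegrE // real_normK ?num_real.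
Qed.

Lemma l2b_iv : l2b (@iv R) 2.
Proof. exact: sumle_iv. Qed.

Definition dl0 (k : int) : R := (k == 0)%:R.

Lemma l2b_dl0 : l2b dl0 1.
Proof.
rewrite /l2b expr1n; move=> L uL.
apply: (@le_trans _ _ (\sum_(k <- L) (if k == 0 then 1 else 0))).
  by apply: ler_sum => k _; rewrite /dl0; case: eqP; rewrite ?expr1n ?expr0n.
rewrite -big_mkcond /= big_const_seq iter_addr_0 -[leRHS]/(1%:R) ler_nat.
by rewrite (count_uniq_mem 0 uL) leq_b1.
Qed.

Definition trip := (int * int * int)%type.

Lemma sumle_sqr3 (u1 u2 u3 : int -> R) A1 A2 A3 (g : trip -> trip) :
  injective g -> l2b u1 A1 -> l2b u2 A2 -> l2b u3 A3 ->
  sumle (fun x => (u1 (g x).1.1 * u2 (g x).1.2 * u3 (g x).2) ^+ 2)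
        ((A1 * A2 * A3) ^+ 2).
Proof.
move=> gi h1 h2 h3.
have sq (u : int -> R) k : 0 <= u k ^+ 2 by exact: sqr_ge0.
have h12 := sumle_prod (sq u1) (sq u2) h1 h2.
have h123 := sumle_prod (fun x => mulr_ge0 (sq u1 x.1) (sq u2 x.2)) (sq u3) h12 h3.
have := sumle_comp gi h123; rewrite -!exprMn.
by apply: sumle_le => // x /=; rewrite !exprMn.
Qed.

Definition sumtri (W : int -> int -> int -> R) (phi f1 f2 f3 : int -> R) (L : seq trip) :=
  \sum_(x <- L) phi x.1.1 * W x.1.1 x.1.2 x.2 *
     (f1 x.1.2 * f2 x.2 * f3 (x.1.1 - x.1.2 - x.2)).

(* The trilinear form with kernel [W] is bounded into l^2, by duality with [phi]; the flags
   tell which of the arguments are taken in l^2. *)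
Definition tribound (W : int -> int -> int -> R) (b1 b2 b3 : bool) (C : R) :=
  forall (phi f1 f2 f3 : int -> R) (P a1 a2 a3 : R),
    [/\ forall k, 0 <= phi k, forall k, 0 <= f1 k, forall k, 0 <= f2 k &
        forall k, 0 <= f3 k] ->
    [/\ 0 <= P, 0 <= a1, 0 <= a2 & 0 <= a3] ->
    l2b phi P -> slotb b1 f1 a1 -> slotb b2 f2 a2 -> slotb b3 f3 a3 ->
    forall L, uniq L -> sumtri W phi f1 f2 f3 L <= C * P * a1 * a2 * a3.

Lemma triboundD W V b1 b2 b3 C D :
  tribound W b1 b2 b3 C -> tribound V b1 b2 b3 D ->
  tribound (fun k k1 k2 => W k k1 k2 + V k k1 k2) b1 b2 b3 (C + D).
Proof.
move=> hW hV phi f1 f2 f3 P a1 a2 a3 f0 a0 hp h1 h2 h3 L uL.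
have := lerD (hW _ _ _ _ _ _ _ _ f0 a0 hp h1 h2 h3 L uL)
             (hV _ _ _ _ _ _ _ _ f0 a0 hp h1 h2 h3 L uL).
rewrite -!mulrDl -big_split /=; apply: le_trans.
by apply: ler_sum => x _; rewrite -mulrDl -mulrDr.
Qed.

Lemma triboundZ W b1 b2 b3 C c : 0 <= c ->
  tribound W b1 b2 b3 C -> tribound (fun k k1 k2 => c * W k k1 k2) b1 b2 b3 (c * C).
Proof.
move=> c0 hW phi f1 f2 f3 P a1 a2 a3 f0 a0 hp h1 h2 h3 L uL.
have := ler_wpM2l c0 (hW _ _ _ _ _ _ _ _ f0 a0 hp h1 h2 h3 L uL).
rewrite !mulrA mulr_sumr; apply: le_trans.
by apply: ler_sum => x _; apply: ler_of_eq; ring.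
Qed.

(* Cauchy-Schwarz for [W phi f1 f2 f3 <= X Y], where X^2 and Y^2 are products of
   functions of three integer variables that determine the triple. *)
Lemma sumtri_le W phi f1 f2 f3 (u1 u2 u3 v1 v2 v3 : int -> R) A1 A2 A3 B1 B2 B3
    (g h : trip -> trip) L :
  injective g -> injective h ->
  [/\ 0 <= A1, 0 <= A2 & 0 <= A3] -> [/\ 0 <= B1, 0 <= B2 & 0 <= B3] ->
  l2b u1 A1 -> l2b u2 A2 -> l2b u3 A3 -> l2b v1 B1 -> l2b v2 B2 -> l2b v3 B3 ->
  (forall x : trip, phi x.1.1 * W x.1.1 x.1.2 x.2 *
     (f1 x.1.2 * f2 x.2 * f3 (x.1.1 - x.1.2 - x.2)) <=
     (u1 (g x).1.1 * u2 (g x).1.2 * u3 (g x).2) *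
     (v1 (h x).1.1 * v2 (h x).1.2 * v3 (h x).2)) ->
  uniq L -> sumtri W phi f1 f2 f3 L <= (A1 * A2 * A3) * (B1 * B2 * B3).
Proof.
move=> gi hi [? ? ?] [? ? ?] hu1 hu2 hu3 hv1 hv2 hv3 le uL.
apply: sum_mul_le le uL; rewrite ?mulr_ge0 //; exact: sumle_sqr3.
Qed.

Ltac trip_inj := move=> [[? ?] ?] [[? ?] ?] /= [? ? ?]; congr (_, _, _); lia.

Let iv0_ := @iv_ge0 R.
Let two0 : 0 <= 2 :> R := ler0n _ 2.

Lemma dl0_ge0 k : 0 <= dl0 k.
Proof. exact: ler0n. Qed.

Lemma dl0_sqr k : dl0 k * dl0 k = dl0 k.
Proof. by rewrite /dl0; case: eqP; rewrite ?mulr1 ?mulr0. Qed.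

Notation ii := (@iv R).

(** The constraint k1 + k2 = 0 is its own square, so it can be used in both Cauchy-Schwarz factors,
    where it makes the third variable summable. *)
Lemma tri_res_p : tribound (fun k k1 k2 => dl0 (k1 + k2)) true true true 1.
Proof.
move=> phi f1 f2 f3 P a1 a2 a3 [p0 f10 f20 f30] [? ? ? ?] hp h1 h2 h3 L uL.
apply: le_trans (@sumtri_le _ _ _ _ _ phi f1 dl0 f2 f3 dl0 P a1 1 a2 a3 1
  (fun x => (x.1.1, x.1.2, x.1.2 + x.2))
  (fun x => (x.2, x.1.1 - x.1.2 - x.2, x.1.2 + x.2)) L _ _ _ _ _ _ _ _ _ _ _ uL) _ => //;
  try trip_inj; try exact: l2b_dl0.
- move=> [[k k1] k2] /=; rewrite -{1}dl0_sqr; apply: ler_of_eq; ring.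
- by apply: ler_of_eq; ring.
Qed.

Lemma tri_res_q : tribound (fun k k1 k2 => dl0 (k - k2)) true true true 1.
Proof.
move=> phi f1 f2 f3 P a1 a2 a3 [p0 f10 f20 f30] [? ? ? ?] hp h1 h2 h3 L uL.
apply: le_trans (@sumtri_le _ _ _ _ _ phi f1 dl0 f2 f3 dl0 P a1 1 a2 a3 1
  (fun x => (x.1.1, x.1.2, x.1.1 - x.2))
  (fun x => (x.2, x.1.1 - x.1.2 - x.2, x.1.1 - x.2)) L _ _ _ _ _ _ _ _ _ _ _ uL) _ => //;
  try trip_inj; try exact: l2b_dl0.
- move=> [[k k1] k2] /=; rewrite -{1}dl0_sqr; apply: ler_of_eq; ring.
- by apply: ler_of_eq; ring.
Qed.

Lemma le_trans_eq2 (a b c d : R) : c = a -> b = d -> a <= b -> c <= d.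
Proof. by move=> -> ->. Qed.

Lemma l2b_scale (f : int -> R) c A : l2b f A -> l2b (fun k => c * f k) (c * A).
Proof.
move=> h L uL; under eq_bigr do rewrite exprMn; rewrite -mulr_sumr exprMn.
by rewrite ler_wpM2l ?sqr_ge0 ?h.
Qed.

(** The factor 1/p is paired with [phi] and [f1], the factor 1/k1 with [f2] and [f3]; each group of
    three variables determines the triple. The constant is 2 * 2, from the two l^2 norms of [iv]. *)
Lemma tri_1p : tribound (fun k k1 k2 => ii k1 * ii (k1 + k2)) true true true 4.
Proof.
move=> phi f1 f2 f3 P a1 a2 a3 [p0 f10 f20 f30] [? ? ? ?] hp h1 h2 h3 L uL.
apply: le_trans (@sumtri_le _ _ _ _ _ phi f1 ii f2 f3 ii P a1 2 a2 a3 2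
  (fun x => (x.1.1, x.1.2, x.1.2 + x.2))
  (fun x => (x.2, x.1.1 - x.1.2 - x.2, x.1.2)) L _ _ _ _ _ _ _ _ _ _ _ uL) _ => //;
  try trip_inj; try exact: l2b_iv.
- move=> [[k k1] k2] /=; apply: ler_of_eq; ring.
- by apply: ler_of_eq; ring.
Qed.

Lemma tri_1q : tribound (fun k k1 k2 => ii k1 * ii (k - k2)) true true true 4.
Proof.
move=> phi f1 f2 f3 P a1 a2 a3 [p0 f10 f20 f30] [? ? ? ?] hp h1 h2 h3 L uL.
apply: le_trans (@sumtri_le _ _ _ _ _ phi f1 ii f2 f3 ii P a1 2 a2 a3 2
  (fun x => (x.1.1, x.1.2, x.1.1 - x.2))
  (fun x => (x.2, x.1.1 - x.1.2 - x.2, x.1.2)) L _ _ _ _ _ _ _ _ _ _ _ uL) _ => //;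
  try trip_inj; try exact: l2b_iv.
- move=> [[k k1] k2] /=; apply: ler_of_eq; ring.
- by apply: ler_of_eq; ring.
Qed.

(** [f1] is only bounded and comes out as [a1]; the place it leaves is taken by a kernel factor, so
    that [phi] f2 / p is paired with f3 / (q r), and the constant is 2^3. The variants below differ
    in which pairing still determines the triple. *)
Lemma tri_q1 : tribound (fun k k1 k2 => ii (k1 + k2) * ii (k - k2) * ii (k - k1)) false true true 8.
Proof.
move=> phi f1 f2 f3 P a1 a2 a3 [p0 f10 f20 f30] [? ? ? ?] hp h1 h2 h3 L uL.
apply: le_trans (@sumtri_le _ _ _ _ _ (fun k => a1 * phi k) f2 ii f3 ii ii (a1 * P) a2 2 a3 2 2
  (fun x => (x.1.1, x.2, x.1.2 + x.2))
  (fun x => (x.1.1 - x.1.2 - x.2, x.1.1 - x.2, x.1.1 - x.1.2)) L _ _ _ _ _ _ _ _ _ _ _ uL) _ => //;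
  try trip_inj; try exact: l2b_iv; try exact: l2b_scale; try (split; rewrite ?mulr_ge0 //).
- move=> [[k k1] k2] /=.
  have := ler_wpM2r (mulr_ge0 (mulr_ge0 (p0 k) (mulr_ge0 (f20 k2) (f30 (k - k1 - k2))))
    (mulr_ge0 (mulr_ge0 (iv0_ (k1 + k2)) (iv0_ (k - k2))) (iv0_ (k - k1)))) (h1 k1).
  apply: le_trans_eq2; ring.
- by apply: ler_of_eq; ring.
Qed.

Lemma tri_q2a : tribound (fun k k1 k2 => ii (k1) * ii (k - k2) * ii (k - k1)) true false true 8.
Proof.
move=> phi f1 f2 f3 P a1 a2 a3 [p0 f10 f20 f30] [? ? ? ?] hp h1 h2 h3 L uL.
apply: le_trans (@sumtri_le _ _ _ _ _ (fun k => a2 * phi k) f1 ii f3 ii ii (a2 * P) a1 2 a3 2 2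
  (fun x => (x.1.1, x.1.2, x.1.1 - x.2))
  (fun x => (x.1.1 - x.1.2 - x.2, x.1.2, x.1.1 - x.1.2)) L _ _ _ _ _ _ _ _ _ _ _ uL) _ => //;
  try trip_inj; try exact: l2b_iv; try exact: l2b_scale; try (split; rewrite ?mulr_ge0 //).
- move=> [[k k1] k2] /=.
  have := ler_wpM2r (mulr_ge0 (mulr_ge0 (p0 k) (mulr_ge0 (f10 k1) (f30 (k - k1 - k2))))
    (mulr_ge0 (mulr_ge0 (iv0_ (k1)) (iv0_ (k - k2))) (iv0_ (k - k1)))) (h2 k2).
  apply: le_trans_eq2; ring.
- by apply: ler_of_eq; ring.
Qed.

Lemma tri_q2b : tribound (fun k k1 k2 => ii (k1 + k2) * ii (k - k2) * ii (k - k1)) true false true 8.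
Proof.
move=> phi f1 f2 f3 P a1 a2 a3 [p0 f10 f20 f30] [? ? ? ?] hp h1 h2 h3 L uL.
apply: le_trans (@sumtri_le _ _ _ _ _ (fun k => a2 * phi k) f1 ii f3 ii ii (a2 * P) a1 2 a3 2 2
  (fun x => (x.1.1, x.1.2, x.1.2 + x.2))
  (fun x => (x.1.1 - x.1.2 - x.2, x.1.1 - x.2, x.1.1 - x.1.2)) L _ _ _ _ _ _ _ _ _ _ _ uL) _ => //;
  try trip_inj; try exact: l2b_iv; try exact: l2b_scale; try (split; rewrite ?mulr_ge0 //).
- move=> [[k k1] k2] /=.
  have := ler_wpM2r (mulr_ge0 (mulr_ge0 (p0 k) (mulr_ge0 (f10 k1) (f30 (k - k1 - k2))))
    (mulr_ge0 (mulr_ge0 (iv0_ (k1 + k2)) (iv0_ (k - k2))) (iv0_ (k - k1)))) (h2 k2).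
  apply: le_trans_eq2; ring.
- by apply: ler_of_eq; ring.
Qed.

Lemma tri_q3a : tribound (fun k k1 k2 => ii (k1) * ii (k1 + k2) * ii (k - k1)) true true false 8.
Proof.
move=> phi f1 f2 f3 P a1 a2 a3 [p0 f10 f20 f30] [? ? ? ?] hp h1 h2 h3 L uL.
apply: le_trans (@sumtri_le _ _ _ _ _ (fun k => a3 * phi k) f1 ii f2 ii ii (a3 * P) a1 2 a2 2 2
  (fun x => (x.1.1, x.1.2, x.1.2 + x.2))
  (fun x => (x.2, x.1.2, x.1.1 - x.1.2)) L _ _ _ _ _ _ _ _ _ _ _ uL) _ => //;
  try trip_inj; try exact: l2b_iv; try exact: l2b_scale; try (split; rewrite ?mulr_ge0 //).
- move=> [[k k1] k2] /=.
  have := ler_wpM2r (mulr_ge0 (mulr_ge0 (p0 k) (mulr_ge0 (f10 k1) (f20 k2)))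
    (mulr_ge0 (mulr_ge0 (iv0_ (k1)) (iv0_ (k1 + k2))) (iv0_ (k - k1)))) (h3 (k - k1 - k2)).
  apply: le_trans_eq2; ring.
- by apply: ler_of_eq; ring.
Qed.

Lemma tri_q3b : tribound (fun k k1 k2 => ii (k1 + k2) * ii (k - k2) * ii (k - k1)) true true false 8.
Proof.
move=> phi f1 f2 f3 P a1 a2 a3 [p0 f10 f20 f30] [? ? ? ?] hp h1 h2 h3 L uL.
apply: le_trans (@sumtri_le _ _ _ _ _ (fun k => a3 * phi k) f1 ii f2 ii ii (a3 * P) a1 2 a2 2 2
  (fun x => (x.1.1, x.1.2, x.1.1 - x.2))
  (fun x => (x.2, x.1.2 + x.2, x.1.1 - x.1.2)) L _ _ _ _ _ _ _ _ _ _ _ uL) _ => //;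
  try trip_inj; try exact: l2b_iv; try exact: l2b_scale; try (split; rewrite ?mulr_ge0 //).
- move=> [[k k1] k2] /=.
  have := ler_wpM2r (mulr_ge0 (mulr_ge0 (p0 k) (mulr_ge0 (f10 k1) (f20 k2)))
    (mulr_ge0 (mulr_ge0 (iv0_ (k1 + k2)) (iv0_ (k - k2))) (iv0_ (k - k1)))) (h3 (k - k1 - k2)).
  apply: le_trans_eq2; ring.
- by apply: ler_of_eq; ring.
Qed.

End Kernels.

(** * Weights |k|^s and difference estimates *)

Section Weights.
Variable R : realType.
Notation C := (R[i]).
Notation ii := (@iv R).

Definition wt (s : R) (k : int) : R := (`|k|%:~R) `^ s.

Lemma wt_ge0 s k : 0 <= wt s k.
Proof. exact: powR_ge0. Qed.

(** One constant for both splittings of the weight: 2^s suffices for two frequencies, and applying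
    that twice gives its square for three. *)
Definition cw (s : R) : R := 2 `^ s + (2 `^ s) ^+ 2.

Lemma cw_ge0 s : 0 <= cw s.
Proof. by rewrite addr_ge0 ?sqr_ge0 ?powR_ge0. Qed.

Lemma wtD2 s j k : 0 <= s -> wt s (j + k) <= 2 `^ s * (wt s j + wt s k).
Proof.
move=> s0.
wlog jk : j k / `|j| <= `|k|.
  move=> H; case: (leP `|j| `|k|) => [/H//|/ltW /H]; by rewrite addrC [wt s k + _]addrC.
apply: (@le_trans _ _ (2 `^ s * wt s k)); last first.
  by rewrite ler_wpM2l ?powR_ge0 // lerDr wt_ge0.
rewrite /wt -powRM ?ler0z //; apply: ge0_ler_powR => //; rewrite ?nnegrE ?mulr_ge0 ?ler0z //.
have -> : 2 = 2%:~R :> R by [].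
by rewrite -intrM ler_int; lia.
Qed.

Lemma wtD s j k : 0 <= s -> wt s (j + k) <= cw s * (wt s j + wt s k).
Proof.
move=> s0; rewrite (le_trans (wtD2 _ _ s0)) // ler_wpM2r ?addr_ge0 ?wt_ge0 //.
by rewrite lerDl sqr_ge0.
Qed.

Lemma wtD3 s j k l : 0 <= s -> wt s (j + k + l) <= cw s * (wt s j + wt s k + wt s l).
Proof.
move=> s0; rewrite (le_trans (wtD2 _ _ s0)) //.
have c0 : 0 <= 2 `^ s :> R := powR_ge0 _ _.
have h := ler_wpM2l c0 (lerD (wtD2 j k s0) (lexx (wt s l))).
rewrite (le_trans h) // /cw.
have := wt_ge0 s j; have := wt_ge0 s k; have := wt_ge0 s l.
move: (wt s j) (wt s k) (wt s l) (2 `^ s) c0 => a b c d d0 a0 b0 c0.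
have : 0 <= d * (a + b) by rewrite mulr_ge0 ?addr_ge0.
have : 0 <= d ^+ 2 * c by rewrite mulr_ge0 ?sqr_ge0.
nra.
Qed.

Lemma wt_ge1 s k : 0 <= s -> k != 0 -> 1 <= wt s k.
Proof.
move=> s0 k0; rewrite -(powRr0 (`|k|%:~R : R)) /wt ler_powR //.
by rewrite ler1z; lia.
Qed.

Lemma wt0 k : wt 0 k = 1.
Proof. exact: powRr0. Qed.

Lemma wt0E (f : int -> C) : (fun k => wt 0 k * cn (f k)) = (fun k => cn (f k)).
Proof. by apply/funext => k; rewrite wt0 mul1r. Qed.

(* [f], [g] are of size [a], [t] and differ by [d], [e], without and with the weight. *)
Definition slotd s b (f g : int -> C) (a bt d e : R) : Prop :=
  [/\ slotb b (fun k => cn (f k)) a /\ slotb b (fun k => wt s k * cn (f k)) bt,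
      slotb b (fun k => cn (g k)) a /\ slotb b (fun k => wt s k * cn (g k)) bt,
      slotb b (fun k => cn (f k - g k)) d &
      slotb b (fun k => wt s k * cn (f k - g k)) e].

(** As k = k1 + k2 + k3, [wtD3] distributes the weight at k over the three arguments, one at a
    time. *)
Lemma tri_w s W b1 b2 b3 Cc phi (f1 f2 f3 : int -> R) P a1 a2 a3 t1 t2 t3 L :
  0 <= s -> (forall k k1 k2, 0 <= W k k1 k2) -> tribound W b1 b2 b3 Cc ->
  [/\ forall k, 0 <= phi k, forall k, 0 <= f1 k, forall k, 0 <= f2 k &
        forall k, 0 <= f3 k] ->
  0 <= P -> [/\ 0 <= a1, 0 <= a2 & 0 <= a3] -> [/\ 0 <= t1, 0 <= t2 & 0 <= t3] ->
  l2b phi P ->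
  slotb b1 f1 a1 -> slotb b2 f2 a2 -> slotb b3 f3 a3 ->
  slotb b1 (fun k => wt s k * f1 k) t1 ->
  slotb b2 (fun k => wt s k * f2 k) t2 ->
  slotb b3 (fun k => wt s k * f3 k) t3 -> uniq L ->
  sumtri (fun k k1 k2 => wt s k * W k k1 k2) phi f1 f2 f3 L <=
    cw s * (Cc * P * (t1 * a2 * a3 + a1 * t2 * a3 + a1 * a2 * t3)).
Proof.
move=> s0 W0 hW [p0 f10 f20 f30] P0 [a10 a20 a30] [t10 t20 t30] hp h1 h2 h3 w1 w2 w3 uL.
have wf0 f : (forall k, 0 <= f k) -> forall k, 0 <= wt s k * f k.
  by move=> f0 k; rewrite mulr_ge0 ?wt_ge0.
have H1 := hW phi _ _ _ P _ _ _ (And4 p0 (wf0 _ f10) f20 f30) (And4 P0 t10 a20 a30) hp w1 h2 h3 L uL.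
have H2 := hW phi _ _ _ P _ _ _ (And4 p0 f10 (wf0 _ f20) f30) (And4 P0 a10 t20 a30) hp h1 w2 h3 L uL.
have H3 := hW phi _ _ _ P _ _ _ (And4 p0 f10 f20 (wf0 _ f30)) (And4 P0 a10 a20 t30) hp h1 h2 w3 L uL.
have := ler_wpM2l (cw_ge0 s) (lerD (lerD H1 H2) H3).
rewrite -!big_split /= mulr_sumr => h.
apply: le_trans (le_trans h _); last by apply: ler_of_eq; ring.
apply: ler_sum => -[[k k1] k2] _ /=; set k3 := k - k1 - k2.
have := wtD3 k1 k2 k3 s0; have -> : k1 + k2 + k3 = k by rewrite /k3; ring.
have c0 : 0 <= phi k * W k k1 k2 * (f1 k1 * f2 k2 * f3 k3) by rewrite !mulr_ge0.
move=> /(ler_wpM2l c0); apply: le_trans_eq2; ring.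
Qed.

Lemma cn_prod3B (x1 x2 x3 y1 y2 y3 : C) : cn (x1 * x2 * x3 - y1 * y2 * y3) <=
  cn (x1 - y1) * cn x2 * cn x3 + cn y1 * cn (x2 - y2) * cn x3 + cn y1 * cn y2 * cn (x3 - y3).
Proof.
have -> : x1 * x2 * x3 - y1 * y2 * y3 =
   (x1 - y1) * x2 * x3 + y1 * (x2 - y2) * x3 + y1 * y2 * (x3 - y3) by ring.
rewrite (le_trans (cnD _ _)) // !cnM lerD2r.
by rewrite (le_trans (cnD _ _)) // !cnM.
Qed.

Lemma cn_prod2B (x1 x2 y1 y2 : C) : cn (x1 * x2 - y1 * y2) <=
  cn (x1 - y1) * cn x2 + cn y1 * cn (x2 - y2).
Proof.
have -> : x1 * x2 - y1 * y2 = (x1 - y1) * x2 + y1 * (x2 - y2) by ring.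
by rewrite (le_trans (cnD _ _)) // !cnM.
Qed.

(** Telescoping the product gives three terms with one difference each. The weight then falls on the
    difference in three cases ([e * a * a]) and on another factor in six ([d * t * a]). *)
Lemma tri_diff s W b1 b2 b3 Cc phi (f1 f2 f3 g1 g2 g3 : int -> C) P a t d e L :
  0 <= s -> (forall k k1 k2, 0 <= W k k1 k2) -> tribound W b1 b2 b3 Cc ->
  (forall k, 0 <= phi k) -> 0 <= P -> [/\ 0 <= a, 0 <= t, 0 <= d & 0 <= e] ->
  l2b phi P -> slotd s b1 f1 g1 a t d e -> slotd s b2 f2 g2 a t d e ->
  slotd s b3 f3 g3 a t d e -> uniq L ->
  \sum_(x <- L) phi x.1.1 * wt s x.1.1 * W x.1.1 x.1.2 x.2 *
     cn (f1 x.1.2 * f2 x.2 * f3 (x.1.1 - x.1.2 - x.2) -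
         g1 x.1.2 * g2 x.2 * g3 (x.1.1 - x.1.2 - x.2))
  <= cw s * Cc * P * (3 * (e * a * a) + 6 * (d * t * a)).
Proof.
move=> s0 W0 hW p0 P0 [a0 t0 d0 e0] hp.
move=> [[F1 F1w] [G1 G1w] D1 D1w] [[F2 F2w] [G2 G2w] D2 D2w] [[F3 F3w] [G3 G3w] D3 D3w] uL.
have c0 f : forall k : int, 0 <= cn (f k) :> R by move=> k; exact: cn_ge0.
have T1 := @tri_w s W b1 b2 b3 Cc phi _ _ _ P d a a e t t L s0 W0 hW
  (And4 p0 (c0 _) (c0 _) (c0 _)) P0 (And3 d0 a0 a0) (And3 e0 t0 t0) hp D1 F2 F3 D1w F2w F3w uL.
have T2 := @tri_w s W b1 b2 b3 Cc phi _ _ _ P a d a t e t L s0 W0 hW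
  (And4 p0 (c0 _) (c0 _) (c0 _)) P0 (And3 a0 d0 a0) (And3 t0 e0 t0) hp G1 D2 F3 G1w D2w F3w uL.
have T3 := @tri_w s W b1 b2 b3 Cc phi _ _ _ P a a d t t e L s0 W0 hW
  (And4 p0 (c0 _) (c0 _) (c0 _)) P0 (And3 a0 a0 d0) (And3 t0 t0 e0) hp G1 G2 D3 G1w G2w D3w uL.
have := lerD (lerD T1 T2) T3.
rewrite -!big_split /= => h.
apply: le_trans (le_trans h _); last by apply: ler_of_eq; ring.
apply: ler_sum => -[[k k1] k2] _ /=; set k3 := k - k1 - k2.
have w0 : 0 <= phi k * wt s k * W k k1 k2 by rewrite !mulr_ge0 ?wt_ge0.
have := ler_wpM2l w0 (cn_prod3B (f1 k1) (f2 k2) (f3 k3) (g1 k1) (g2 k2) (g3 k3)).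
by move/le_trans; apply; apply: ler_of_eq; ring.
Qed.

Definition sumbi (W : int -> int -> R) (phi f1 f2 : int -> R) (L : seq (int * int)) :=
  \sum_(x <- L) phi x.1 * W x.1 x.2 * (f1 x.2 * f2 (x.1 - x.2)).

Definition bibound (W : int -> int -> R) (Cc : R) :=
  forall (phi f1 f2 : int -> R) (P a1 a2 : R),
    [/\ forall k, 0 <= phi k, forall k, 0 <= f1 k & forall k, 0 <= f2 k] ->
    [/\ 0 <= P, 0 <= a1 & 0 <= a2] ->
    l2b phi P -> l2b f1 a1 -> l2b f2 a2 ->
    forall L, uniq L -> sumbi W phi f1 f2 L <= Cc * P * a1 * a2.

Lemma sumle_sqr2 (u1 u2 : int -> R) A1 A2 (g : int * int -> int * int) :
  injective g -> l2b u1 A1 -> l2b u2 A2 ->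
  sumle (fun x => (u1 (g x).1 * u2 (g x).2) ^+ 2) ((A1 * A2) ^+ 2).
Proof.
move=> gi h1 h2.
have sq (u : int -> R) k : 0 <= u k ^+ 2 by exact: sqr_ge0.
have := sumle_comp gi (sumle_prod (sq u1) (sq u2) h1 h2).
by rewrite exprMn; apply: sumle_le => // x /=; rewrite exprMn.
Qed.

Lemma sumbi_le W phi f1 f2 (u1 u2 v1 v2 : int -> R) A1 A2 B1 B2
    (g h : int * int -> int * int) L :
  injective g -> injective h ->
  [/\ 0 <= A1, 0 <= A2, 0 <= B1 & 0 <= B2] ->
  l2b u1 A1 -> l2b u2 A2 -> l2b v1 B1 -> l2b v2 B2 ->
  (forall x, phi x.1 * W x.1 x.2 * (f1 x.2 * f2 (x.1 - x.2)) <=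
     (u1 (g x).1 * u2 (g x).2) * (v1 (h x).1 * v2 (h x).2)) ->
  uniq L -> sumbi W phi f1 f2 L <= (A1 * A2) * (B1 * B2).
Proof.
move=> gi hi [? ? ? ?] hu1 hu2 hv1 hv2 le uL.
apply: sum_mul_le le uL; rewrite ?mulr_ge0 //; exact: sumle_sqr2.
Qed.

Ltac pair_inj := move=> [? ?] [? ?] /= [? ?]; congr (_, _); lia.

(** Concentrating at one output frequency makes pointwise bounds of the nonlinearity an instance of
    the l^2 estimates, weights and differences included. *)
Lemma bi_conv k0 : bibound (fun k k1 => dl0 R (k - k0)) 1.
Proof.
move=> phi f1 f2 P a1 a2 [p0 f10 f20] [? ? ?] hp h1 h2 L uL.
have hd : l2b (fun k => dl0 R (k - k0)) 1.
  by apply: (sumle_comp (g := fun k => k - k0)) (@l2b_dl0 R) => x y; lia.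
apply: le_trans (@sumbi_le _ _ _ _ phi f1 (fun k => dl0 R (k - k0)) f2 P a1 1 a2
  (fun x => (x.1, x.2)) (fun x => (x.1, x.1 - x.2)) L _ _ _ _ _ _ _ _ uL) _ => //;
  try pair_inj.
- move=> [k k1] /=; apply: ler_of_eq; ring.
- by apply: ler_of_eq; ring.
Qed.

Lemma bi_1 : bibound (fun k k1 => ii k1) 2.
Proof.
move=> phi f1 f2 P a1 a2 [p0 f10 f20] [? ? ?] hp h1 h2 L uL.
apply: le_trans (@sumbi_le _ _ _ _ phi ii f1 f2 P 2 a1 a2
  (fun x => (x.1, x.2)) (fun x => (x.2, x.1 - x.2)) L _ _ _ _ _ _ _ _ uL) _ => //;
  try pair_inj; try exact: l2b_iv.
by apply: ler_of_eq; ring.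
Qed.

Lemma bi_2 : bibound (fun k k1 => ii (k - k1)) 2.
Proof.
move=> phi f1 f2 P a1 a2 [p0 f10 f20] [? ? ?] hp h1 h2 L uL.
apply: le_trans (@sumbi_le _ _ _ _ phi ii f1 f2 P 2 a1 a2
  (fun x => (x.1, x.1 - x.2)) (fun x => (x.2, x.1 - x.2)) L _ _ _ _ _ _ _ _ uL) _ => //;
  try pair_inj; try exact: l2b_iv.
by apply: ler_of_eq; ring.
Qed.

Lemma bi_w s W Cc phi (f1 f2 : int -> R) P a1 a2 t1 t2 L :
  0 <= s -> (forall k k1, 0 <= W k k1) -> bibound W Cc ->
  [/\ forall k, 0 <= phi k, forall k, 0 <= f1 k & forall k, 0 <= f2 k] ->
  0 <= P -> [/\ 0 <= a1, 0 <= a2, 0 <= t1 & 0 <= t2] ->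
  l2b phi P -> l2b f1 a1 -> l2b f2 a2 ->
  l2b (fun k => wt s k * f1 k) t1 -> l2b (fun k => wt s k * f2 k) t2 -> uniq L ->
  sumbi (fun k k1 => wt s k * W k k1) phi f1 f2 L <=
    cw s * (Cc * P * (t1 * a2 + a1 * t2)).
Proof.
move=> s0 W0 hW [p0 f10 f20] P0 [a10 a20 t10 t20] hp h1 h2 w1 w2 uL.
have wf0 f : (forall k, 0 <= f k) -> forall k, 0 <= wt s k * f k.
  by move=> f0 k; rewrite mulr_ge0 ?wt_ge0.
have H1 := hW phi _ _ P _ _ (And3 p0 (wf0 _ f10) f20) (And3 P0 t10 a20) hp w1 h2 L uL.
have H2 := hW phi _ _ P _ _ (And3 p0 f10 (wf0 _ f20)) (And3 P0 a10 t20) hp h1 w2 L uL.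
have := ler_wpM2l (cw_ge0 s) (lerD H1 H2).
rewrite -!big_split /= mulr_sumr => h.
apply: le_trans (le_trans h _); last by apply: ler_of_eq; ring.
apply: ler_sum => -[k k1] _ /=.
have := wtD k1 (k - k1) s0; have -> : k1 + (k - k1) = k by ring.
have c0 : 0 <= phi k * W k k1 * (f1 k1 * f2 (k - k1)) by rewrite !mulr_ge0.
move=> /(ler_wpM2l c0); apply: le_trans_eq2; ring.
Qed.

Lemma bi_diff s W Cc phi (f1 f2 g1 g2 : int -> C) P a t d e L :
  0 <= s -> (forall k k1, 0 <= W k k1) -> bibound W Cc ->
  (forall k, 0 <= phi k) -> 0 <= P -> [/\ 0 <= a, 0 <= t, 0 <= d & 0 <= e] ->
  l2b phi P -> slotd s true f1 g1 a t d e -> slotd s true f2 g2 a t d e -> uniq L ->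
  \sum_(x <- L) phi x.1 * wt s x.1 * W x.1 x.2 *
     cn (f1 x.2 * f2 (x.1 - x.2) - g1 x.2 * g2 (x.1 - x.2))
  <= cw s * Cc * P * (2 * (e * a) + 2 * (d * t)).
Proof.
move=> s0 W0 hW p0 P0 [a0 t0 d0 e0] hp.
move=> [[F1 F1w] [G1 G1w] D1 D1w] [[F2 F2w] [G2 G2w] D2 D2w] uL.
have c0 f : forall k : int, 0 <= cn (f k) :> R by move=> k; exact: cn_ge0.
have T1 := @bi_w s W Cc phi _ _ P d a e t L s0 W0 hW
  (And3 p0 (c0 _) (c0 _)) P0 (And4 d0 a0 e0 t0) hp D1 F2 D1w F2w uL.
have T2 := @bi_w s W Cc phi _ _ P a d t e L s0 W0 hW
  (And3 p0 (c0 _) (c0 _)) P0 (And4 a0 d0 t0 e0) hp G1 D2 G1w D2w uL.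
have := lerD T1 T2.
rewrite -!big_split /= => h.
apply: le_trans (le_trans h _); last by apply: ler_of_eq; ring.
apply: ler_sum => -[k k1] _ /=.
have w0 : 0 <= phi k * wt s k * W k k1 by rewrite !mulr_ge0 ?wt_ge0.
have := ler_wpM2l w0 (cn_prod2B (f1 k1) (f2 (k - k1)) (g1 k1) (g2 (k - k1))).
by move/le_trans; apply; apply: ler_of_eq; ring.
Qed.

End Weights.

(** * Primitives of bounded measurable functions *)

Section Primitives.
Variable R : realType.
Implicit Types (f g F G h : R -> R) (a b s t T A C : R).
Notation mu := (@lebesgue_measure R).

Lemma itv_fin a b : (mu `[a, b] < +oo)%E.
Proof. by rewrite lebesgue_measure_itv /=; case: ifP => _; rewrite ltry. Qed.

Definition bnd_on a b F := exists C, forall t, a <= t <= b -> `|F t| <= C.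

Lemma bnd_integrable a b F : measurable_fun `[a, b] F -> bnd_on a b F ->
  mu.-integrable `[a, b] (EFin \o F).
Proof.
move=> mF [C hC]; apply: measurable_bounded_integrable => //; first exact: itv_fin.
exists C; split; first exact: num_real.
move=> x Cx t /=; rewrite in_itv /= => ht.
by rewrite (le_trans (hC _ ht)) // ltW.
Qed.

Lemma measurable_sub a b c d F : c <= a -> b <= d ->
  measurable_fun `[c, d] F -> measurable_fun `[a, b] F.
Proof.
move=> ca bd; apply: measurable_funS => //; apply: subset_itvScc; by rewrite bnd_simp.
Qed.

(** Composing with the 1-Lipschitz retraction [cl] onto [0, T] extends g to a continuous function on
    the line. *)
Lemma unif_cont_measurable T g : 0 <= T ->
  (forall e, 0 < e -> exists2 d, 0 < d & forall s t, 0 <= s <= T -> 0 <= t <= T ->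
     `|t - s| < d -> `|g t - g s| <= e) ->
  measurable_fun `[0, T] g.
Proof.
move=> T0 hg; pose cl x := Num.max 0 (Num.min x T).
have clI x : 0 <= cl x <= T.
  by rewrite /cl le_max lexx /= ge_max T0 /= ge_min lexx orbT.
have cllip x y : `|cl x - cl y| <= `|x - y|.
  have n1 := ler_norm (x - y); have n2 := ler_norm (y - x); rewrite distrC in n2.
  rewrite /cl ler_norml.
  by case: (leP x T) => h1; case: (leP y T) => h2; case: (leP 0 x) => h3;
    case: (leP 0 y) => h4; rewrite ?(max_r T0) ?(max_r h3) ?(max_r h4) ?(max_l (ltW h3)) ?(max_l (ltW h4));
    apply/andP; split; lra.
apply: (eq_measurable_fun (g \o cl)).
  move=> x; rewrite inE /= in_itv /= => /andP[x0 xT].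
  by rewrite /= /cl min_l // max_r.
apply: measurable_funTS; apply: continuous_measurable_fun => x.
apply/cvgrPdist_le => /= e e0; have [d d0 hd] := hg _ e0.
near=> y; apply: hd; rewrite ?clI //.
rewrite (le_lt_trans (cllip _ _)) //.
Unshelve. all: by end_near.
Qed.

(* [f] is, on [0, T], a primitive of the bounded measurable function [F]. *)
Definition rprim T f F :=
  [/\ measurable_fun `[0, T] f, measurable_fun `[0, T] F, bnd_on 0 T F &
      forall t, 0 <= t <= T -> f t = f 0 + Rintegral mu `[0, t] F].

Lemma Rint_split s t F : 0 <= s -> s <= t -> measurable_fun `[0, t] F -> bnd_on 0 t F ->
  Rintegral mu `[0, t] F - Rintegral mu `[0, s] F = Rintegral mu `[s, t] F.
Proof.
move=> s0 st mF bF.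
rewrite Rintegral_itvB ?bnd_simp //; last exact: bnd_integrable.
rewrite Rintegral_itv_obnd_cbnd //.
have : mu.-integrable `[s, t] (EFin \o F).
  apply: bnd_integrable; first exact: measurable_sub mF.
  by have [C hC] := bF; exists C => u /andP[su ut]; rewrite hC // ut (le_trans s0).
apply: integrableS => //; exact: subset_itv_oc_cc.
Qed.

Lemma Rint_le s t F G : s <= t -> measurable_fun `[s, t] F -> bnd_on s t F ->
  measurable_fun `[s, t] G -> bnd_on s t G ->
  (forall u, s <= u <= t -> F u <= G u) -> Rintegral mu `[s, t] F <= Rintegral mu `[s, t] G.
Proof.
move=> st mF bF mG bG FG; apply: le_Rintegral => //; exact: bnd_integrable.
Qed.

Lemma Rint_cst s t A : s <= t -> Rintegral mu `[s, t] (fun=> A) = A * (t - s).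
Proof.
move=> st; transitivity (A * fine (mu `[s, t])); first exact: Rintegral_cst.
rewrite lebesgue_measure_itv /= lte_fin.
case: ltP => [//|ts]; have -> : t = s by apply/eqP; rewrite eq_le ts.
by rewrite subrr.
Qed.

Lemma Rint_abs_le s t F A : s <= t -> measurable_fun `[s, t] F ->
  (forall u, s <= u <= t -> `|F u| <= A) -> `|Rintegral mu `[s, t] F| <= A * (t - s).
Proof.
move=> st mF hA.
have bF : bnd_on s t F by exists A.
apply: le_trans (le_normr_Rintegral _ (bnd_integrable mF bF)) _ => //.
rewrite -Rint_cst //; apply: Rint_le => //.
- exact: measurableT_comp.
- by exists A => u hu; rewrite normr_id hA.
- by exists `|A|.
Qed.

Lemma bnd_sub a b c d F : c <= a -> b <= d -> bnd_on c d F -> bnd_on a b F.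
Proof.
by move=> ca bd [C hC]; exists C => t /andP[at' tb]; rewrite hC // (le_trans ca) ?(le_trans tb).
Qed.

Lemma rprim_incr T f F s t : rprim T f F -> 0 <= s -> s <= t -> t <= T ->
  f t - f s = Rintegral mu `[s, t] F.
Proof.
move=> [mf mF bF hf] s0 st tT; rewrite (hf t) ?(hf s) ?s0 ?(le_trans st) ?(le_trans s0) //.
rewrite -Rint_split //; first ring.
- exact: measurable_sub mF.
- exact: bnd_sub bF.
Qed.

Lemma rprim_lip T f F : rprim T f F -> exists2 C, 0 <= C & forall s t, 0 <= s <= T -> 0 <= t <= T ->
  `|f t - f s| <= C * `|t - s|.
Proof.
move=> hF; have [mf mF [C hC] _] := hF; exists `|C| => // s t.
wlog st : s t / s <= t.
  move=> H; case: (leP s t) => [/H//|/ltW ts hs ht]; rewrite distrC [`|t - s|]distrC; exact: H.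
move=> /andP[s0 sT] /andP[t0 tT]; rewrite (rprim_incr hF) //.
rewrite [`|t - s|]ger0_norm ?subr_ge0 //; apply: Rint_abs_le => //.
  exact: measurable_sub mF.
by move=> u /andP[su ut]; rewrite (le_trans (hC _ _)) ?ler_norm // (le_trans s0) ?(le_trans ut).
Qed.

Lemma const_of_small_incr T h :
  (forall e, 0 < e -> exists2 d, 0 < d & forall s t, 0 <= s -> s <= t -> t <= T ->
     t - s < d -> `|h t - h s| <= e * (t - s)) ->
  forall t, 0 <= t <= T -> h t = h 0.
Proof.
move=> hh t /andP[t0 tT]; apply/eqP; rewrite -subr_eq0 -normr_le0.
apply/ler_addgt0Pr => e e0; rewrite add0r.
(* With this slope the increments over [0, t] add up to at most e. *)
have e'0 : 0 < e / (t + 1) by rewrite divr_gt0 // ltr_pwDr.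
have [d d0 hd] := hh _ e'0.
pose m := (Num.Def.trunc (t / d)).+1.
have tm : t / m%:R < d.
  by rewrite ltr_pdivrMr // mulrC -ltr_pdivrMr // truncnS_gt.
have step j : (j <= m)%N -> `|h (j%:R * (t / m%:R)) - h 0| <= e / (t + 1) * (j%:R * (t / m%:R)).
  elim: j => [|j IH] jm; first by rewrite !mul0r subrr normr0 mulr0.
  have := lerD (hd (j%:R * (t / m%:R)) (j.+1%:R * (t / m%:R)) _ _ _ _) (IH (ltnW jm)).
  have q0 : 0 <= t / m%:R by rewrite divr_ge0 // ltW.
  have -> : j.+1%:R * (t / m%:R) - j%:R * (t / m%:R) = t / m%:R.
    by rewrite -mulrBl -natrB // subSnn mul1r.
  move=> H; rewrite -(subrKA (h (j%:R * (t / m%:R)))).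
  apply: le_trans (ler_normD _ _) _; apply: le_trans (H _ _ _ _) _ => //.
  - by rewrite mulr_ge0.
  - by rewrite ler_wpM2r // ler_nat.
  - rewrite (le_trans _ tT) // mulrA ler_pdivrMr // mulrC ler_wpM2l // ler_nat //.
  - rewrite -mulrDr ler_wpM2l ?(ltW e'0) // -natr1; lra.
have := step m (leqnn m).
have -> : m%:R * (t / m%:R) = t by field; rewrite gt_eqF.
move=> /le_trans; apply.
by rewrite mulrAC ler_pdivrMr ?ltr_pwDr // ler_wpM2l ?lerDl // ltW.
Qed.

Lemma small_of_quad T C e : 0 < e -> 0 <= C -> exists2 d, 0 < d &
  forall u, 0 <= u -> u < d -> C * u ^+ 2 <= e * u.
Proof.
move=> e0 C0; exists (e / (C + 1)) => [|u u0 ud]; first by rewrite divr_gt0 // ltr_pwDr.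
rewrite expr2 mulrA ler_wpM2r //.
move: ud; rewrite ltr_pdivlMr ?ltr_pwDr // => /ltW; apply: le_trans.
by rewrite mulrC ler_wpM2l // lerDl.
Qed.

(** The defect of f against the integral of F has increments that are uniformly o(t - s), so it is
    constant. This criterion takes the place of differentiation almost everywhere. *)
Lemma rprim_ofP T f F : 0 <= T ->
  measurable_fun `[0, T] f -> measurable_fun `[0, T] F -> bnd_on 0 T F ->
  (forall e, 0 < e -> exists2 d, 0 < d & forall s t, 0 <= s -> s <= t -> t <= T ->
     t - s < d -> `|f t - f s - Rintegral mu `[s, t] F| <= e * (t - s)) ->
  rprim T f F.
Proof.
move=> T0 mf mF bF hF; split => // t tT.
pose h u := f u - Rintegral mu `[0, u] F.
have /(_ t tT) : forall t, 0 <= t <= T -> h t = h 0.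
  apply: const_of_small_incr => e e0; have [d d0 hd] := hF _ e0; exists d => // u v u0 uv vT uvd.
  rewrite /h; have -> : f v - Rintegral mu `[0, v] F - (f u - Rintegral mu `[0, u] F) =
    f v - f u - (Rintegral mu `[0, v] F - Rintegral mu `[0, u] F) by ring.
  rewrite Rint_split //; first exact: hd.
    exact: measurable_sub mF.
  exact: bnd_sub bF.
rewrite /h set_itv1 Rintegral_set1 subr0 => <-; ring.
Qed.

Lemma bndD a b F G : bnd_on a b F -> bnd_on a b G -> bnd_on a b (fun t => F t + G t).
Proof.
move=> [C hC] [D hD]; exists (C + D) => t ht.
by rewrite (le_trans (ler_normD _ _)) // lerD ?hC ?hD.
Qed.

Lemma bndM a b F G : bnd_on a b F -> bnd_on a b G -> bnd_on a b (fun t => F t * G t).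
Proof.
by move=> [C hC] [D hD]; exists (C * D) => t ht; rewrite normrM ler_pM ?hC ?hD.
Qed.

Lemma rprim_bnd T f F : 0 <= T -> rprim T f F -> bnd_on 0 T f.
Proof.
move=> T0 /rprim_lip[C C0 hC]; exists (`|f 0| + C * T) => t /andP[t0 tT].
rewrite -(subrK (f 0) (f t)) addrC (le_trans (ler_normD _ _)) // lerD2l.
rewrite (le_trans (hC 0 t _ _)) ?lexx ?t0 //.
by rewrite subr0 ger0_norm // ler_wpM2l.
Qed.

Lemma rprimM T f F g G : 0 <= T -> rprim T f F -> rprim T g G ->
  rprim T (fun t => f t * g t) (fun t => F t * g t + f t * G t).
Proof.
move=> T0 hf hg; have [mf mF bF ef] := hf; have [mg mG bG eg] := hg.
have bf := rprim_bnd T0 hf; have bg := rprim_bnd T0 hg.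
have [Cf Cf0 lf] := rprim_lip hf; have [Cg Cg0 lg] := rprim_lip hg.
have mH : measurable_fun `[0, T] (fun t => F t * g t + f t * G t).
  by apply: measurable_funD; apply: measurable_funM.
have bH : bnd_on 0 T (fun t => F t * g t + f t * G t) by apply: bndD; apply: bndM.
apply: rprim_ofP => //; first exact: measurable_funM.
move=> e e0.
have [CF hCF] := bF; have [CG hCG] := bG.
have K0 : 0 <= `|CF| * Cg + Cf * `|CG| by rewrite addr_ge0 ?mulr_ge0.
have [d d0 hd] := small_of_quad T e0 K0; exists d => // s t s0 st tT std.
have inT u : s <= u <= t -> 0 <= u <= T.
  by move=> /andP[su ut]; rewrite (le_trans s0) ?(le_trans ut).
have sI : 0 <= s <= T by rewrite s0 (le_trans st).
have tI : 0 <= t <= T by rewrite tT (le_trans s0).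
have ms F' : measurable_fun `[0, T] F' -> measurable_fun `[s, t] F' by exact: measurable_sub.
have bs F' : bnd_on 0 T F' -> bnd_on s t F' by exact: bnd_sub.
have it F' (m1 : measurable_fun `[0, T] F') (b1 : bnd_on 0 T F') :=
  bnd_integrable (ms _ m1) (bs _ b1).
(* The defect of the product rule on [s, t] only involves increments of f and g multiplied by G and
   F; as f and g are Lipschitz, it is quadratic in t - s. *)
have -> : f t * g t - f s * g s - Rintegral mu `[s, t] (fun t => F t * g t + f t * G t) =
  Rintegral mu `[s, t] (fun u => F u * (g t - g u) + (f s - f u) * G u).
  have -> : f t * g t - f s * g s = (f t - f s) * g t + f s * (g t - g s) by ring.
  rewrite (rprim_incr hf) // (rprim_incr hg) //.
  rewrite -RintegralZr ?it // -RintegralZl ?it // -RintegralD //; last 2 first.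
  - apply: (it (fun x => F x * g t)); first exact: measurable_funM.
    by apply: bndM => //; exists `|g t|.
  - apply: (it (fun x => f s * G x)); first exact: measurable_funM.
    by apply: bndM => //; exists `|f s|.
  rewrite -RintegralB //; last 2 first.
  - apply: (it (fun x => F x * g t + f s * G x)).
      by apply: measurable_funD; apply: measurable_funM.
    by apply: bndD; apply: bndM => //; [exists `|g t| | exists `|f s| ].
  - exact: it.
  by apply: eq_Rintegral => u _ /=; ring.
apply: le_trans (hd _ _ std); last by rewrite subr_ge0.
rewrite expr2 mulrA; apply: Rint_abs_le => //.
  apply: ms; apply: measurable_funD; apply: measurable_funM => //; exact: measurable_funB.
move=> u ut; have uI := inT _ ut; have /andP[su uut] := ut.
rewrite (le_trans (ler_normD _ _)) // !normrM mulrDl.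
have h1 : `|g t - g u| <= Cg * (t - s).
  rewrite (le_trans (lg _ _ _ _)) // ler_wpM2l // ger0_norm ?subr_ge0 //; lra.
have h2 : `|f s - f u| <= Cf * (t - s).
  rewrite (le_trans (lf _ _ _ _)) // ler_wpM2l // ler0_norm ?subr_le0 //; lra.
apply: lerD; first by rewrite -mulrA ler_pM // (le_trans (hCF _ uI)) ?ler_norm.
by rewrite mulrAC ler_pM // (le_trans (hCG _ uI)) ?ler_norm.
Qed.

Lemma rprim_cst T c : rprim T (fun=> c) (fun=> 0).
Proof.
split => //; first by exists 0 => t _; rewrite normr0.
move=> t /andP[t0 _]; rewrite Rint_cst // mul0r addr0 //.
Qed.

Lemma rprimD T f F g G : rprim T f F -> rprim T g G ->
  rprim T (fun t => f t + g t) (fun t => F t + G t).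
Proof.
move=> [mf mF bF ef] [mg mG bG eg]; split; try exact: measurable_funD; first exact: bndD.
move=> t tT; rewrite ef // (eg t) // RintegralD //; first by ring.
- apply: bnd_integrable; first by apply: measurable_sub mF => //; case/andP: tT.
  by apply: bnd_sub bF => //; case/andP: tT.
- apply: bnd_integrable; first by apply: measurable_sub mG => //; case/andP: tT.
  by apply: bnd_sub bG => //; case/andP: tT.
Qed.

Lemma rprim_eq T f F g G : (forall t, 0 <= t <= T -> f t = g t) ->
  (forall t, 0 <= t <= T -> F t = G t) -> 0 <= T -> rprim T f F -> rprim T g G.
Proof.
move=> fg FG T0 [mf mF [C bF] ef]; split.
- by apply: eq_measurable_fun mf => x; rewrite inE /= in_itv /=; exact: fg.
- by apply: eq_measurable_fun mF => x; rewrite inE /= in_itv /=; exact: FG.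
- by exists C => t ht; rewrite -FG // bF.
- move=> t ht; rewrite -!fg ?lexx // ef //; congr (_ + _).
  apply: eq_Rintegral => x; rewrite inE /= in_itv /= => /andP[x0 xt]; apply: FG.
  by rewrite x0 (le_trans xt) //; case/andP: ht.
Qed.

Lemma rprimZ T c f F : 0 <= T -> rprim T f F -> rprim T (fun t => c * f t) (fun t => c * F t).
Proof.
move=> T0 hf; apply: rprim_eq (rprimM T0 (rprim_cst T c) hf) => // t _.
by rewrite mul0r add0r.
Qed.

(** [A] is the part of the bound that scales with t - s; [E] will be a truncation error whose
    integral over the whole of [0, T] is small. *)
Lemma rprim_abs_le T f F s t A (E : R -> R) : rprim T f F ->
  0 <= s -> s <= t -> t <= T -> measurable_fun `[0, T] E -> bnd_on 0 T E ->
  (forall u, 0 <= u <= T -> 0 <= E u) ->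
  (forall u, s <= u <= t -> `|F u| <= A + E u) ->
  `|f t - f s| <= A * (t - s) + Rintegral mu `[0, T] E.
Proof.
move=> hf s0 st tT mE bE E0 hA; have [mf mF bF ef] := hf.
have ms F' : measurable_fun `[0, T] F' -> measurable_fun `[s, t] F' by exact: measurable_sub.
have bs F' : bnd_on 0 T F' -> bnd_on s t F' by exact: bnd_sub.
rewrite (rprim_incr hf) //.
apply: le_trans (le_normr_Rintegral _ (bnd_integrable (ms _ mF) (bs _ bF))) _ => //.
apply: (@le_trans _ _ (Rintegral mu `[s, t] (fun u => A + E u))).
  apply: Rint_le => //.
  - by apply: measurableT_comp => //; exact: ms.
  - by have [C hC] := bs _ bF; exists C => u hu; rewrite normr_id hC.
  - by apply: measurable_funD => //; exact: ms.
  - by apply: bndD; [exists `|A| | exact: bs].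
rewrite RintegralD // ?Rint_cst // ?lerD2l; last 2 first.
- by apply: (@bnd_integrable _ _ (fun=> A)) => //; exists `|A|.
- by apply: bnd_integrable; [exact: ms|exact: bs].
have mt : measurable_fun `[0, t] E by exact: measurable_sub mE.
have bt : bnd_on 0 t E by exact: bnd_sub bE.
have pos a b : 0 <= a -> b <= T -> 0 <= Rintegral mu `[a, b] E.
  move=> a0 bT; apply: Rintegral_ge0 => u /=; rewrite in_itv /= => /andP[au ub].
  by apply: E0; rewrite (le_trans a0) ?(le_trans ub).
rewrite -Rint_split //.
have h1 := pos 0 s (lexx _) (le_trans st tT).
have h2 := pos t T (le_trans s0 st) (lexx _).
rewrite lerBlDr; apply: (@le_trans _ _ (Rintegral mu `[0, T] E)); last by rewrite lerDl.
by rewrite -subr_ge0 Rint_split // (le_trans s0).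
Qed.

Lemma rprim_derive T f F : (forall x : R, is_derive x 1 f (F x)) -> continuous F ->
  bnd_on 0 T F -> rprim T f F.
Proof.
move=> df cF bF.
have cf : continuous f.
  by move=> x; apply: differentiable_continuous; apply/derivable1_diffP; case: (df x).
split => //; first by apply: measurable_funTS; exact: continuous_measurable_fun.
  by apply: measurable_funTS; exact: continuous_measurable_fun.
move=> t /andP[]; rewrite le_eqVlt => /predU1P[<- _|t0 tT].
  by rewrite set_itv1 Rintegral_set1 addr0.
rewrite /Rintegral (@continuous_FTC2 _ F f) //=; first by ring.
- by apply: continuous_subspaceT.
- split => [x _||]; first by case: (df x).
  + by apply: cvg_at_right_filter; exact: cf.
  + by apply: cvg_at_left_filter; exact: cf.
- by move=> x _; rewrite derive1E; case: (df x).
Qed.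

Lemma continuous_scale (c : R) (f : R -> R) : continuous f -> continuous (fun t => f (c * t)).
Proof.
move=> cf x; apply: (@continuous_comp _ _ _ (fun t => c * t) f); last exact: cf.
exact: mulrl_continuous.
Qed.

Lemma rprim_cos T c : rprim T (fun t => cos (c * t)) (fun t => - (c * sin (c * t))).
Proof.
apply: rprim_derive.
- move=> x; apply: is_derive_eq; rewrite /= /GRing.scale /=; ring.
- move=> x; apply: cvgN; apply: cvgM; first exact: cvg_cst.
  exact: (continuous_scale (@continuous_sin R)).
- by exists `|c| => t _; rewrite normrN normrM ler_piMr // sin_max.
Qed.

Lemma rprim_sin T c : rprim T (fun t => sin (c * t)) (fun t => c * cos (c * t)).
Proof.
apply: rprim_derive.
- move=> x; apply: is_derive_eq; rewrite /= /GRing.scale /=; ring.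
- move=> x; apply: cvgM; first exact: cvg_cst.
  exact: (continuous_scale (@continuous_cos R)).
- by exists `|c| => t _; rewrite normrM ler_piMr // cos_max.
Qed.

End Primitives.

(** * Primitives of complex-valued functions *)

Section ComplexPrimitives.
Variable R : realType.
Notation C := (R[i]).
Implicit Types (f g F G : R -> C) (T : R).

Definition cprim T f F :=
  rprim T (fun t => complex.Re (f t)) (fun t => complex.Re (F t)) /\
  rprim T (fun t => complex.Im (f t)) (fun t => complex.Im (F t)).

Lemma cprim_eq T f F g G : 0 <= T -> (forall t, 0 <= t <= T -> f t = g t) ->
  (forall t, 0 <= t <= T -> F t = G t) -> cprim T f F -> cprim T g G.
Proof.
move=> T0 fg FG [hr hi]; split.
- by apply: rprim_eq hr => // t ht; rewrite ?fg ?FG.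
- by apply: rprim_eq hi => // t ht; rewrite ?fg ?FG.
Qed.

Lemma cprimD T f F g G : 0 <= T -> cprim T f F -> cprim T g G ->
  cprim T (fun t => f t + g t) (fun t => F t + G t).
Proof.
move=> T0 [fr fi] [gr gi]; split.
- by apply: rprim_eq (rprimD fr gr) => // t _; rewrite ReD.
- by apply: rprim_eq (rprimD fi gi) => // t _; rewrite ImD.
Qed.

Lemma cprimM T f F g G : 0 <= T -> cprim T f F -> cprim T g G ->
  cprim T (fun t => f t * g t) (fun t => F t * g t + f t * G t).
Proof.
move=> T0 [fr fi] [gr gi]; split.
- apply: rprim_eq (rprimD (rprimM T0 fr gr) (rprimZ (-1) T0 (rprimM T0 fi gi))) => // t _;
    rewrite ?ReD !ReM; ring.
- apply: rprim_eq (rprimD (rprimM T0 fr gi) (rprimM T0 fi gr)) => // t _;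
    rewrite ?ImD !ImM; ring.
Qed.

Lemma cprim_cst T (c : C) : cprim T (fun=> c) (fun=> 0).
Proof. by split; exact: rprim_cst. Qed.

Lemma cprimZ T (c : C) f F : 0 <= T -> cprim T f F ->
  cprim T (fun t => c * f t) (fun t => c * F t).
Proof.
move=> T0 hf; apply: cprim_eq (cprimM T0 (cprim_cst T c) hf) => // t _.
by rewrite mul0r add0r.
Qed.

Lemma cprimB T f F g G : 0 <= T -> cprim T f F -> cprim T g G ->
  cprim T (fun t => f t - g t) (fun t => F t - G t).
Proof.
move=> T0 hf hg; apply: cprim_eq (cprimD T0 hf (cprimZ (-1) T0 hg)) => // t _;
by rewrite mulN1r.
Qed.

Lemma cprim_sum T (I : Type) (r : seq I) (f F : I -> R -> C) : 0 <= T ->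
  (forall i, cprim T (f i) (F i)) ->
  cprim T (fun t => \sum_(i <- r) f i t) (fun t => \sum_(i <- r) F i t).
Proof.
move=> T0 h; elim: r => [|i r IH].
  by apply: cprim_eq (cprim_cst T 0) => // t _; rewrite big_nil.
by apply: cprim_eq (cprimD T0 (h i) IH) => // t _; rewrite big_cons.
Qed.

Lemma cprim_exp T (c : R) : 0 <= T ->
  cprim T (fun t => cexpi (c * t)) (fun t => Complex 0 c * cexpi (c * t)).
Proof.
move=> T0; split.
- by apply: rprim_eq (rprim_cos T c) => // t _; rewrite ReM /= mul0r sub0r.
- by apply: rprim_eq (rprim_sin T c) => // t _; rewrite ImM /= mul0r add0r.
Qed.

(* Unlike [cn], visibly measurable as a function of the real and imaginary parts. *)
Definition cabs1 (z : C) : R := `|complex.Re z| + `|complex.Im z|.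

Lemma cprim_abs_le T f F s t A (E : R -> R) : cprim T f F ->
  0 <= s -> s <= t -> t <= T -> measurable_fun `[0, T] E -> bnd_on 0 T E ->
  (forall u, 0 <= u <= T -> 0 <= E u) ->
  (forall u, s <= u <= t -> cn (F u) <= A + E u) ->
  `|complex.Re (f t - f s)| <= A * (t - s) + Rintegral (@lebesgue_measure R) `[0, T] E.
Proof.
move=> [hr _] s0 st tT mE bE E0 h; rewrite ReD ReN.
apply: (rprim_abs_le hr) => // u hu; exact: le_trans (cn_Re _) (h u hu).
Qed.

(** Multiplying by the conjugate of the increment makes it real, so that no factor is lost in
    passing from real parts to the modulus. *)
Lemma cprim_cn_le T f F s t A : cprim T f F -> 0 <= s -> s <= t -> t <= T ->
  (forall u, s <= u <= t -> cn (F u) <= A) -> cn (f t - f s) <= A * (t - s).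
Proof.
move=> hF s0 st tT hA; set z := f t - f s.
have T0 : 0 <= T by rewrite (le_trans s0) // (le_trans st).
have h := cprimZ (conjc z) T0 hF.
have A0 : 0 <= A by apply: le_trans (hA s _); rewrite ?cn_ge0 // lexx.
have : `|complex.Re (conjc z * z)| <= cn z * A * (t - s).
  rewrite [in X in X <= _]/z mulrBr.
  apply: le_trans (cprim_abs_le (A := cn z * A) (E := fun=> 0) h s0 st tT _ _ _ _) _ => //.
  - by exists 0 => u _; rewrite normr0.
  - by move=> u hu; rewrite cnM cn_conj addr0 ler_wpM2l ?cn_ge0 // hA.
  - by rewrite Rintegral_cst // mul0r addr0.
have -> : complex.Re (conjc z * z) = cn z ^+ 2.
  by rewrite cn_sqr /cabs2; case: (z) => a b; rewrite ReM /=; ring.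
rewrite ger0_norm ?sqr_ge0 // expr2 -mulrA.
have [->|z0] := eqVneq (cn z) 0; first by rewrite mulr_ge0 // subr_ge0.
by rewrite ler_pM2l // lt_neqAle eq_sym z0 cn_ge0.
Qed.

End ComplexPrimitives.

(** * Absolutely convergent sums over the integers *)

Section SumsOverZ.
Variable R : realType.
Notation C := (R[i]).

Definition bx (M : nat) : seq int := [seq j%:Z - M%:Z | j <- iota 0 (2 * M).+1].

Lemma bx_uniq M : uniq (bx M).
Proof. by rewrite map_inj_uniq ?iota_uniq // => i j /addIr [->]. Qed.

Lemma mem_bx M k : (k \in bx M) = (`|k| <= M%:Z).
Proof.
apply/mapP/idP => [[j]|h]; first by rewrite mem_iota => hj ->; lia.
by exists (absz (k + M%:Z)%R); rewrite ?mem_iota; lia.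
Qed.

Lemma bx_sub M N : (M <= N)%N -> {subset bx M <= bx N}.
Proof. by move=> MN k; rewrite !mem_bx; lia. Qed.

Lemma subset_bx (S : seq int) : exists M, {subset S <= bx M}.
Proof.
elim: S => [|k S [M hM]]; first by exists 0%N.
exists (maxn M (absz k)) => j; rewrite in_cons => /predU1P[->|/hM]; rewrite !mem_bx; lia.
Qed.

Lemma psumZE (f : int -> R) N : psumZ f N = \sum_(j <- bx N) f j.
Proof. by rewrite /psumZ /bx big_map -(big_mkord predT (fun j => f (j%:Z - N%:Z))) /index_iota subn0. Qed.

(** The limit along symmetric boxes is also the unordered sum: every finite set containing a large
    box approximates it. The sets [Sb k M] used later are not symmetric boxes. *)
Lemma rsum_lim (g : int -> R) K : sumle (fun k => `|g k|) K ->
  forall e, 0 < e -> exists M, forall S, uniq S -> {subset bx M <= S} ->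
    `|limn (psumZ g) - \sum_(k <- S) g k| <= e.
Proof.
move=> hK.
have split_sum (h : int -> R) M S : uniq S -> {subset bx M <= S} ->
    \sum_(k <- S) h k = \sum_(k <- bx M) h k + \sum_(k <- S | k \notin bx M) h k.
  move=> uS sS; rewrite (bigID (mem (bx M))) /=; congr (_ + _).
  rewrite -big_filter; apply: perm_big; apply: uniq_perm; rewrite ?filter_uniq ?bx_uniq //.
  by move=> k; rewrite mem_filter; case: (boolP (k \in bx M)) => //= /sS.
pose A := [set x | exists2 S, uniq S & x = \sum_(k <- S) `|g k|].
have supA : has_sup A.
  split; first by exists 0, [::] => //; rewrite big_nil.
  by exists K => _ [S uS ->]; exact: hK.
have tail e : 0 < e -> exists M, forall S, uniq S -> {subset bx M <= S} ->
    `|\sum_(k <- S) g k - \sum_(k <- bx M) g k| <= e.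
  move=> e0; have [_ [S0 uS0 ->] hS0] := sup_adherent e0 supA.
  have [M hM] := subset_bx S0; exists M => S uS sS.
  rewrite (split_sum g M) // addrC addKr.
  apply: le_trans (ler_norm_sum _ _ _) _.
  have : \sum_(k <- S) `|g k| <= sup A by apply: sup_upper_bound => //; exists S.
  rewrite (split_sum (fun k => `|g k|) M) //.
  have : \sum_(k <- S0) `|g k| <= \sum_(k <- bx M) `|g k|.
    exact: ler_sum_subset.
  move: hS0; move: (sup A) (\sum_(k <- S0) _) (\sum_(k <- bx M) _) (\sum_(k <- S | _) _).
  move=> a b c d; lra.
(* The positive and negative parts (|g| + g)/2 and (|g| - g)/2 have monotone bounded partial
   sums. *)
have cvgN : cvgn (psumZ g).
  have mono (h : int -> R) : (forall k, 0 <= h k <= `|g k|) -> cvgn (psumZ h).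
    move=> h0; apply: nondecreasing_is_cvgn.
      move=> m n mn; rewrite !psumZE; apply: ler_sum_subset; rewrite ?bx_uniq //.
        by move=> x; case/andP: (h0 x).
      exact: bx_sub.
    exists K => _ [n _ <-]; rewrite psumZE.
    apply: le_trans (hK _ (bx_uniq n)); apply: ler_sum => k _; by case/andP: (h0 k).
  have bd k : - `|g k| <= g k <= `|g k| by rewrite -ler_norml.
  have c1 : cvgn (psumZ (fun k => (`|g k| + g k) / 2)).
    by apply: mono => k; have /andP[? ?] := bd k; apply/andP; split; lra.
  have c2 : cvgn (psumZ (fun k => (`|g k| - g k) / 2)).
    by apply: mono => k; have /andP[? ?] := bd k; apply/andP; split; lra.
  have -> : psumZ g = (fun n => psumZ (fun k => (`|g k| + g k) / 2) n - psumZ (fun k => (`|g k| - g k) / 2) n).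
    by apply/funext => n; rewrite /psumZ -sumrB; apply: eq_bigr => i _; field.
  exact: (is_cvgB c1 c2).
move=> e e0; have [M hM] := tail _ (divr_gt0 e0 (ltr0n _ 2)); exists M => S uS sS.
have h1 := hM S uS sS.
apply/ler_addgt0Pr => d d0.
have := cvgN => /cvgrPdist_le /(_ d d0) [N _ hN].
have /= h2 := hN (maxn N M) (leq_maxl _ _).
have h3 := hM (bx (maxn N M)) (bx_uniq _) (bx_sub (leq_maxr _ _)).
rewrite psumZE in h2; rewrite distrC in h3.
apply: le_trans (ler_distD (\sum_(j <- bx (maxn N M)) g j) _ _) _.
apply: (@le_trans _ _ (d + (e / 2 + e / 2))); last by rewrite -splitr addrC.
apply: lerD h2 _.
apply: le_trans (ler_distD (\sum_(j <- bx M) g j) _ _) _.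
by apply: lerD; rewrite distrC.
Qed.

Definition csum_lim (f : int -> C) (l : C) := forall e, 0 < e -> exists M, forall S,
  uniq S -> {subset bx M <= S} -> cn (l - \sum_(k <- S) f k) <= e.

Lemma csumZ_lim (f : int -> C) K : sumle (fun k => cn (f k)) K -> csum_lim f (csumZ f).
Proof.
move=> hK e e0.
have hr : sumle (fun k => `|complex.Re (f k)|) K by apply: sumle_le hK => // k; exact: cn_Re.
have hi : sumle (fun k => `|complex.Im (f k)|) K by apply: sumle_le hK => // k; exact: cn_Im.
have [M hM] := rsum_lim hr (divr_gt0 e0 (ltr0n _ 2)).
have [N hN] := rsum_lim hi (divr_gt0 e0 (ltr0n _ 2)).
exists (maxn M N) => S uS sS; rewrite (le_trans (cn_le_ReIm _)) // [e]splitr.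
rewrite ReD ImD ReN ImN Re_sum Im_sum; apply: lerD; [apply: hM|apply: hN] => // k hk;
  apply: sS; apply: bx_sub hk; rewrite ?leq_maxl ?leq_maxr //.
Qed.

Lemma csum_lim_le (f : int -> C) l K : csum_lim f l -> sumle (fun k => cn (f k)) K -> cn l <= K.
Proof.
move=> hl hK; apply/ler_addgt0Pr => e e0; have [M hM] := hl e e0.
have := hM _ (bx_uniq M) (fun _ => id) => h.
rewrite -(subrK (\sum_(k <- bx M) f k) l) addrC (le_trans (cnD _ _)) // lerD //.
by rewrite (le_trans (cn_sum _ _ _)) // hK ?bx_uniq.
Qed.

Lemma csum_limB (f g : int -> C) l m : csum_lim f l -> csum_lim g m ->
  csum_lim (fun k => f k - g k) (l - m).
Proof.
move=> hl hm e e0; have [M hM] := hl _ (divr_gt0 e0 (ltr0n _ 2)).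
have [N hN] := hm _ (divr_gt0 e0 (ltr0n _ 2)).
exists (maxn M N) => S uS sS; rewrite sumrB.
have -> : l - m - (\sum_(k <- S) f k - \sum_(k <- S) g k) =
  (l - \sum_(k <- S) f k) - (m - \sum_(k <- S) g k) by ring.
rewrite (le_trans (cnB _ _)) // [e]splitr lerD //; [apply: hM|apply: hN] => // k hk;
  apply: sS; apply: bx_sub hk; rewrite ?leq_maxl ?leq_maxr //.
Qed.

Lemma csum_lim_fin (f : int -> C) (S0 : seq int) : uniq S0 ->
  csum_lim (fun k => if k \in S0 then f k else 0) (\sum_(k <- S0) f k).
Proof.
move=> u0 e e0; have [M hM] := subset_bx S0; exists M => S uS sS.
suff -> : \sum_(k <- S) (if k \in S0 then f k else 0) = \sum_(k <- S0) f k.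
  by rewrite subrr cn0 ltW.
rewrite -big_mkcond -big_filter; apply: perm_big.
apply: uniq_perm; rewrite ?filter_uniq //.
by move=> k; rewrite mem_filter; case: (boolP (k \in S0)) => //= /hM /sS.
Qed.

End SumsOverZ.

(** * The nonlinearity and its truncations *)

Section Nonlinearity.
Variable R : realType.
Notation C := (R[i]).
Implicit Types (v w : fseq R).

Definition nt v (k : int) (tau : R) (k1 : int) : C :=
  cexpi ((3 * k * k1 * (k - k1))%:~R * tau) * v k1 * v (k - k1).

Lemma kdv_nonlinE v k tau : v 0 = 0 -> kdv_nonlin v k tau = csumZ (nt v k tau).
Proof.
move=> v0; rewrite /kdv_nonlin; congr csumZ; apply/funext => k1; rewrite /nt.
case: eqVneq => [->|_] /=; first by rewrite v0 mulr0 mul0r.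
by case: eqVneq => [->|_] //=; rewrite v0 mulr0.
Qed.

Lemma cn_nt v k tau k1 : cn (nt v k tau k1) = cn (v k1) * cn (v (k - k1)).
Proof. by rewrite /nt !cnM cn_cexpi mul1r. Qed.

Lemma cn_ntB v w k tau k1 :
  cn (nt v k tau k1 - nt w k tau k1) = cn (v k1 * v (k - k1) - w k1 * w (k - k1)).
Proof. by rewrite /nt -!mulrA -mulrBr cnM cn_cexpi mul1r. Qed.

Lemma l2b_cn0 a : l2b (fun k : int => cn ((fun=> 0 : C) k)) a.
Proof. by move=> L _; rewrite big1 ?sqr_ge0 // => k _; rewrite cn0 expr0n. Qed.

Lemma sumle_nt v a k tau : 0 <= a -> l2b (fun j => cn (v j)) a ->
  sumle (fun k1 => cn (nt v k tau k1)) (a * a).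
Proof.
move=> a0 hv L uL; apply: (sum_mul_le (X := fun j => cn (v j)) (Y := fun j => cn (v (k - j)))) => //.
- by apply: (sumle_comp (g := fun j => k - j) (f := fun j => cn (v j) ^+ 2)) hv => x y; lia.
- by move=> j; rewrite cn_nt.
Qed.

Lemma kdv_nonlin_lim v a k tau : 0 <= a -> l2b (fun j => cn (v j)) a -> v 0 = 0 ->
  csum_lim (nt v k tau) (kdv_nonlin v k tau).
Proof. by move=> a0 hv v0; rewrite kdv_nonlinE //; apply: csumZ_lim; exact: (sumle_nt k tau a0 hv). Qed.

Lemma sumle_ntB s w v a t d e k tau : 0 <= s -> [/\ 0 <= a, 0 <= t, 0 <= d & 0 <= e] ->
  slotd s true w v a t d e ->
  sumle (fun k1 => wt s k * cn (nt w k tau k1 - nt v k tau k1))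
    (cw s * (2 * (e * a) + 2 * (d * t))).
Proof.
move=> s0 h0 hs L uL.
have hd : l2b (fun j => dl0 R (j - k)) 1.
  by apply: (sumle_comp (g := fun j => j - k)) (@l2b_dl0 R) => x y; lia.
have uL' : uniq [seq (k, k1) | k1 <- L] by rewrite map_inj_uniq // => x y [].
have d0 : forall j l : int, 0 <= dl0 R (j - k).
  by move=> j _; exact: dl0_ge0.
have := bi_diff s0 d0 (@bi_conv R k) (fun j => d0 j 0) ler01 h0 hd hs hs uL'.
rewrite big_map /= !mulr1; apply: le_trans; apply: ler_sum => k1 _.
by rewrite subrr /dl0 eqxx /= mul1r mulr1 cn_ntB.
Qed.

Lemma kdv_nonlinB_le s w v a t d e k tau : 0 <= s ->
  [/\ 0 <= a, 0 <= t, 0 <= d & 0 <= e] -> slotd s true w v a t d e -> w 0 = 0 -> v 0 = 0 ->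
  wt s k * cn (kdv_nonlin w k tau - kdv_nonlin v k tau) <=
    cw s * (2 * (e * a) + 2 * (d * t)).
Proof.
move=> s0 h0 hs w0 v0; have [a0 _ _ _] := h0.
have [[wa _] [va _] _ _] := hs.
have hl := csum_limB (kdv_nonlin_lim k tau a0 wa w0) (kdv_nonlin_lim k tau a0 va v0).
have hb := sumle_ntB k tau s0 h0 hs.
have [w00|wn0] := eqVneq (wt s k) 0.
  by rewrite w00 mul0r; exact: sumle_ge0 hb.
have wp : 0 < wt s k by rewrite lt_neqAle eq_sym wn0 wt_ge0.
rewrite mulrC -ler_pdivlMr //; apply: csum_lim_le hl _ => L uL.
by rewrite ler_pdivlMr // mulrC mulr_sumr; exact: hb.
Qed.

Lemma kdv_nonlin0 k tau : kdv_nonlin (fun=> 0 : C) k tau = 0.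
Proof.
have h : csum_lim (nt (fun=> 0 : C) k tau) (kdv_nonlin (fun=> 0 : C) k tau).
  exact: (@kdv_nonlin_lim _ 0 k tau (lexx _) (@l2b_cn0 0)).
apply: cn_eq0; apply/eqP; rewrite eq_le cn_ge0 andbT.
apply: csum_lim_le h _ => L _; rewrite big1 // => j _.
by rewrite cn_nt cn0 mul0r.
Qed.

(* The equation for a solution supported on the frequencies [A] is [v_k' = k * Fn A v k]. *)
Definition Fn (A : pred int) v k (tau : R) : C :=
  if A k then Complex 0 2^-1 * kdv_nonlin v k tau else 0.

Definition FnS (A : pred int) (S : seq int) v k (tau : R) : C :=
  if A k then Complex 0 2^-1 * \sum_(k1 <- S) nt v k tau k1 else 0.

Lemma cn_half : cn (Complex 0 2^-1 : C) = 2^-1.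
Proof. by rewrite cn_imag ger0_norm // invr_ge0. Qed.

Lemma FnB_le A s w v a t d e k tau : 0 <= s ->
  [/\ 0 <= a, 0 <= t, 0 <= d & 0 <= e] -> slotd s true w v a t d e -> w 0 = 0 -> v 0 = 0 ->
  wt s k * cn (Fn A w k tau - Fn A v k tau) <= cw s * (e * a + d * t).
Proof.
move=> s0 h0 hs w0 v0; have := kdv_nonlinB_le k tau s0 h0 hs w0 v0.
have [a0 t0 d0 e0] := h0.
rewrite /Fn; case: ifP => _ h; last by rewrite subrr cn0 mulr0 !(mulr_ge0, addr_ge0) ?cw_ge0.
rewrite -mulrBr cnM cn_half mulrCA.
apply: (@le_trans _ _ (2^-1 * (cw s * (2 * (e * a) + 2 * (d * t))))).
  by rewrite ler_wpM2l // invr_ge0.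
by apply: ler_of_eq; field.
Qed.

Lemma slotd_0 s v a t : l2b (fun k => cn (v k)) a -> l2b (fun k => wt s k * cn (v k)) t ->
  0 <= a -> 0 <= t -> slotd s true v (fun=> 0) a t a t.
Proof.
move=> va vt a0 t0; have E : (fun k => cn (v k - 0)) = (fun k => cn (v k)).
  by apply/funext => k; rewrite subr0.
have E' : (fun k => wt s k * cn (v k - 0)) = (fun k => wt s k * cn (v k)).
  by apply/funext => k; rewrite subr0.
rewrite /slotd /slotb E E'; split => //=; split => //.
- exact: l2b_cn0.
- by move=> L _; rewrite big1 ?sqr_ge0 // => k _ /=; rewrite cn0 mulr0 expr0n.
Qed.

Lemma slotd_wt0 s w v a t d e : slotd s true w v a t d e -> slotd 0 true w v a a d d.
Proof.
move=> [[wa _] [va _] d1 _]; have E (f : int -> R) : (fun k => wt 0 k * f k) = f.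
  by apply/funext => k; rewrite wt0 mul1r.
by rewrite /slotd /slotb !E.
Qed.

(** At least 1 and at least 2 (1 + a) times each of [cw s] and [cw 0]: the same scaled sizes then
    bound the solutions and their nonlinearities, the inputs of the quartic forms. *)
Definition cF s a : R := 2 * (1 + cw s + cw 0) * (1 + a).

Lemma cF_ge1 s a : 0 <= a -> 1 <= cF s a.
Proof.
move=> a0; have := cw_ge0 (R := R) s; have := cw_ge0 (R := R) 0.
by rewrite /cF => ? ?; nra.
Qed.

(** Prepares the nonlinearity as an argument of the forms, in l^inf (flag [false]). Its own sizes
    come from the difference estimate against the zero sequence. *)
Lemma slotd_Fn A s w v a t d e tau : 0 <= s ->
  [/\ 0 <= a, 0 <= t, 0 <= d & 0 <= e] -> slotd s true w v a t d e -> w 0 = 0 -> v 0 = 0 ->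
  slotd s false (Fn A w ^~ tau) (Fn A v ^~ tau)
    (cF s a * a) (cF s a * t) (cF s a * d) (cF s a * (e + d * t)).
Proof.
move=> s0 h0 hs w0 v0; have [a0 t0 d0 e0] := h0.
have [[wa wt'] [va vt'] _ _] := hs.
have hs0 := slotd_wt0 hs.
have cs0 := cw_ge0 (R := R) s; have c00 := cw_ge0 (R := R) 0.
have F0 k : Fn A (fun=> 0 : C) k tau = 0.
  by rewrite /Fn kdv_nonlin0 mulr0; case: ifP.
have single u : l2b (fun k => cn (u k)) a -> l2b (fun k => wt s k * cn (u k)) t -> u 0 = 0 ->
    (forall k, cn (Fn A u k tau) <= cF s a * a) /\
    (forall k, wt s k * cn (Fn A u k tau) <= cF s a * t).
  move=> ua ut u0.
  have sl := slotd_0 ua ut a0 t0.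
  split => k.
    have := @FnB_le A 0 _ _ _ _ _ _ k tau (lexx _) (And4 a0 a0 a0 a0) (slotd_wt0 sl) u0 erefl.
    rewrite wt0 mul1r F0 subr0; move/le_trans; apply; rewrite /cF; nra.
  have := @FnB_le A s _ _ _ _ _ _ k tau s0 (And4 a0 t0 a0 t0) sl u0 erefl.
  rewrite F0 subr0; move/le_trans; apply; rewrite /cF.
  have : 0 <= t * a by rewrite mulr_ge0.
  nra.
split => /=; [exact: single|exact: single| |].
- move=> k; have := @FnB_le A 0 _ _ _ _ _ _ k tau (lexx _) (And4 a0 a0 d0 d0) hs0 w0 v0.
  rewrite wt0 mul1r; move/le_trans; apply; rewrite /cF.
  have : 0 <= d * a by rewrite mulr_ge0.
  nra.
- move=> k; have := FnB_le A k tau s0 h0 hs w0 v0; move/le_trans; apply.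
  rewrite /cF -mulrA; apply: ler_pM => //; first by rewrite addr_ge0 ?mulr_ge0.
    lra.
  have := mulr_ge0 d0 t0; have := mulr_ge0 (mulr_ge0 d0 t0) a0; move: (d * t) => x.
  lra.
Qed.

End Nonlinearity.

(** * Measurability and truncation of the nonlinearity *)

Section TruncationError.
Variable R : realType.
Notation C := (R[i]).
Notation mu := (@lebesgue_measure R).

Definition cmeas (T : R) (F : R -> C) :=
  measurable_fun `[0, T] (fun t => complex.Re (F t)) /\
  measurable_fun `[0, T] (fun t => complex.Im (F t)).

Lemma cmeas_prim T f F : cprim T f F -> cmeas T f /\ cmeas T F.
Proof. by move=> [[? ? _ _] [? ? _ _]]. Qed.

Lemma cmeas_cst T (c : C) : cmeas T (fun=> c).
Proof. by split; exact: measurable_cst. Qed.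

Lemma cmeasM T F G : cmeas T F -> cmeas T G -> cmeas T (fun t => F t * G t).
Proof.
move=> [Fr Fi] [Gr Gi]; split.
- have -> : (fun t => complex.Re (F t * G t)) = (fun t => complex.Re (F t) * complex.Re (G t) - complex.Im (F t) * complex.Im (G t)).
    by apply/funext => t; rewrite ReM.
  by apply: measurable_funB; apply: measurable_funM.
- have -> : (fun t => complex.Im (F t * G t)) = (fun t => complex.Re (F t) * complex.Im (G t) + complex.Im (F t) * complex.Re (G t)).
    by apply/funext => t; rewrite ImM.
  by apply: measurable_funD; apply: measurable_funM.
Qed.

Lemma cmeasB T F G : cmeas T F -> cmeas T G -> cmeas T (fun t => F t - G t).
Proof.
move=> [Fr Fi] [Gr Gi]; split.
- have -> : (fun t => complex.Re (F t - G t)) = (fun t => complex.Re (F t) - complex.Re (G t)).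
    by apply/funext => t; rewrite ReD ReN.
  exact: measurable_funB.
- have -> : (fun t => complex.Im (F t - G t)) = (fun t => complex.Im (F t) - complex.Im (G t)).
    by apply/funext => t; rewrite ImD ImN.
  exact: measurable_funB.
Qed.

Lemma cmeas_sum T (I : Type) (r : seq I) (F : I -> R -> C) :
  (forall i, cmeas T (F i)) -> cmeas T (fun t => \sum_(i <- r) F i t).
Proof.
move=> h; split.
- have -> : (fun t => complex.Re (\sum_(i <- r) F i t)) = (fun t => \sum_(i <- r) complex.Re (F i t)).
    by apply/funext => t; rewrite Re_sum.
  by apply: measurable_sum => i; case: (h i).
- have -> : (fun t => complex.Im (\sum_(i <- r) F i t)) = (fun t => \sum_(i <- r) complex.Im (F i t)).
    by apply/funext => t; rewrite Im_sum.
  by apply: measurable_sum => i; case: (h i).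
Qed.

Lemma cabs1_measurable T F : cmeas T F -> measurable_fun `[0, T] (fun t => cabs1 (F t)).
Proof. by move=> [Fr Fi]; apply: measurable_funD; apply: measurableT_comp. Qed.

Lemma cn_le_cabs1 (z : C) : cn z <= cabs1 z.
Proof. exact: cn_le_ReIm. Qed.

Lemma cabs1_le (z : C) : cabs1 z <= 2 * cn z.
Proof. by have := cn_Re z; have := cn_Im z; rewrite /cabs1; lra. Qed.

Lemma cabs1_ge0 (z : C) : 0 <= cabs1 z.
Proof. by rewrite addr_ge0. Qed.

(* Solutions of the system restricted to the frequencies in [A], bounded by [a] in H^0. *)
Definition gsol (A : pred int) (T a : R) (v : R -> fseq R) :=
  [/\ A 0 = false, forall t, 0 <= t <= T -> v t 0 = 0,
      forall t, 0 <= t <= T -> l2b (fun k => cn (v t k)) a &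
      forall k, cprim T (fun t => v t k) (fun t => k%:~R * Fn A (v t) k t)].

Variables (A : pred int) (T a : R) (v : R -> fseq R).
Hypotheses (T0 : 0 <= T) (a0 : 0 <= a) (hv : gsol A T a v).

Lemma cmeas_v k : cmeas T (fun t => v t k).
Proof. by have [_ _ _ h] := hv; have [] := cmeas_prim (h k). Qed.

Lemma cmeas_Fn k : cmeas T (fun t => Fn A (v t) k t).
Proof.
have [A0 _ _ h] := hv; have [k0|k0] := eqVneq k 0.
  by rewrite k0 /Fn A0; exact: cmeas_cst.
have [_ m] := cmeas_prim (h k).
have := cmeasM (cmeas_cst T (k%:~R^-1)) m.
rewrite (_ : (fun t => _) = (fun t => Fn A (v t) k t)) //.
by apply/funext => t; rewrite mulKf ?intr_eq0.
Qed.

Lemma cmeas_nt k k1 : cmeas T (fun t => nt (v t) k t k1).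
Proof.
apply: cmeasM; last exact: cmeas_v.
apply: cmeasM; last exact: cmeas_v.
by have [] := cmeas_prim (cprim_exp ((3 * k * k1 * (k - k1))%:~R) T0).
Qed.

Lemma cmeas_FnS S k : cmeas T (fun t => FnS A S (v t) k t).
Proof.
rewrite /FnS; case: (A k); last exact: cmeas_cst.
by apply: cmeasM; [exact: cmeas_cst|apply: cmeas_sum => k1; exact: cmeas_nt].
Qed.

Lemma Fn_lim k t : 0 <= t <= T -> csum_lim (nt (v t) k t) (kdv_nonlin (v t) k t).
Proof. by move=> tT; have [_ v0 ha _] := hv; apply: (kdv_nonlin_lim k t a0); auto. Qed.

Lemma Fn_err_le S k t : 0 <= t <= T -> uniq S ->
  cn (Fn A (v t) k t - FnS A S (v t) k t) <= a * a.
Proof.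
move=> tT uS; have [_ v0 ha _] := hv.
have hs := sumle_nt k t a0 (ha t tT).
have h1 := csum_lim_le (Fn_lim k tT) hs.
have h2 := le_trans (cn_sum S xpredT (nt (v t) k t)) (hs S uS).
rewrite /Fn /FnS; case: ifP => _; last by rewrite subrr cn0 mulr_ge0.
rewrite -mulrBr cnM cn_half.
have := cnB (kdv_nonlin (v t) k t) (\sum_(k1 <- S) nt (v t) k t k1).
move: h1 h2; move: (cn _) (cn _) (cn _) (a * a) => x y z b; lra.
Qed.

Lemma err_bnd S k : uniq S -> bnd_on 0 T (fun t => cabs1 (Fn A (v t) k t - FnS A S (v t) k t)).
Proof.
move=> uS; exists (2 * (a * a)) => t tT; rewrite ger0_norm ?cabs1_ge0 //.
by rewrite (le_trans (cabs1_le _)) // ler_wpM2l // Fn_err_le.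
Qed.

Lemma err_meas S k : measurable_fun `[0, T] (fun t => cabs1 (Fn A (v t) k t - FnS A S (v t) k t)).
Proof. by apply: cabs1_measurable; apply: cmeasB; [exact: cmeas_Fn|exact: cmeas_FnS]. Qed.

(** Dominated convergence with the majorant [2 * (a * a)]. There is no uniformity in k; only
    finitely many k will be involved at a time. *)
Lemma err_cvg (Sq : nat -> seq int) k : (forall m, uniq (Sq m)) ->
  (forall j, exists m0, forall m, (m0 <= m)%N -> {subset bx j <= Sq m}) ->
  (fun m => Rintegral mu `[0, T] (fun t => cabs1 (Fn A (v t) k t - FnS A (Sq m) (v t) k t)))
    @ \oo --> (0 : R).
Proof.
move=> uS hS.
pose f m t := cabs1 (Fn A (v t) k t - FnS A (Sq m) (v t) k t).
have := @dominated_cvg _ _ R mu `[0, T] (measurable_itv _) (fun m t => (f m t)%:E)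
  (fun=> 0%E) (fun=> (2 * (a * a))%:E).
have h1 m : measurable_fun `[0, T] (fun t => (f m t)%:E).
  by apply/measurable_EFinP; exact: err_meas.
have h2 t : `[0, T] t -> (fun m => (f m t)%:E) @ \oo --> (0 : \bar R)%E.
  rewrite /= in_itv /= => tT; apply: cvg_EFin; first by near=> m.
  apply/cvgrPdist_le => /= e e0.
  have [M hM] := Fn_lim k tT (divr_gt0 e0 (ltr0n _ 2)).
  have [m0 hm0] := hS M.
  exists m0 => // m /= m0m; rewrite sub0r normrN ger0_norm ?cabs1_ge0 //.
  rewrite /f /Fn /FnS; case: ifP => _; last by rewrite subrr /cabs1 /= normr0 addr0 ltW.
  rewrite (le_trans (cabs1_le _)) // -mulrBr cnM cn_half mulrA divff // mul1r.
  by rewrite (le_trans (hM _ (uS m) (hm0 m m0m))) // ler_pdivrMr // ler_pMr // ler1n.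
have h3 : mu.-integrable `[0, T] (fun=> (2 * (a * a))%:E).
  apply: (@bnd_integrable _ _ _ (fun=> 2 * (a * a))) => //.
  by exists `|2 * (a * a)|.
have h4 m t : `[0, T] t -> (`|(f m t)%:E| <= (2 * (a * a))%:E)%E.
  rewrite /= in_itv /= => tT; rewrite lee_fin ger0_norm ?cabs1_ge0 //.
  by rewrite (le_trans (cabs1_le _)) // ler_wpM2l // Fn_err_le.
move=> /(_ h1 h2 (fun _ _ => erefl) h3 h4); rewrite integral0.
move=> /fine_cvg; exact.
Unshelve. all: by end_near.
Qed.

End TruncationError.

(** * Normal form *)

Section NormalForm.
Variable R : realType.
Notation C := (R[i]).
Notation im1 := (Complex 0 1 : C).

Definition EE (n : int) (t : R) : C := cexpi (n%:~R * t).

Lemma cn_EE n t : cn (EE n t) = 1.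
Proof. exact: cn_cexpi. Qed.

Lemma EED m n t : EE (m + n) t = EE m t * EE n t.
Proof. by rewrite /EE intrD mulrDl cexpiD. Qed.

Lemma im_int (n : int) : Complex 0 (n%:~R : R) = n%:~R * im1.
Proof. by rewrite intC; apply/eqP; rewrite eq_complex /= !mul0r !mulr0 mulr1 subrr addr0 !eqxx. Qed.

Lemma im_half : Complex 0 2^-1 = 2^-1 * im1 :> C.
Proof.
have -> : (2^-1 : C) = ((2^-1 : R)%:C)%C by rewrite fmorphV rmorph_nat.
by apply/eqP; rewrite eq_complex /= !mul0r !mulr0 mulr1 subrr addr0 !eqxx.
Qed.

(* This truncation is symmetric under [k1 |-> k - k1]. *)
Definition Sb (k : int) (M : nat) : seq int := [seq k1 <- bx M | `|k - k1| <= M%:Z].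

Lemma Sb_uniq k M : uniq (Sb k M).
Proof. by rewrite filter_uniq ?bx_uniq. Qed.

Lemma Sb_exhaust k j : exists m0, forall m, (m0 <= m)%N -> {subset bx j <= Sb k m}.
Proof.
exists (j + absz k)%N => m hm x; rewrite mem_filter !mem_bx => hx.
by apply/andP; split; lia.
Qed.

Lemma Sb_reflect k M (f : int -> C) : \sum_(k1 <- Sb k M) f (k - k1) = \sum_(k1 <- Sb k M) f k1.
Proof.
rewrite -(big_map (fun k1 => k - k1) predT f); apply: perm_big; apply: uniq_perm.
- by rewrite map_inj_uniq ?Sb_uniq // => x y; lia.
- exact: Sb_uniq.
move=> x; rewrite mem_filter mem_bx; apply/mapP/andP => [[y]|[h1 h2]].
  by rewrite mem_filter mem_bx => /andP[h1 h2] ->; split; lia.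
by exists (k - x); rewrite ?mem_filter ?mem_bx; [apply/andP; split|]; lia.
Qed.

(* The phase [k^3 - k1^3 - k2^3 - k3^3] for [k3 = k - k1 - k2]. *)
Definition Ph (k k1 k2 : int) : int := 3 * ((k1 + k2) * (k - k2) * (k - k1)).

Lemma PhE k k1 k2 :
  Ph k k1 k2 = 3 * k * k1 * (k - k1) + 3 * (k - k1) * k2 * (k - k1 - k2).
Proof. rewrite /Ph; ring. Qed.

Variable A : pred int.

(* The kernel left by dividing by the phase [Ph], and the resonant terms where [Ph = 0]. *)
Definition c3 k k1 k2 : C := if A (k - k1) then ((6 * Ph k k1 k2 * k1)%:~R)^-1 else 0.

Definition cres k k1 k2 : C :=
  if A (k - k1) && (Ph k k1 k2 == 0) then Complex 0 2^-1 * 3^-1 * (k1%:~R)^-1 else 0.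

Definition B2 (M : nat) (v : fseq R) k t :=
  \sum_(k1 <- Sb k M) ((6 * k1 * (k - k1))%:~R)^-1 *
     (EE (3 * k * k1 * (k - k1)) t * v k1 * v (k - k1)).

Definition sum3 (M M' : nat) k (g : int -> int -> C) :=
  \sum_(k1 <- Sb k M) \sum_(k2 <- bx M') g k1 k2.

Definition B3 (M M' : nat) (v : fseq R) k t :=
  sum3 M M' k (fun k1 k2 => c3 k k1 k2 * (EE (Ph k k1 k2) t * (v k1 * v k2 * v (k - k1 - k2)))).

Definition Q3 (M M' : nat) (v F : fseq R) k t :=
  sum3 M M' k (fun k1 k2 => c3 k k1 k2 * (EE (Ph k k1 k2) t *
    (k1%:~R * (F k1 * v k2 * v (k - k1 - k2)) + k2%:~R * (v k1 * F k2 * v (k - k1 - k2)) +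
     (k - k1 - k2)%:~R * (v k1 * v k2 * F (k - k1 - k2))))).

Definition Res (M M' : nat) (v : fseq R) k t :=
  sum3 M M' k (fun k1 k2 => cres k k1 k2 * (EE (Ph k k1 k2) t * (v k1 * v k2 * v (k - k1 - k2)))).

Definition Er (M M' : nat) (v : fseq R) k t : C :=
  k%:~R * (Fn A v k t - FnS A (Sb k M) v k t) -
  3^-1 * \sum_(k1 <- Sb k M) EE (3 * k * k1 * (k - k1)) t * (k1%:~R)^-1 * v k1 *
     (Fn A v (k - k1) t - FnS A (bx M') v (k - k1) t).

(** Differentiating the exponential produces i times 3 k k1 k2, which against 1/(6 k1 k2) is the
    coefficient ik/2 of the equation. In the other terms the factor k1 or k2 of the equation cancels
    one denominator. *)
Lemma B2_deriv_term k k1 t (v F : fseq R) : v 0 = 0 -> F 0 = 0 ->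
  ((6 * k1 * (k - k1))%:~R)^-1 *
   (Complex 0 ((3 * k * k1 * (k - k1))%:~R : R) * EE (3 * k * k1 * (k - k1)) t * (v k1 * v (k - k1)) +
     EE (3 * k * k1 * (k - k1)) t * (k1%:~R * F k1 * v (k - k1) + v k1 * ((k - k1)%:~R * F (k - k1))))
  = k%:~R * (Complex 0 2^-1 * nt v k t k1) +
    6^-1 * (EE (3 * k * k1 * (k - k1)) t * ((k - k1)%:~R)^-1 * v (k - k1) * F k1 +
            EE (3 * k * k1 * (k - k1)) t * (k1%:~R)^-1 * v k1 * F (k - k1)).
Proof.
move=> v0 F0; rewrite im_int im_half /nt -/(EE _ _).
have [->|k10] := eqVneq k1 0.
  by rewrite v0 F0 !(mulr0, mul0r, invr0, addr0, mulr0z).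
have [k20|k20] := eqVneq (k - k1) 0.
  by rewrite k20 v0 F0 !(mulr0, mul0r, invr0, addr0, add0r, mulr0z).
move: k20; set k2 := k - k1 => k20; rewrite !intrM.
move: (EE _ _) => e; move: (v k1) (v k2) (F k1) (F k2) => x y z w.
have h1 : k1%:~R != 0 :> C by rewrite intr_eq0.
have h2 : k2%:~R != 0 :> C by rewrite intr_eq0.
have -> : (3%:~R : C) = 3 by [].
have -> : (6%:~R : C) = 6 by [].
by field; rewrite h1 h2 /=.
Qed.

(** As 0^-1 = 0, [c3] vanishes at a resonance; multiplying back by the phase therefore restores the
    cubic coefficient i/(6 k1) except there, where [cres] is what is missing. *)
Lemma c3_im k k1 k2 :
  c3 k k1 k2 * Complex 0 ((Ph k k1 k2)%:~R : R) =
  (if A (k - k1) then Complex 0 2^-1 * 3^-1 * (k1%:~R)^-1 else 0) - cres k k1 k2.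
Proof.
rewrite /c3 /cres im_int im_half; case: (A _) => /=; last by rewrite mul0r subrr.
have [->|p0] := eqVneq (Ph k k1 k2) 0; first by rewrite subrr mulr0z !mul0r mulr0.
rewrite subr0; have [->|k10] := eqVneq k1 0.
  by rewrite !(mulr0, mul0r, invr0, mulr0z).
have h1 : k1%:~R != 0 :> C by rewrite intr_eq0.
move: (Ph k k1 k2) p0 => p p0; have h2 : p%:~R != 0 :> C by rewrite intr_eq0.
rewrite !intrM; have -> : (6%:~R : C) = 6 by [].
by field; rewrite h1 h2.
Qed.

Variables (T a : R) (v : R -> fseq R).
Hypotheses (T0 : 0 <= T) (a0 : 0 <= a) (hv : gsol A T a v).

Let Ft t k := Fn A (v t) k t.

Lemma Ft0 t : Ft t 0 = 0.
Proof. by have [A0 _ _ _] := hv; rewrite /Ft /Fn A0. Qed.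

(* Differentiating by parts: [B2] removes the quadratic terms, [B3] the nonresonant cubic
   ones, and [Er] collects the truncation errors. *)
Definition Ynf M M' k t := v t k - B2 M (v t) k t + B3 M M' (v t) k t.

Lemma cprim_v k : cprim T (fun t => v t k) (fun t => k%:~R * Ft t k).
Proof. by have [_ _ _] := hv. Qed.

Lemma cprim_EE n : cprim T (EE n) (fun t => Complex 0 (n%:~R : R) * EE n t).
Proof. exact: cprim_exp. Qed.

Lemma B2_prim M k : cprim T (fun t => B2 M (v t) k t)
  (fun t => k%:~R * (Complex 0 2^-1 * \sum_(k1 <- Sb k M) nt (v t) k t k1) +
     3^-1 * \sum_(k1 <- Sb k M) EE (3 * k * k1 * (k - k1)) t * (k1%:~R)^-1 * v t k1 * Ft t (k - k1)).
Proof.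
have := cprim_sum (Sb k M) T0 (fun k1 => cprimZ (((6 * k1 * (k - k1))%:~R)^-1) T0
  (cprimM T0 (cprim_EE (3 * k * k1 * (k - k1))) (cprimM T0 (cprim_v k1) (cprim_v (k - k1))))).
apply: cprim_eq => // t tT; first by apply: eq_bigr => k1 _; rewrite !mulrA.
have [_ v0 _ _] := hv.
under eq_bigr do rewrite B2_deriv_term ?v0 ?Ft0 //.
rewrite big_split /= -!mulr_sumr; congr (_ + _).
rewrite big_split /=.
set s1 := \sum_(k1 <- _) _; set s2 := \sum_(k1 <- _) _.
(* The reflection k1 -> k - k1 exchanges the two sums and preserves [Sb k M]; the coefficient 1/6
   doubles to 1/3. *)
have -> : s1 = s2.
  rewrite /s1 /s2 -[RHS]Sb_reflect; apply: eq_bigr => k1 _.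
  have -> : k - (k - k1) = k1 by ring.
  by have -> : 3 * k * (k - k1) * k1 = 3 * k * k1 * (k - k1) by ring.
by field.
Qed.

Lemma B3_prim M M' k : cprim T (fun t => B3 M M' (v t) k t)
  (fun t => sum3 M M' k (fun k1 k2 => (if A (k - k1) then Complex 0 2^-1 * 3^-1 * (k1%:~R)^-1 else 0) *
      (EE (Ph k k1 k2) t * (v t k1 * v t k2 * v t (k - k1 - k2))))
    - Res M M' (v t) k t + Q3 M M' (v t) (Ft t) k t).
Proof.
have := cprim_sum (Sb k M) T0 (fun k1 => cprim_sum (bx M') T0 (fun k2 =>
  cprimZ (c3 k k1 k2) T0 (cprimM T0 (cprim_EE (Ph k k1 k2))
   (cprimM T0 (cprimM T0 (cprim_v k1) (cprim_v k2)) (cprim_v (k - k1 - k2)))))).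
apply: cprim_eq => // t tT.
rewrite /Res /Q3 /sum3 -sumrB -big_split; apply: eq_bigr => k1 _ /=.
rewrite -sumrB -big_split; apply: eq_bigr => k2 _ /=.
rewrite -mulrBl -c3_im; ring.
Qed.

(** Inserting the truncated equation for the frequency k - k1; the two quadratic phases add up to
    [Ph]. *)
Lemma T3_expand M M' k t : 0 <= t <= T ->
  3^-1 * \sum_(k1 <- Sb k M) EE (3 * k * k1 * (k - k1)) t * (k1%:~R)^-1 * v t k1 *
     FnS A (bx M') (v t) (k - k1) t =
  sum3 M M' k (fun k1 k2 => (if A (k - k1) then Complex 0 2^-1 * 3^-1 * (k1%:~R)^-1 else 0) *
      (EE (Ph k k1 k2) t * (v t k1 * v t k2 * v t (k - k1 - k2)))).
Proof.
move=> tT; rewrite mulr_sumr; apply: eq_bigr => k1 _.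
rewrite /FnS; case: (A _); last first.
  by rewrite !mulr0 big1 // => k2 _; rewrite mul0r.
rewrite !mulr_sumr; apply: eq_bigr => k2 _.
by rewrite PhE EED /nt -/(EE _ _); ring.
Qed.

Lemma Ynf_prim M M' k : A k -> cprim T (Ynf M M' k)
  (fun t => Er M M' (v t) k t - Res M M' (v t) k t + Q3 M M' (v t) (Ft t) k t).
Proof.
move=> Ak; have := cprimD T0 (cprimB T0 (cprim_v k) (B2_prim M k)) (B3_prim M M' k).
apply: cprim_eq => // t tT.
rewrite -T3_expand // /Er /Ft; under [X in _ = _ - _ * X - _ + _]eq_bigr do rewrite mulrBr.
rewrite sumrB (_ : FnS A (Sb k M) (v t) k t = Complex 0 2^-1 * \sum_(k1 <- Sb k M) nt (v t) k t k1); last first.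
  by rewrite /FnS Ak.
set x := \sum_(i <- Sb k M) EE _ _ * _ * _ * Fn _ _ _ _.
set y := \sum_(i <- Sb k M) EE _ _ * _ * _ * FnS _ _ _ _ _.
ring.
Qed.

End NormalForm.

(** * Bounds for the kernels of the normal form *)

Section KernelBounds.
Variable R : realType.
Notation C := (R[i]).
Notation ii := (@iv R).

Lemma iv_sub_le (j l : int) : j != 0 -> l != 0 -> `|j + l|%:~R * ii j * ii l <= ii j + ii l.
Proof.
move=> j0 l0; have hj := normMiv R j0; have hl := normMiv R l0.
have h : `|j + l|%:~R <= `|j|%:~R + `|l|%:~R :> R.
  by rewrite -intrD ler_int ler_normD.
have := ler_wpM2r (mulr_ge0 (iv_ge0 R j) (iv_ge0 R l)) h.
rewrite mulrDl [`|l|%:~R * _]mulrCA hl [`|j|%:~R * _]mulrA hj mulr1 mul1r.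
by rewrite mulrA [iv R l + _]addrC.
Qed.

Lemma iv_num_le (j l : int) : `|j + l|%:~R * ii j * ii l <= ii j + ii l.
Proof.
have [->|j0] := eqVneq j 0; first by rewrite iv0 mulr0 mul0r add0r iv_ge0.
have [->|l0] := eqVneq l 0; first by rewrite iv0 mulr0 addr0 iv_ge0.
exact: iv_sub_le.
Qed.

(** As p + q + r = 2 k, one of the three has modulus at least 2n/3, which gives 3/(2n). The
    remaining factor kept is always 1/p or 1/q, the ones for which [tri_1p] and [tri_1q] apply. *)
Lemma iv_high3 (n : nat) (p q r k : int) : (0 < n)%N -> n%:Z <= `|k| -> p + q + r = 2 * k ->
  ii p * ii q * ii r <= 3 / 2 / n%:R * (ii p + ii q).
Proof.
move=> n0 nk pqr.
have nR : 0 < n%:R :> R by rewrite ltr0n.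
have p0 := iv_ge0 R p; have q0 := iv_ge0 R q; have r0 := iv_ge0 R r.
have p1 := iv_le1 R p; have q1 := iv_le1 R q; have r1 := iv_le1 R r.
have big x : 2 * n%:Z <= 3 * `|x| -> ii x <= 3 / 2 / n%:R.
  move=> hx; have x0 : x != 0 by lia.
  have : (2 * n%:Z)%:~R <= (3 * `|x|)%:~R :> R by rewrite ler_int.
  rewrite !intrM -[(n%:Z)%:~R]/(n%:R) => h.
  have := ler_wpM2r (iv_ge0 R x) h.
  rewrite -[X in _ <= X]mulrA normMiv // mulr1 -[3%:~R]/(3 : R) -[2%:~R]/(2 : R) => h2.
  rewrite ler_pdivlMr //; lra.
have c0 : 0 <= 3 / 2 / n%:R :> R by rewrite divr_ge0 // divr_ge0.
have [hp|hp] := boolP (2 * n%:Z <= 3 * `|p|).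
  have := big p hp => h.
  have h1 : ii p * ii q * ii r <= ii p * ii q by rewrite ler_piMr // mulr_ge0.
  have h2 : ii p * ii q <= 3 / 2 / n%:R * ii q by rewrite ler_wpM2r.
  rewrite mulrDr; have := mulr_ge0 c0 p0; lra.
have [hq|hq] := boolP (2 * n%:Z <= 3 * `|q|).
  have := big q hq => h.
  have h1 : ii p * ii q * ii r <= ii p * ii q by rewrite ler_piMr // mulr_ge0.
  have h2 : ii q * ii p <= 3 / 2 / n%:R * ii p by rewrite ler_wpM2r.
  rewrite mulrDr; have := mulr_ge0 c0 q0; lra.
have hr : 2 * n%:Z <= 3 * `|r| by lia.
have := big r hr => h.
have h1 : ii p * ii q * ii r <= ii p * ii r.
  by rewrite mulrAC ler_piMr // mulr_ge0.
have h2 : ii r * ii p <= 3 / 2 / n%:R * ii p by rewrite ler_wpM2r.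
rewrite mulrDr; have := mulr_ge0 c0 q0; lra.
Qed.

Variable A : pred int.
Hypothesis A0 : A 0 = false.

Lemma cn_c3_le k k1 k2 :
  cn (c3 R A k k1 k2) <= ii k1 * (ii (k1 + k2) * ii (k - k2) * ii (k - k1)).
Proof.
rewrite /c3; case: (A _); last by rewrite cn0 !mulr_ge0 ?iv_ge0.
have ivM x y : (`|x * y|%:~R)^-1 = ii x * ii y by rewrite normrM intrM invfM.
have ivM' x y : ii (x * y) = ii x * ii y by exact: ivM.
rewrite cnV cn_int ivM /Ph !ivM'.
have x0 := mulr_ge0 (mulr_ge0 (mulr_ge0 (iv_ge0 R (k1 + k2)) (iv_ge0 R (k - k2))) (iv_ge0 R (k - k1))) (iv_ge0 R k1).
have -> : ii k1 * (ii (k1 + k2) * ii (k - k2) * ii (k - k1)) =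
  1 * (ii (k1 + k2) * ii (k - k2) * ii (k - k1) * ii k1) by ring.
rewrite [leLHS](_ : _ = (ii 6 * ii 3) * (ii (k1 + k2) * ii (k - k2) * ii (k - k1) * ii k1)); last by ring.
apply: ler_wpM2r => //; rewrite -[leRHS]mulr1; apply: ler_pM; rewrite ?iv_ge0 ?iv_le1 //.
Qed.

Lemma c3_high n k k1 k2 : (0 < n)%N -> n%:Z <= `|k| ->
  cn (c3 R A k k1 k2) <= 3 / 2 / n%:R * (ii k1 * ii (k1 + k2) + ii k1 * ii (k - k2)).
Proof.
move=> n0 nk; apply: le_trans (cn_c3_le _ _ _) _.
rewrite -mulrDr [leRHS]mulrCA ler_wpM2l ?iv_ge0 //; apply: (iv_high3 n0 nk); ring.
Qed.

(** [A (k - k1)] and [A 0 = false] exclude r = 0, so a resonance means p = 0 or q = 0. *)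
Lemma cres_le k k1 k2 : cn (cres R A k k1 k2) <= dl0 R (k1 + k2) + dl0 R (k - k2).
Proof.
rewrite /cres; case: ifP => [/andP[Ar]|_]; last by rewrite cn0 addr_ge0 ?dl0_ge0.
have r0 : k - k1 != 0 by apply: contraTneq Ar => ->; rewrite A0.
rewrite /Ph !mulf_eq0 (negPf r0) orbF /= => h.
apply: (@le_trans _ _ 1); last first.
  by case/orP: h => /eqP ->; rewrite /dl0 eqxx ?lerDl ?lerDr ler0n.
rewrite !cnM cn_half !cnV cn_int.
have -> : (3 : C) = 3%:~R by [].
rewrite cn_int -/(iv R k1).
have := iv_le1 R k1; have := iv_ge0 R k1.
have -> : (`|3|%:~R : R) = 3 by [].
move: (ii k1) => x; lra.
Qed.

Lemma q1_le k k1 k2 : cn (c3 R A k k1 k2 * k1%:~R) <=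
  ii (k1 + k2) * ii (k - k2) * ii (k - k1).
Proof.
rewrite cnM cn_int; have := ler_wpM2r (ler0n R (absz k1)) (cn_c3_le k k1 k2).
rewrite -abszE -pmulrn => /le_trans; apply.
have [->|k10] := eqVneq k1 0; first by rewrite mulr0 !mulr_ge0 ?iv_ge0.
have := normMiv R k10; rewrite -abszE -pmulrn => h.
by rewrite mulrAC [ii k1 * _]mulrC h mul1r.
Qed.

(** Writing k2 = p - k1 splits k2/(k1 p) into 1/k1 and 1/p, so the derivative on the second factor
    costs nothing. The third factor is treated in the same way by k3 = q - k1. *)
Lemma q2_le k k1 k2 : cn (c3 R A k k1 k2 * k2%:~R) <=
  ii k1 * ii (k - k2) * ii (k - k1) + ii (k1 + k2) * ii (k - k2) * ii (k - k1).
Proof.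
rewrite cnM cn_int; have k2z : 0 <= `|k2|%:~R :> R by rewrite ler0z.
have := ler_wpM2r k2z (cn_c3_le k k1 k2) => /le_trans; apply.
have := iv_num_le (- k1) (k1 + k2); rewrite ivN addKr => h.
have := ler_wpM2r (mulr_ge0 (iv_ge0 R (k - k2)) (iv_ge0 R (k - k1))) h.
by apply: le_trans_eq2; ring.
Qed.

Lemma q3_le k k1 k2 : cn (c3 R A k k1 k2 * (k - k1 - k2)%:~R) <=
  ii k1 * ii (k1 + k2) * ii (k - k1) + ii (k1 + k2) * ii (k - k2) * ii (k - k1).
Proof.
rewrite cnM cn_int; have k3z : 0 <= `|k - k1 - k2|%:~R :> R by rewrite ler0z.
have := ler_wpM2r k3z (cn_c3_le k k1 k2) => /le_trans; apply.
have := iv_num_le (- k1) (k - k2); rewrite ivN.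
have -> : - k1 + (k - k2) = k - k1 - k2 by ring.
move=> h.
have := ler_wpM2r (mulr_ge0 (iv_ge0 R (k1 + k2)) (iv_ge0 R (k - k1))) h.
by apply: le_trans_eq2; ring.
Qed.

End KernelBounds.

Section PointwiseBounds.
Variable R : realType.
Notation C := (R[i]).

Lemma slotd_weaken s b (f g : int -> C) a t d e a' t' d' e' :
  [/\ 0 <= a <= a', 0 <= t <= t', 0 <= d <= d' & 0 <= e <= e'] ->
  slotd s b f g a t d e -> slotd s b f g a' t' d' e'.
Proof.
move=> [aa tt dd ee] [[f1 f2] [g1 g2] h1 h2].
have W (h : int -> R) x y : 0 <= x <= y -> (forall k, 0 <= h k) -> slotb b h x -> slotb b h y.
  move=> xy h0; case: (b) => /= hh; first by apply: l2b_le hh => // k; rewrite h0 lexx.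
  by move=> k; case/andP: xy => _; exact: le_trans (hh k).
by split; [split|split| |]; (apply: W; [|move=> k|]); rewrite ?mulr_ge0 ?wt_ge0 ?cn_ge0 //;
  eassumption.
Qed.

Lemma uniq_triples (K : seq int) (S1 : int -> seq int) (S2 : seq int) :
  uniq K -> (forall k, uniq (S1 k)) -> uniq S2 ->
  uniq (flatten [seq [seq (k, k1, k2) | k1 <- S1 k, k2 <- S2] | k <- K] : seq trip).
Proof.
move=> uK u1 u2.
have -> : flatten [seq [seq (k, k1, k2) | k1 <- S1 k, k2 <- S2] | k <- K] =
  [seq (p.1, p.2, k2) | p <- [seq (k, k1) | k <- K, k1 <- S1 k], k2 <- S2].
  elim: K {uK} => //= k K ->; rewrite allpairs_cat; congr (_ ++ _).
  by rewrite allpairs_mapl.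
apply: allpairs_uniq => //; last by move=> [[? ?] ?] [[? ?] ?] _ _ [-> -> ->].
apply: allpairs_uniq_dep => //.
by move=> [? ?] [? ?] _ _ [-> ->].
Qed.

End PointwiseBounds.

(** * Difference estimates for the terms of the normal form at a fixed time *)

Section PointwiseEstimates.
Variable R : realType.
Notation C := (R[i]).
Notation ii := (@iv R).

Lemma big_triples (K : seq int) (S1 : int -> seq int) (S2 : seq int) (f : trip -> R) :
  \sum_(x <- flatten [seq [seq (k, k1, k2) | k1 <- S1 k, k2 <- S2] | k <- K]) f x =
  \sum_(k <- K) \sum_(k1 <- S1 k) \sum_(k2 <- S2) f (k, k1, k2).
Proof.
by rewrite big_flatten big_map; apply: eq_bigr => k _; rewrite big_allpairs_dep.
Qed.

(** Flattens the nested sums into one list of triples, to which [tri_diff] applies. The bound is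
    independent of [M] and [M'], so the truncation can be removed afterwards. *)
Lemma sum3_diff s (c : int -> int -> int -> C) W b1 b2 b3 Cc (psi f1 f2 f3 g1 g2 g3 : int -> C)
    P a t d e (K : seq int) M M' (u : R) :
  0 <= s -> (forall k k1 k2, 0 <= W k k1 k2) -> tribound W b1 b2 b3 Cc ->
  0 <= P -> [/\ 0 <= a, 0 <= t, 0 <= d & 0 <= e] -> l2b (fun k => cn (psi k)) P ->
  slotd s b1 f1 g1 a t d e -> slotd s b2 f2 g2 a t d e -> slotd s b3 f3 g3 a t d e ->
  uniq K -> {in K, forall k k1 k2, cn (c k k1 k2) <= W k k1 k2} ->
  \sum_(k <- K) cn (psi k) * wt s k * cn
    (sum3 M M' k (fun k1 k2 => c k k1 k2 * (EE (Ph k k1 k2) u * (f1 k1 * f2 k2 * f3 (k - k1 - k2)))) -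
     sum3 M M' k (fun k1 k2 => c k k1 k2 * (EE (Ph k k1 k2) u * (g1 k1 * g2 k2 * g3 (k - k1 - k2)))))
  <= cw s * Cc * P * (3 * (e * a * a) + 6 * (d * t * a)).
Proof.
move=> s0 W0 hW P0 h0 hp s1 s2 s3 uK hc.
have uL := uniq_triples uK (fun k => Sb_uniq k M) (bx_uniq M').
have := tri_diff s0 W0 hW (fun k => cn_ge0 (psi k)) P0 h0 hp s1 s2 s3 uL.
rewrite big_triples; apply: le_trans.
rewrite big_seq [leRHS]big_seq; apply: ler_sum => k kK.
rewrite /sum3 -sumrB.
have w0 : 0 <= cn (psi k) * wt s k by rewrite mulr_ge0 ?cn_ge0 ?wt_ge0.
apply: le_trans (ler_wpM2l w0 (cn_sum _ _ _)) _.
rewrite mulr_sumr; apply: ler_sum => k1 _; rewrite -sumrB.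
apply: le_trans (ler_wpM2l w0 (cn_sum _ _ _)) _.
rewrite mulr_sumr; apply: ler_sum => k2 _ /=.
rewrite -!mulrBr cnM cnM cn_EE mul1r mulrA ler_wpM2r ?cn_ge0 //.
by rewrite ler_wpM2l // hc.
Qed.

(** The bound of [tri_diff] once every size is multiplied by [cF s a]: three arguments give the
    third power. *)
Definition bigC s a : R := cw s * cF s a ^+ 3 * (3 * (a * a) + 6 * a).

Lemma bigC_ge0 s a : 0 <= a -> 0 <= bigC s a.
Proof.
move=> a0; have := cF_ge1 s a0 => h; have : 0 <= cF s a by lra.
by move=> c0; rewrite !(mulr_ge0, addr_ge0, exprn_ge0) ?cw_ge0.
Qed.

Variables (s : R) (w v : fseq R) (a t d e : R).
Hypotheses (s0 : 0 <= s) (h0 : [/\ 0 <= a, 0 <= t, 0 <= d & 0 <= e])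
  (hs : slotd s true w v a t d e) (w0 : w 0 = 0) (v0 : v 0 = 0).
Notation c := (cF s a).

Let hpar : [/\ 0 <= c * a, 0 <= c * t, 0 <= c * d & 0 <= c * (e + d * t)].
Proof.
have [a0 t0 d0 e0] := h0; have c1 := cF_ge1 s a0; have c0 : 0 <= c by lra.
by split; rewrite ?mulr_ge0 ?addr_ge0 ?mulr_ge0.
Qed.

Let hsc : slotd s true w v (c * a) (c * t) (c * d) (c * (e + d * t)).
Proof.
have [a0 t0 d0 e0] := h0; have c1 := cF_ge1 s a0.
have mono x y : 0 <= x <= y -> 0 <= x <= c * y.
  by move=> /andP[x0 xy]; rewrite x0 (le_trans xy) // ler_peMl // (le_trans x0).
apply: slotd_weaken hs; split; apply: mono; rewrite ?lexx ?a0 ?t0 ?d0 ?e0 //=.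
by rewrite lerDl mulr_ge0.
Qed.

Let hsF A u := slotd_Fn A u s0 h0 hs w0 v0.

Lemma final_le Cc P : 0 <= Cc -> 0 <= P ->
  cw s * Cc * P * (3 * (c * (e + d * t) * (c * a) * (c * a)) + 6 * (c * d * (c * t) * (c * a)))
  <= Cc * bigC s a * P * (e + d * t).
Proof.
move=> C0 P0; have [a0 t0 d0 e0] := h0; have c1 := cF_ge1 s a0; have c0 : 0 <= c by lra.
have := cw_ge0 (R := R) s => cw0.
have x0 : 0 <= d * t by rewrite mulr_ge0.
have -> : Cc * bigC s a * P * (e + d * t) =
   cw s * Cc * P * c ^+ 3 * ((3 * (a * a) + 6 * a) * (e + d * t)) by rewrite /bigC; ring.
have -> : cw s * Cc * P * (3 * (c * (e + d * t) * (c * a) * (c * a)) + 6 * (c * d * (c * t) * (c * a)))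
  = cw s * Cc * P * c ^+ 3 * (3 * ((e + d * t) * (a * a)) + 6 * (d * t * a)) by ring.
apply: ler_wpM2l; first by rewrite (mulr_ge0 (mulr_ge0 (mulr_ge0 cw0 C0) P0)) ?exprn_ge0.
have : 0 <= e * a by rewrite mulr_ge0.
move: (d * t) x0 => x x0; lra.
Qed.

Variables (A : pred int) (psi : int -> C) (P : R) (K : seq int).
Hypotheses (A0 : A 0 = false) (P0 : 0 <= P) (hp : l2b (fun k => cn (psi k)) P) (uK : uniq K).

Lemma Res_diff M M' u : \sum_(k <- K) cn (psi k) * wt s k *
   cn (Res A M M' w k u - Res A M M' v k u) <= 2 * bigC s a * P * (e + d * t).
Proof.
apply: le_trans (final_le (ler0n _ 2) P0).
apply: (@sum3_diff s (cres R A) (fun k k1 k2 => dl0 R (k1 + k2) + dl0 R (k - k2)) true true true) => //.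
- by move=> k k1 k2; rewrite addr_ge0 ?dl0_ge0.
- by have := triboundD (@tri_res_p R) (@tri_res_q R); have -> : 1 + 1 = 2 :> R by [].
- by move=> k _ k1 k2; exact: cres_le.
Qed.

Lemma B3_diff n M M' u : (0 < n)%N -> {in K, forall k, n%:Z <= `|k|} ->
  \sum_(k <- K) cn (psi k) * wt s k * cn (B3 A M M' w k u - B3 A M M' v k u) <=
   12 / n%:R * bigC s a * P * (e + d * t).
Proof.
move=> n0 hn; have c0 : 0 <= 3 / 2 / n%:R :> R by rewrite !divr_ge0.
apply: le_trans (final_le _ P0); last by rewrite divr_ge0.
apply: (@sum3_diff s (c3 R A) (fun k k1 k2 => 3 / 2 / n%:R * (ii k1 * ii (k1 + k2) + ii k1 * ii (k - k2))) true true true) => //.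
- by move=> k k1 k2; rewrite mulr_ge0 // addr_ge0 // mulr_ge0 // iv_ge0.
- have := triboundZ c0 (triboundD (@tri_1p R) (@tri_1q R)).
  have -> : 3 / 2 / n%:R * (4 + 4) = 12 / n%:R :> R; last by [].
  by field; rewrite pnatr_eq0 -lt0n n0.
- by move=> k kK k1 k2; apply: c3_high => //; exact: hn.
Qed.

(** The time derivative falls on each of the three factors in turn. The constants are 8, 16 and 16,
    the last two kernels being sums of two. *)
Lemma Q3_diff M M' u : \sum_(k <- K) cn (psi k) * wt s k *
   cn (Q3 A M M' w (Fn A w ^~ u) k u - Q3 A M M' v (Fn A v ^~ u) k u) <=
   40 * bigC s a * P * (e + d * t).
Proof.
have i0 x : 0 <= ii x := iv_ge0 R x.
pose q1 (x F : fseq R) k := sum3 M M' k (fun k1 k2 => c3 R A k k1 k2 * k1%:~R *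
   (EE (Ph k k1 k2) u * (F k1 * x k2 * x (k - k1 - k2)))).
pose q2 (x F : fseq R) k := sum3 M M' k (fun k1 k2 => c3 R A k k1 k2 * k2%:~R *
   (EE (Ph k k1 k2) u * (x k1 * F k2 * x (k - k1 - k2)))).
pose q3 (x F : fseq R) k := sum3 M M' k (fun k1 k2 => c3 R A k k1 k2 * (k - k1 - k2)%:~R *
   (EE (Ph k k1 k2) u * (x k1 * x k2 * F (k - k1 - k2)))).
have QE x F k : Q3 A M M' x F k u = q1 x F k + q2 x F k + q3 x F k.
  rewrite /Q3 /q1 /q2 /q3 /sum3 -!big_split; apply: eq_bigr => k1 _ /=.
  by rewrite -!big_split; apply: eq_bigr => k2 _ /=; ring.
have h1 : \sum_(k <- K) cn (psi k) * wt s k * cn (q1 w (Fn A w ^~ u) k - q1 v (Fn A v ^~ u) k)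
    <= 8 * bigC s a * P * (e + d * t).
  apply: le_trans (final_le _ P0) => //.
  apply: (@sum3_diff s (fun k k1 k2 => c3 R A k k1 k2 * k1%:~R) _ false true true) (@tri_q1 R) _ _ _ _ _ _ _ _ => //.
  - by move=> k k1 k2; rewrite !mulr_ge0.
  - by move=> k _ k1 k2; exact: q1_le.
have h2 : \sum_(k <- K) cn (psi k) * wt s k * cn (q2 w (Fn A w ^~ u) k - q2 v (Fn A v ^~ u) k)
    <= (8 + 8) * bigC s a * P * (e + d * t).
  apply: le_trans (final_le _ P0) => //.
  apply: (@sum3_diff s (fun k k1 k2 => c3 R A k k1 k2 * k2%:~R) _ true false true)
    (triboundD (@tri_q2a R) (@tri_q2b R)) _ _ _ _ _ _ _ _ => //.
  - by move=> k k1 k2; rewrite addr_ge0 // !mulr_ge0.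
  - by move=> k _ k1 k2; exact: q2_le.
have h3 : \sum_(k <- K) cn (psi k) * wt s k * cn (q3 w (Fn A w ^~ u) k - q3 v (Fn A v ^~ u) k)
    <= (8 + 8) * bigC s a * P * (e + d * t).
  apply: le_trans (final_le _ P0) => //.
  apply: (@sum3_diff s (fun k k1 k2 => c3 R A k k1 k2 * (k - k1 - k2)%:~R) _ true true false)
    (triboundD (@tri_q3a R) (@tri_q3b R)) _ _ _ _ _ _ _ _ => //.
  - by move=> k k1 k2; rewrite addr_ge0 // !mulr_ge0.
  - by move=> k _ k1 k2; exact: q3_le.
apply: le_trans (le_trans (lerD (lerD h1 h2) h3) _); last first.
  by apply: ler_of_eq; ring.
rewrite -!big_split /=; apply: ler_sum => k _; rewrite -!mulrDr !QE.
apply: ler_wpM2l; first by rewrite mulr_ge0 ?cn_ge0 ?wt_ge0.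
rewrite -![X in cn (X - _)]addrA; set x1 := q1 _ _ _; set x2 := q2 _ _ _; set x3 := q3 _ _ _.
set y1 := q1 _ _ _; set y2 := q2 _ _ _; set y3 := q3 _ _ _.
have -> : x1 + (x2 + x3) - (y1 + y2 + y3) = (x1 - y1) + (x2 - y2) + (x3 - y3) by ring.
by rewrite (le_trans (cnD _ _)) // lerD2r cnD.
Qed.

(** Since k = k1 + k2, the kernel 1/(k1 k2) is at most (1/k1 + 1/k2)/|k| in modulus, and |k| >=
    n. *)
Lemma B2_diff n M u : (0 < n)%N -> {in K, forall k, n%:Z <= `|k|} ->
  \sum_(k <- K) cn (psi k) * wt s k * cn (B2 M w k u - B2 M v k u) <=
   cw s * 4 / n%:R * P * (2 * (1 + a) * (e + d * t)).
Proof.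
move=> n0 hn; have [a0 t0 d0 e0] := h0.
have uL : uniq [seq (k, k1) | k <- K, k1 <- Sb k M].
  apply: allpairs_uniq_dep => //; first by move=> k _; exact: Sb_uniq.
  by move=> [? ?] [? ?] _ _ [-> ->].
have i1 (k k1 : int) : 0 <= ii k1 by exact: iv_ge0.
have i2 (k k1 : int) : 0 <= ii (k - k1) by exact: iv_ge0.
have b1 := bi_diff s0 i1 (@bi_1 R) (fun k => cn_ge0 (psi k)) P0 h0 hp hs hs uL.
have b2 := bi_diff s0 i2 (@bi_2 R) (fun k => cn_ge0 (psi k)) P0 h0 hp hs hs uL.
have nR : 0 < n%:R :> R by rewrite ltr0n.
have := ler_wpM2l (ltW (divr_gt0 ltr01 nR)) (lerD b1 b2).
rewrite -big_split /= big_allpairs_dep /= mulr_sumr => h.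
have {h}h := le_trans _ h; apply: le_trans (h _ _) _.
  rewrite big_seq [leRHS]big_seq; apply: ler_sum => k kK.
  rewrite mulr_sumr /B2 -sumrB.
  have w0' : 0 <= cn (psi k) * wt s k by rewrite mulr_ge0 ?cn_ge0 ?wt_ge0.
  apply: le_trans (ler_wpM2l w0' (cn_sum _ _ _)) _.
  rewrite mulr_sumr; apply: ler_sum => k1 _ /=.
  rewrite -mulrBr -!mulrA -mulrBr !cnM cn_EE mul1r.
  set X := cn (_ - _); have X0 : 0 <= X by exact: cn_ge0.
  rewrite mulrA cnV cn_int.
  have key : (`|6 * (k1 * (k - k1))|%:~R)^-1 <= 1 / n%:R * (ii k1 + ii (k - k1)).
    have ivM x y : ii (x * y) = ii x * ii y by rewrite /iv normrM intrM invfM.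
    rewrite -/(iv R (6 * (k1 * (k - k1)))) !ivM.
    have j1 := i1 0 k1; have j2 := i1 0 (k - k1); have j6 := iv_le1 R 6.
    apply: (@le_trans _ _ (ii k1 * ii (k - k1))).
      by rewrite ler_piMl // mulr_ge0.
    have := iv_num_le R k1 (k - k1); rewrite [k1 + _]addrC subrK => hh.
    rewrite [leRHS]mulrC mul1r ler_pdivlMr //; apply: le_trans hh.
    rewrite mulrC mulrA; apply: ler_wpM2r => //; apply: ler_wpM2r => //.
    by rewrite -[leLHS]/((n%:Z)%:~R) ler_int hn.
  have := ler_wpM2l (mulr_ge0 w0' X0) key.
  by apply: le_trans_eq2; ring.
have -> : 1 / n%:R * (cw s * 2 * P * (2 * (e * a) + 2 * (d * t)) + cw s * 2 * P * (2 * (e * a) + 2 * (d * t)))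
  = cw s * 4 / n%:R * P * (2 * (e * a + d * t)) by ring.
apply: ler_wpM2l; first by rewrite mulr_ge0 // divr_ge0 ?(ltW nR) // mulr_ge0 ?cw_ge0.
rewrite -mulrA; apply: ler_wpM2l => //.
have := mulr_ge0 d0 t0; move: (d * t) => x x0; have := mulr_ge0 a0 x0; lra.
Qed.

End PointwiseEstimates.

(** * The time-integrated estimate on high frequencies *)

Section MasterEstimate.
Variable R : realType.
Notation C := (R[i]).
Notation mu := (@lebesgue_measure R).

Definition mb (T : R) (f : R -> R) := measurable_fun `[0, T] f /\ bnd_on 0 T f.

Lemma mb_integrable T f : mb T f -> mu.-integrable `[0, T] (EFin \o f).
Proof. by move=> [? ?]; exact: bnd_integrable. Qed.

Lemma mb0 T : mb T (fun=> 0).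
Proof. by split; [exact: measurable_cst|exists 0 => t _; rewrite normr0]. Qed.

Lemma mbD T f g : mb T f -> mb T g -> mb T (fun t => f t + g t).
Proof. by move=> [? ?] [? ?]; split; [exact: measurable_funD|exact: bndD]. Qed.

Lemma mbZ T c f : mb T f -> mb T (fun t => c * f t).
Proof.
move=> [? ?]; split; first by apply: measurable_funM.
by apply: bndM => //; exists `|c|.
Qed.

Lemma RintD_mb T f g : mb T f -> mb T g -> Rintegral mu `[0, T] (fun t => f t + g t) =
  Rintegral mu `[0, T] f + Rintegral mu `[0, T] g.
Proof. by move=> hf hg; rewrite RintegralD //; exact: mb_integrable. Qed.

Lemma mb_sum T (I : Type) (r : seq I) (c : I -> R) (f : I -> R -> R) :
  (forall i, mb T (f i)) -> mb T (fun t => \sum_(i <- r) c i * f i t) /\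
  Rintegral mu `[0, T] (fun t => \sum_(i <- r) c i * f i t) =
    \sum_(i <- r) c i * Rintegral mu `[0, T] (f i).
Proof.
move=> h; elim: r => [|i r [IH1 IH2]].
  have -> : (fun t : R => \sum_(i <- [::]) c i * f i t) = (fun=> 0).
    by apply/funext => t; rewrite big_nil.
  by split; [exact: mb0|rewrite big_nil Rintegral_cst // mul0r].
have -> : (fun t : R => \sum_(j <- i :: r) c j * f j t) =
   (fun t => c i * f i t + \sum_(j <- r) c j * f j t).
  by apply/funext => t; rewrite big_cons.
split; first by apply: mbD => //; exact: mbZ.
rewrite big_cons RintegralD ?IH2 ?RintegralZl //; first exact: mb_integrable.
- exact: (mb_integrable (mbZ (c i) (h i))).
- exact: mb_integrable.
Qed.

Lemma cvg_sum0 (I : Type) (r : seq I) (c : I -> R) (x : I -> nat -> R) :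
  (forall i, x i @ \oo --> (0 : R)) ->
  (fun m => \sum_(i <- r) c i * x i m) @ \oo --> (0 : R).
Proof.
move=> h; elim: r => [|i r IH].
  have -> : (fun m => \sum_(i <- [::]) c i * x i m) = (fun=> 0 : R).
    by apply/funext => t; rewrite big_nil.
  exact: cvg_cst.
have -> : (fun m => \sum_(j <- i :: r) c j * x j m) =
   (fun m => c i * x i m + \sum_(j <- r) c j * x j m).
  by apply/funext => t; rewrite big_cons.
rewrite -[X in _ --> X]addr0; apply: cvgD IH.
by rewrite -[X in _ --> X](mulr0 (c i)); apply: cvgMr; exact: h.
Qed.

Lemma cvg0_small (x : nat -> R) e : 0 < e -> x @ \oo --> (0 : R) -> exists m, x m <= e.
Proof.
move=> e0 /cvgrPdist_le /(_ e e0) [m _ hm]; exists m.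
by have := hm m (leqnn _); rewrite /= sub0r normrN; apply: le_trans; exact: ler_norm.
Qed.

Section Err.
Variables (A : pred int) (T a : R).
Hypotheses (T0 : 0 <= T) (a0 : 0 <= a).

Definition e1 (v : R -> fseq R) k M t := cabs1 (Fn A (v t) k t - FnS A (Sb k M) (v t) k t).
Definition e2 (v : R -> fseq R) j M t := cabs1 (Fn A (v t) j t - FnS A (bx M) (v t) j t).

Lemma e1_mb v k M : gsol A T a v -> mb T (e1 v k M).
Proof. by move=> hv; split; [exact: (err_meas T0 hv)|apply: (err_bnd a0 hv); exact: Sb_uniq]. Qed.

Lemma e2_mb v k M : gsol A T a v -> mb T (e2 v k M).
Proof. by move=> hv; split; [exact: (err_meas T0 hv)|apply: (err_bnd a0 hv); exact: bx_uniq]. Qed.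

Lemma e1_cvg v k : gsol A T a v ->
  (fun M => Rintegral mu `[0, T] (e1 v k M)) @ \oo --> (0 : R).
Proof. by move=> hv; apply: (err_cvg T0 a0 hv); [exact: Sb_uniq|exact: Sb_exhaust]. Qed.

Lemma e2_cvg v k : gsol A T a v ->
  (fun M => Rintegral mu `[0, T] (e2 v k M)) @ \oo --> (0 : R).
Proof.
move=> hv; apply: (err_cvg T0 a0 hv); first exact: bx_uniq.
by move=> j; exists j => m; exact: bx_sub.
Qed.

Lemma cn_Er_le v k M M' t : gsol A T a v -> 0 <= t <= T ->
  cn (Er A M M' (v t) k t) <= `|k|%:~R * e1 v k M t + \sum_(k1 <- Sb k M) a * e2 v (k - k1) M' t.
Proof.
move=> [_ _ ha _] tT; rewrite /Er (le_trans (cnB _ _)) // lerD //.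
  by rewrite cnM cn_int ler_wpM2l ?ler0z // cn_le_cabs1.
rewrite cnM; apply: (@le_trans _ _ (1 * cn (\sum_(k1 <- Sb k M) EE (3 * k * k1 * (k - k1)) t * (k1%:~R)^-1 * v t k1 *
     (Fn A (v t) (k - k1) t - FnS A (bx M') (v t) (k - k1) t)))).
  rewrite ler_wpM2r ?cn_ge0 // cnV.
  have -> : (3 : C) = 3%:~R by [].
  by rewrite cn_int; exact: (iv_le1 R 3).
rewrite mul1r (le_trans (cn_sum _ _ _)) //; apply: ler_sum => k1 _.
rewrite !cnM cn_EE mul1r cnV cn_int -/(iv R k1).
apply: ler_pM; rewrite ?mulr_ge0 ?iv_ge0 ?cn_ge0 ?cn_le_cabs1 //.
rewrite -[leRHS]mul1r; apply: ler_pM; rewrite ?cn_ge0 ?iv_ge0 ?iv_le1 //.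
exact: (@l2b_sup _ (fun k => cn (v t k)) a k1 a0 (ha t tT)).
Qed.

(** [M] is fixed first. This leaves finitely many errors of the inner sums, one for each pair of k
    in [K] and k1 in [Sb k M], and [M'] is chosen to make these small. *)
Lemma Err_small v w (K : seq int) (c : int -> R) e : gsol A T a v -> gsol A T a w -> 0 < e ->
  exists M M' (E : R -> R), [/\ mb T E, Rintegral mu `[0, T] E <= e &
    forall t,
     \sum_(k <- K) c k * ((`|k|%:~R * e1 w k M t + \sum_(k1 <- Sb k M) a * e2 w (k - k1) M' t) +
       (`|k|%:~R * e1 v k M t + \sum_(k1 <- Sb k M) a * e2 v (k - k1) M' t)) = E t].
Proof.
move=> hv hw e0; have e20 : 0 < e / 2 by rewrite divr_gt0.
pose g1 M k t := e1 w k M t + e1 v k M t.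
pose g2 M' j t := e2 w j M' t + e2 v j M' t.
have mg1 M k : mb T (g1 M k) by apply: mbD; exact: e1_mb.
have mg2 M j : mb T (g2 M j) by apply: mbD; exact: e2_mb.
have cD (x y : nat -> R) : x @ \oo --> (0 : R) -> y @ \oo --> (0 : R) ->
    (fun m => x m + y m) @ \oo --> (0 : R).
  by move=> hx hy; rewrite -[X in _ --> X]addr0; exact: cvgD.
have i1 k : (fun M => Rintegral mu `[0, T] (g1 M k)) @ \oo --> (0 : R).
  rewrite (_ : (fun M => _) = (fun M => Rintegral mu `[0, T] (e1 w k M) + Rintegral mu `[0, T] (e1 v k M))).
    by apply: cD; exact: e1_cvg.
  by apply/funext => M; rewrite (RintD_mb (e1_mb k M hw) (e1_mb k M hv)).
have i2 j : (fun M => Rintegral mu `[0, T] (g2 M j)) @ \oo --> (0 : R).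
  rewrite (_ : (fun M => _) = (fun M => Rintegral mu `[0, T] (e2 w j M) + Rintegral mu `[0, T] (e2 v j M))).
    by apply: cD; exact: e2_cvg.
  by apply/funext => M; rewrite (RintD_mb (e2_mb j M hw) (e2_mb j M hv)).
have [M hM] := cvg0_small e20 (cvg_sum0 K (fun k => c k * `|k|%:~R) i1).
pose L := [seq (k, k1) | k <- K, k1 <- Sb k M].
have [M' hM'] := cvg0_small e20 (cvg_sum0 L (fun x => c x.1 * a) (fun x => i2 (x.1 - x.2))).
have [m1 r1] := mb_sum K (fun k => c k * `|k|%:~R) (mg1 M).
have [m2 r2] := mb_sum L (fun x => c x.1 * a) (fun x => mg2 M' (x.1 - x.2)).
pose E t := \sum_(k <- K) c k * `|k|%:~R * g1 M k t + \sum_(x <- L) c x.1 * a * g2 M' (x.1 - x.2) t.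
exists M, M', E; split.
- exact: mbD.
- by rewrite (RintD_mb m1 m2) r1 r2 [leRHS]splitr; apply: lerD.
- move=> t; rewrite /E big_allpairs_dep -big_split; apply: eq_bigr => k _ /=.
  rewrite addrACA -big_split mulrDr mulr_sumr /=; congr (_ + _); first by rewrite /g1; ring.
  by apply: eq_bigr => k1 _ /=; rewrite /g2; ring.
Qed.

Variables (s : R) (w v : R -> fseq R) (t0 t1 t d e : R).
Hypotheses (s0 : 0 <= s) (hv : gsol A T a v) (hw : gsol A T a w)
  (h0 : [/\ 0 <= a, 0 <= t, 0 <= d & 0 <= e])
  (t00 : 0 <= t0) (t01 : t0 <= t1) (t1T : t1 <= T)
  (hs : forall u, t0 <= u <= t1 -> slotd s true (w u) (v u) a t d e).
Notation z u k := (w u k - v u k).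

Let inT u : t0 <= u <= t1 -> 0 <= u <= T.
Proof. by move=> /andP[u0 u1]; rewrite (le_trans t00) ?(le_trans u1). Qed.

(** The increment of w - v is that of the normal forms plus boundary terms. The derivative
    contributes 42 = 2 + 40, from [Res_diff] and [Q3_diff]; the boundary terms carry the gain 1/n
    and count twice, at t0 and t1. The truncation error is an arbitrary [eps]. *)
Lemma high_freq (n : nat) (psi : int -> C) P (K : seq int) : (0 < n)%N -> 0 <= P ->
  l2b (fun k => cn (psi k)) P -> uniq K -> {in K, forall k, n%:Z <= `|k|} -> all A K ->
  `|complex.Re (\sum_(k <- K) psi k * (wt s k)%:C%C * (z t1 k - z t0 k))| <=
    (42 * bigC s a * (t1 - t0) + (24 * bigC s a + 16 * cw s * (1 + a)) / n%:R) * P * (e + d * t).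
Proof.
move=> n0 P0 hp uK hn hA.
have [A0 v0 _ _] := hv; have [_ w0 _ _] := hw.
apply/ler_addgt0Pr => eps eps0.
have [M [M' [E [[mE bE] iE hE]]]] := Err_small K (fun k => cn (psi k) * wt s k) hv hw eps0.
pose W k : C := psi k * (wt s k)%:C%C.
have cW k : cn (W k) = cn (psi k) * wt s k.
  by rewrite cnM cn_real ger0_norm // wt_ge0.
pose dY k u := Ynf A w M M' k u - Ynf A v M M' k u.
pose D k u := (Er A M M' (w u) k u - Res A M M' (w u) k u + Q3 A M M' (w u) (Fn A (w u) ^~ u) k u) -
              (Er A M M' (v u) k u - Res A M M' (v u) k u + Q3 A M M' (v u) (Fn A (v u) ^~ u) k u).
have prim : cprim T (fun u => \sum_(k <- K) W k * dY k u) (fun u => \sum_(k <- K) W k * D k u).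
  (* [Ynf_prim] holds for k in [A] only, whereas [cprim_sum] asks for all indices; the summand is
     set to zero elsewhere. *)
  rewrite (_ : (fun u => \sum_(k <- K) W k * dY k u) = (fun u => \sum_(k <- K) (if A k then W k * dY k u else 0))); last first.
    by apply/funext => u; rewrite big_seq [RHS]big_seq; apply: eq_bigr => k /(allP hA) ->.
  rewrite (_ : (fun u => \sum_(k <- K) W k * D k u) = (fun u => \sum_(k <- K) (if A k then W k * D k u else 0))); last first.
    by apply/funext => u; rewrite big_seq [RHS]big_seq; apply: eq_bigr => k /(allP hA) ->.
  apply: (cprim_sum K (f := fun k u => if A k then W k * dY k u else 0) (F := fun k u => if A k then W k * D k u else 0) T0) => k.
  case: (boolP (A k)) => Ak; last exact: cprim_cst.
  exact: (cprimZ (W k) T0 (cprimB T0 (Ynf_prim T0 hw M M' Ak) (Ynf_prim T0 hv M M' Ak))).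
have Dle u : t0 <= u <= t1 -> cn (\sum_(k <- K) W k * D k u) <=
    42 * bigC s a * P * (e + d * t) + E u.
  move=> hu; have uT := inT hu.
  have r := Res_diff s0 h0 (hs hu) A0 P0 hp uK M M' u.
  have q := Q3_diff s0 h0 (hs hu) (w0 u uT) (v0 u uT) A P0 hp uK M M' u.
  rewrite -hE.
  have -> : 42 * bigC s a * P * (e + d * t) = 2 * bigC s a * P * (e + d * t) + 40 * bigC s a * P * (e + d * t) by ring.
  apply: le_trans (lerD (lerD r q) (lexx _)); rewrite -!big_split /=.
  rewrite (le_trans (cn_sum _ _ _)) //; apply: ler_sum => k _.
  rewrite cnM cW -!mulrDr; apply: ler_wpM2l; first by rewrite mulr_ge0 ?cn_ge0 ?wt_ge0.
  have ew := cn_Er_le k M M' hw uT; have ev := cn_Er_le k M M' hv uT.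
  rewrite /D; set x1 := Er _ _ _ (w u) _ _; set x2 := Res _ _ _ (w u) _ _; set x3 := Q3 _ _ _ (w u) _ _ _.
  set y1 := Er _ _ _ (v u) _ _; set y2 := Res _ _ _ (v u) _ _; set y3 := Q3 _ _ _ (v u) _ _ _.
  have -> : x1 - x2 + x3 - (y1 - y2 + y3) = - (x2 - y2) + (x3 - y3) + (x1 - y1) by ring.
  rewrite (le_trans (cnD _ _)) // lerD //; first by rewrite (le_trans (cnD _ _)) // cnN.
  by rewrite (le_trans (cnB _ _)) // lerD.
have E0 u : 0 <= u <= T -> 0 <= E u.
  move=> _; rewrite -hE; apply: sumr_ge0 => k _; rewrite mulr_ge0 ?mulr_ge0 ?cn_ge0 ?wt_ge0 //.
  by rewrite !addr_ge0 ?mulr_ge0 ?ler0z ?cabs1_ge0 //; apply: sumr_ge0 => k1 _; rewrite mulr_ge0 ?cabs1_ge0.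
have main := cprim_abs_le prim t00 t01 t1T mE bE E0 Dle.
pose bd u := \sum_(k <- K) W k * (B2 M (w u) k u - B2 M (v u) k u) -
   \sum_(k <- K) W k * (B3 A M M' (w u) k u - B3 A M M' (v u) k u).
have bdle u : t0 <= u <= t1 -> cn (bd u) <= ((12 * bigC s a + 8 * cw s * (1 + a)) / n%:R) * P * (e + d * t).
  move=> hu; have uT := inT hu.
  have b2 := B2_diff s0 h0 (hs hu) P0 hp uK M u n0 hn.
  have b3 := B3_diff s0 h0 (hs hu) A P0 hp uK M M' u n0 hn.
  have := lerD b2 b3 => h.
  apply: (@le_trans _ _ (cw s * 4 / n%:R * P * (2 * (1 + a) * (e + d * t)) +
     12 / n%:R * bigC s a * P * (e + d * t))); last first.
    by apply: ler_of_eq; ring.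
  apply: le_trans h; rewrite (le_trans (cnB _ _)) // lerD //;
  by rewrite (le_trans (cn_sum _ _ _)) //; apply: ler_sum => k _; rewrite cnM cW.
have split_eq : \sum_(k <- K) W k * (z t1 k - z t0 k) =
  (\sum_(k <- K) W k * dY k t1 - \sum_(k <- K) W k * dY k t0) + (bd t1 - bd t0).
  rewrite /bd -!sumrB -big_split; apply: eq_bigr => k _ /=; rewrite /dY /Ynf; ring.
have hb := le_trans (cnB _ _) (lerD (bdle t1 _) (bdle t0 _)).
rewrite -/W split_eq ReD (le_trans (ler_normD _ _)) //.
apply: le_trans (lerD main (le_trans (cn_Re _) (hb _ _))) _; rewrite ?lexx ?t01 //.
apply: (@le_trans _ _ (42 * bigC s a * P * (e + d * t) * (t1 - t0) + eps +
  (((12 * bigC s a + 8 * cw s * (1 + a)) / n%:R) * P * (e + d * t) +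
   ((12 * bigC s a + 8 * cw s * (1 + a)) / n%:R) * P * (e + d * t)))).
  by rewrite lerD2r lerD2l.
by apply: ler_of_eq; ring.
Qed.

End Err.
End MasterEstimate.

(** * Short-time increments of a difference in H^s *)

Section Increments.
Variable R : realType.
Notation C := (R[i]).

(** Testing with the conjugate of x on [K], whose norm is the square root of the sum S, gives S <= B
    sqrt(S). *)
Lemma sqr_sum_dual (K : seq int) (x : int -> C) (B : R) : uniq K -> 0 <= B ->
  (forall (psi : int -> C) P, 0 <= P -> l2b (fun k => cn (psi k)) P ->
     `|complex.Re (\sum_(k <- K) psi k * x k)| <= B * P) ->
  \sum_(k <- K) cn (x k) ^+ 2 <= B ^+ 2.
Proof.
move=> uK B0 h; set S := \sum_(k <- K) _.
have S0 : 0 <= S by apply: sumr_ge0 => k _; rewrite sqr_ge0.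
pose psi k : C := if k \in K then conjc (x k) else 0.
have hp : l2b (fun k => cn (psi k)) (Num.sqrt S).
  move=> L uL; rewrite sqr_sqrtr //.
  apply: (@le_trans _ _ (\sum_(k <- L | k \in K) cn (x k) ^+ 2)).
    rewrite [leRHS]big_mkcond; apply: ler_sum => k _; rewrite /psi.
    by case: ifP => _; rewrite ?cn_conj // cn0 expr0n.
  rewrite -big_filter; apply: ler_sum_subset => [k||k]; rewrite ?sqr_ge0 ?filter_uniq //.
  by rewrite mem_filter => /andP[].
have := h psi _ (sqrtr_ge0 S) hp.
have -> : complex.Re (\sum_(k <- K) psi k * x k) = S.
  rewrite Re_sum big_seq /S [RHS]big_seq; apply: eq_bigr => k kK.
  by rewrite /psi kK cn_sqr /cabs2; case: (x k) => p q; rewrite ReM /=; ring.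
rewrite ger0_norm // => h1.
have := sqr_sqrtr S0; have := sqrtr_ge0 S; move: (Num.sqrt S) h1 => q h1 q0 qS.
have [q00|qn] := eqVneq q 0; first by rewrite -qS q00 expr0n sqr_ge0.
have qp : 0 < q by rewrite lt_neqAle eq_sym qn.
move: h1; rewrite -qS expr2 ler_pM2r // => h1; rewrite -expr2 ler_pXn2r ?nnegrE //.
Qed.

Lemma sqr_sum_split (K : seq int) (p : pred int) (f : int -> R) B1 B2 :
  0 <= B1 -> 0 <= B2 -> \sum_(k <- K | p k) f k ^+ 2 <= B1 ^+ 2 ->
  \sum_(k <- K | ~~ p k) f k ^+ 2 <= B2 ^+ 2 -> \sum_(k <- K) f k ^+ 2 <= (B1 + B2) ^+ 2.
Proof.
move=> B10 B20 h1 h2; rewrite (bigID p) /= (le_trans (lerD h1 h2)) // sqrrD addrAC lerDl.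
by rewrite mulrn_wge0 // mulr_ge0.
Qed.

Section Two.
Variables (A : pred int) (T a s : R) (w v : R -> fseq R) (t0 t1 t d e : R).
Hypotheses (T0 : 0 <= T) (s0 : 0 <= s) (hv : gsol A T a v) (hw : gsol A T a w)
  (h0 : [/\ 0 <= a, 0 <= t, 0 <= d & 0 <= e])
  (t00 : 0 <= t0) (t01 : t0 <= t1) (t1T : t1 <= T)
  (hs : forall u, t0 <= u <= t1 -> slotd s true (w u) (v u) a t d e).
Notation z u k := (w u k - v u k).

Let inT u : t0 <= u <= t1 -> 0 <= u <= T.
Proof. by move=> /andP[u0 u1]; rewrite (le_trans t00) ?(le_trans u1). Qed.

Lemma low_freq k : wt s k * cn (z t1 k - z t0 k) <=
  (if A k then `|k|%:~R * (cw s * ((1 + a) * (e + d * t))) * (t1 - t0) else 0).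
Proof.
have [A0 v0 _ pv] := hv; have [_ w0 _ pw] := hw; have [a0 tt d0 e0] := h0.
have := cprimZ ((wt s k)%:C%C) T0 (cprimB T0 (pw k) (pv k)) => pr.
have -> : wt s k * cn (z t1 k - z t0 k) =
   cn ((wt s k)%:C%C * z t1 k - (wt s k)%:C%C * z t0 k).
  by rewrite -mulrBr cnM cn_real ger0_norm // wt_ge0.
case: ifP => Ak; last first.
  rewrite -(mul0r (t1 - t0)); apply: (cprim_cn_le pr t00 t01 t1T) => u hu.
  by rewrite /Fn Ak !mulr0 subrr mulr0 cn0.
apply: (cprim_cn_le pr t00 t01 t1T) => u hu; have uT := inT hu.
rewrite -mulrBr !cnM cn_int cn_real (ger0_norm (wt_ge0 _ _)) mulrCA.
rewrite ler_wpM2l ?ler0z // (le_trans (FnB_le A k u s0 h0 (hs hu) (w0 u uT) (v0 u uT))) //.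
rewrite ler_wpM2l ?cw_ge0 //.
have := mulr_ge0 d0 tt; move: (d * t) => x x0; have := mulr_ge0 a0 x0; lra.
Qed.

(** [2 * n + 1] counts the low frequencies and crudely replaces its square root; the next factor [n]
    is the derivative in the equation. *)
Definition rate s a (n : nat) : R :=
  42 * bigC s a + (2 * n%:R + 1) * n%:R * cw s * (1 + a).

Definition gain s a : R := 24 * bigC s a + 16 * cw s * (1 + a).

Lemma gain_ge0 r b : 0 <= b -> 0 <= gain r b.
Proof.
move=> b0; apply: addr_ge0; first exact: (mulr_ge0 (ler0n _ _) (bigC_ge0 r b0)).
by apply: mulr_ge0; [exact: (mulr_ge0 (ler0n _ _) (cw_ge0 r))|exact: addr_ge0].
Qed.

Lemma rate_ge0 r b n : 0 <= b -> 0 <= rate r b n.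
Proof.
move=> b0; apply: addr_ge0; first exact: (mulr_ge0 (ler0n _ _) (bigC_ge0 r b0)).
apply: mulr_ge0; last exact: addr_ge0.
by apply: mulr_ge0 (cw_ge0 r); apply: mulr_ge0 => //.
Qed.

Lemma increment_le (n : nat) : (0 < n)%N ->
  l2b (fun k => wt s k * cn (z t1 k - z t0 k))
    ((rate s a n * (t1 - t0) + gain s a / n%:R) * (e + d * t)).
Proof.
move=> n0 K uK; have [a0 tt d0 e0] := h0.
have sg0 : 0 <= e + d * t by rewrite addr_ge0 ?mulr_ge0.
have dt0 : 0 <= t1 - t0 by rewrite subr_ge0.
have bc := bigC_ge0 s a0; have cw0 := cw_ge0 (R := R) s.
have nR : 0 <= n%:R^-1 :> R by rewrite invr_ge0.
pose f k := wt s k * cn (z t1 k - z t0 k).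
rewrite -/(\sum_(k <- K) f k ^+ 2).
set B1 := (42 * bigC s a * (t1 - t0) + gain s a / n%:R) * (e + d * t).
set B2 := (2 * n%:R + 1) * (n%:R * cw s * (1 + a) * (e + d * t) * (t1 - t0)).
have B10 : 0 <= B1.
  apply: mulr_ge0 => //; apply: addr_ge0; first exact: (mulr_ge0 (mulr_ge0 (ler0n _ _) bc) dt0).
  exact: (mulr_ge0 (gain_ge0 s a0) nR).
have n00 : 0 <= n%:R :> R by exact: ler0n.
have a10 : 0 <= 1 + a by exact: addr_ge0.
have x00 : 0 <= n%:R * cw s * (1 + a) * (e + d * t) * (t1 - t0).
  exact: (mulr_ge0 (mulr_ge0 (mulr_ge0 (mulr_ge0 n00 cw0) a10) sg0) dt0).
have B20 : 0 <= B2 by apply: mulr_ge0 x00; apply: addr_ge0 => //; apply: mulr_ge0.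
have -> : (rate s a n * (t1 - t0) + gain s a / n%:R) * (e + d * t) = B1 + B2.
  by rewrite /rate /B1 /B2; ring.
(* Frequencies outside [A] are put with the low ones; the increments vanish there. *)
apply: (sqr_sum_split (p := fun k => A k && (n%:Z <= `|k|))) => //.
- rewrite -big_filter; set K' := (X in \sum_(i <- X) _).
  have uK' : uniq K' by rewrite filter_uniq.
  have := sqr_sum_dual (x := fun k => (wt s k)%:C%C * (z t1 k - z t0 k)) uK' B10.
  have -> : \sum_(k <- K') cn ((wt s k)%:C%C * (z t1 k - z t0 k)) ^+ 2 = \sum_(i <- K') f i ^+ 2.
    by apply: eq_bigr => k _; rewrite cnM cn_real ger0_norm ?wt_ge0.
  apply=> psi P P0 hp; under eq_bigr do rewrite mulrA.
  apply: le_trans (high_freq T0 a0 s0 hv hw h0 t00 t01 t1T hs n0 P0 hp uK' _ _) _.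
  + by move=> k; rewrite mem_filter => /andP[/andP[]].
  + by apply/allP => k; rewrite mem_filter => /andP[/andP[]].
  + by rewrite /B1 /gain; apply: ler_of_eq; ring.
- set x := n%:R * cw s * (1 + a) * (e + d * t) * (t1 - t0).
  apply: (@le_trans _ _ (\sum_(k <- bx n) x ^+ 2)).
    apply: (@le_trans _ _ (\sum_(k <- [seq k <- K | k \in bx n]) x ^+ 2)); last first.
      apply: ler_sum_subset => [k||k]; rewrite ?filter_uniq ?sqr_ge0 //.
      by rewrite mem_filter => /andP[].
    rewrite big_filter big_mkcond [leRHS]big_mkcond /=; apply: ler_sum => k _.
    rewrite /f; have := low_freq k; case: (boolP (A k)) => Ak /= h.
      rewrite mem_bx -ltNge; case: ifP => hn; last by case: ifP => //; rewrite sqr_ge0.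
      have -> : `|k| <= n%:Z by exact: ltW.
      rewrite ler_pXn2r ?nnegrE ?mulr_ge0 ?wt_ge0 ?cn_ge0 // (le_trans h) //.
      have kn : `|k|%:~R <= n%:R :> R by rewrite -[leRHS]/((n%:Z)%:~R) ler_int ltW.
      have := ler_wpM2r (mulr_ge0 (mulr_ge0 cw0 (mulr_ge0 a10 sg0)) dt0) kn.
      by apply: le_trans_eq2; rewrite /x; ring.
    have -> : wt s k * cn (z t1 k - z t0 k) = 0.
      by apply/eqP; rewrite eq_le h mulr_ge0 ?wt_ge0 ?cn_ge0.
    by rewrite expr0n; case: ifP => //; rewrite sqr_ge0.
  rewrite big_const_seq iter_addr_0 count_predT size_map size_iota -mulr_natr.
  rewrite [leRHS]exprMn [leLHS]mulrC; apply: ler_wpM2r; first exact: sqr_ge0.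
  have -> : (2 * n).+1%:R = 2 * n%:R + 1 :> R by rewrite -natr1 natrM.
  by rewrite expr2 ler_peMl ?addr_ge0 ?mulr_ge0 // lerDr mulr_ge0.
Qed.

End Two.

(* The gain [1/n] of the normal form on the frequencies [>= n], and the crude Lipschitz bound
   on the others. *)
Lemma master_estimate s a eta : 0 <= s -> 0 <= a -> 0 < eta -> exists2 tau : R, 0 < tau &
  forall (A : pred int) T (w v : R -> fseq R) t0 t1 t d e, 0 <= T ->
   gsol A T a v -> gsol A T a w -> [/\ 0 <= t, 0 <= d & 0 <= e] ->
   0 <= t0 -> t0 <= t1 -> t1 <= T -> t1 - t0 <= tau ->
   (forall u, t0 <= u <= t1 -> slotd s true (w u) (v u) a t d e) ->
   l2b (fun k => wt s k * cn ((w t1 k - v t1 k) - (w t0 k - v t0 k))) (eta * (e + d * t)).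
Proof.
move=> s0 a0 eta0.
have bc := bigC_ge0 s a0; have cw0 := cw_ge0 (R := R) s.
have g0 := gain_ge0 s a0.
(* This [n] brings the boundary terms below eta/2; [tau] then does the same for the integrated
   terms. Neither depends on [A], [T] or the H^s sizes. *)
pose n := (Num.Def.trunc (2 * gain s a / eta)).+1.
have hn : gain s a / n%:R <= eta / 2.
  have : 2 * gain s a / eta < n%:R by exact: truncnS_gt.
  rewrite ltr_pdivrMr // ler_pdivrMr // => h.
  by move: (gain s a) (n%:R : R) h => x y h; lra.
have r0 : 0 <= rate s a n := rate_ge0 s n a0.
exists (eta / 2 / (rate s a n + 1)); first by rewrite !divr_gt0 // ltr_wpDl.
move=> A T w v t0 t1 t d e T0 hv hw [t'0 d0 e0] t00 t01 t1T dt hs.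
have h := increment_le T0 s0 hv hw (And4 a0 t'0 d0 e0) t00 t01 t1T hs (ltn0Sn _ : (0 < n)%N).
have sg0 : 0 <= e + d * t by rewrite addr_ge0 ?mulr_ge0.
have dt0 : 0 <= t1 - t0 by rewrite subr_ge0.
apply: l2b_le h => [|k]; last by apply/andP; split; [rewrite mulr_ge0 ?wt_ge0 ?cn_ge0|].
have x0 : 0 <= rate s a n * (t1 - t0) + gain s a / n%:R.
  by apply: addr_ge0; [exact: mulr_ge0|apply: mulr_ge0 g0 _; rewrite invr_ge0].
apply/andP; split; first exact: mulr_ge0.
apply: ler_wpM2r => //; rewrite [eta]splitr; apply: lerD => //.
move: dt; rewrite ler_pdivlMr ?ltr_wpDl // => dt; apply: le_trans dt.
by rewrite mulrC ler_wpM2l // lerDl.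
Qed.

End Increments.

(** * Lipschitz dependence and a priori bounds *)

Section SobolevNorms.
Variable R : realType.
Notation C := (R[i]).
Implicit Types (f g v w : fseq R) (s : R).

Lemma hs_termE s f (k : int) : hs_term s f k = ((wt s k * cn (f k)) ^+ 2)%:E.
Proof.
rewrite /hs_term exprMn cn_sqr; congr (_ * _)%:E.
by rewrite /wt mulrC powRrM powR_mulrn // powR_ge0.
Qed.

Lemma hs_norm2_le s f Z : (hs_norm2 s f <= (Z ^+ 2)%:E)%E ->
  f 0 = 0 -> l2b (fun k => wt s k * cn (f k)) Z.
Proof.
move=> h f0 L uL; rewrite -lee_fin; apply: le_trans h.
pose L' := [seq k <- L | k != 0].
have -> : \sum_(k <- L) (wt s k * cn (f k)) ^+ 2 = \sum_(k <- L') (wt s k * cn (f k)) ^+ 2.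
  rewrite big_filter (bigID (fun k => k != 0)) /= addrC big1 ?add0r // => k.
  by rewrite negbK => /eqP ->; rewrite f0 cn0 mulr0 expr0n.
apply: esum_ge; exists [set` L'].
  split; first exact: finite_seq.
  by move=> k /=; rewrite mem_filter => /andP[].
rewrite -fsbig_seq ?filter_uniq // -sumEFin; apply: lee_sum => k _.
by rewrite hs_termE.
Qed.

Lemma hs_norm2_ge s f Z : l2b (fun k => wt s k * cn (f k)) Z ->
  (hs_norm2 s f <= (Z ^+ 2)%:E)%E.
Proof.
move=> h; apply: ge_ereal_sup => /= _ [X [finX _] <-].
rewrite fsbig_finite //= (eq_bigr (fun k => ((wt s k * cn (f k)) ^+ 2)%:E)).
  by rewrite sumEFin lee_fin; apply: h; exact: finmap.fset_uniq.
by move=> k _; rewrite hs_termE.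
Qed.

Lemma hs_norm2_ge0 s f : (0 <= hs_norm2 s f)%E.
Proof. by apply: esum_ge0 => k _; rewrite hs_termE lee_fin sqr_ge0. Qed.

Lemma hs_norm_ge0 s f : 0 <= hs_norm s f.
Proof. exact: sqrtr_ge0. Qed.

Lemma hs_norm_sqr s f : (hs_norm2 s f < +oo)%E -> ((hs_norm s f ^+ 2)%:E = hs_norm2 s f)%E.
Proof.
move=> h; rewrite /hs_norm sqr_sqrtr ?fine_ge0 ?hs_norm2_ge0 // fineK //.
by rewrite ge0_fin_numE // hs_norm2_ge0.
Qed.

Lemma l2b_hs_norm s f : f 0 = 0 -> (hs_norm2 s f < +oo)%E ->
  l2b (fun k => wt s k * cn (f k)) (hs_norm s f).
Proof. by move=> f0 h; apply: hs_norm2_le => //; rewrite hs_norm_sqr. Qed.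

Lemma hs_norm2_lty s f Z : l2b (fun k => wt s k * cn (f k)) Z -> (hs_norm2 s f < +oo)%E.
Proof. by move=> h; rewrite (le_lt_trans (hs_norm2_ge h)) // ltry. Qed.

Lemma hs_norm_le s f Z : 0 <= Z -> l2b (fun k => wt s k * cn (f k)) Z -> hs_norm s f <= Z.
Proof.
move=> Z0 h; rewrite -(@ler_pXn2r _ 2) ?nnegrE ?hs_norm_ge0 // -lee_fin.
by rewrite hs_norm_sqr ?(hs_norm2_lty h) //; exact: hs_norm2_ge.
Qed.

Lemma l2b_hs_norm_of s f Z : f 0 = 0 -> l2b (fun k => wt s k * cn (f k)) Z ->
  l2b (fun k => wt s k * cn (f k)) (hs_norm s f).
Proof. by move=> f0 h; apply: l2b_hs_norm => //; exact: hs_norm2_lty h. Qed.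

Lemma l2bD (x y z : int -> R) a b : 0 <= a -> 0 <= b -> l2b x a -> l2b y b ->
  (forall k, 0 <= z k <= x k + y k) -> l2b z (a + b).
Proof.
move=> a0 b0 hx hy hz L uL.
apply: (@le_trans _ _ (\sum_(k <- L) (x k + y k) ^+ 2)).
  apply: ler_sum => k _; have /andP[z0 zk] := hz k.
  by rewrite ler_pXn2r ?nnegrE // (le_trans z0).
have h := sum_mul_le a0 b0 hx hy (fun k => lexx _) uL.
have -> : \sum_(k <- L) (x k + y k) ^+ 2 = \sum_(k <- L) x k ^+ 2 + \sum_(k <- L) y k ^+ 2 +
    2 * \sum_(k <- L) x k * y k.
  by rewrite mulr_sumr -!big_split; apply: eq_bigr => k _ /=; ring.
have h1 := hx L uL; have h2 := hy L uL.
move: h h1 h2; move: (\sum_(k <- L) x k * y k) (\sum_(k <- L) x k ^+ 2) (\sum_(k <- L) y k ^+ 2).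
by move=> p q r; nra.
Qed.

Lemma l2b_wt0 s f a : 0 <= s -> f 0 = 0 -> 0 <= a ->
  l2b (fun k => wt s k * cn (f k)) a -> l2b (fun k => cn (f k)) a.
Proof.
move=> s0 f0 a0; apply: l2b_le => [|k]; first by rewrite a0 lexx.
rewrite cn_ge0 /=; have [->|k0] := eqVneq k 0; first by rewrite f0 cn0 mulr0.
by rewrite ler_peMl ?cn_ge0 // wt_ge1.
Qed.

(** On a window of length [tau] the supremum S of y satisfies S <= y t0 + S/2, so y at most doubles.
    Only boundedness of y enters, as continuity of the H^s norm in time is not known where this is
    applied. *)
Lemma doubling (T tau : R) (m : nat) (y : R -> R) : 0 < tau -> T <= m%:R * tau ->
  (exists Y, forall t, 0 <= t <= T -> y t <= Y) -> (forall t, 0 <= t <= T -> 0 <= y t) ->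
  (forall t0 t1 Z, 0 <= t0 -> t0 <= t1 -> t1 <= T -> t1 - t0 <= tau -> 0 <= Z ->
     (forall u, t0 <= u <= t1 -> y u <= Z) -> y t1 <= y t0 + Z / 2) ->
  forall t, 0 <= t <= T -> y t <= 2 ^+ m * y 0.
Proof.
move=> tau0 Tm [Y hY] y0 step.
have one t0 t1 : 0 <= t0 -> t0 <= t1 -> t1 <= T -> t1 - t0 <= tau -> y t1 <= 2 * y t0.
  move=> t00 t01 t1T dt.
  pose S := sup [set y u | u in [set u | t0 <= u <= t1]].
  have hS : has_sup [set y u | u in [set u | t0 <= u <= t1]].
    split; first by exists (y t0), t0 => //=; rewrite lexx t01.
    exists Y => _ [u /= /andP[u0 u1] <-]; apply: hY.
    by rewrite (le_trans t00) ?(le_trans u1).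
  have le_S u : t0 <= u <= t1 -> y u <= S.
    by move=> hu; apply: sup_upper_bound => //; exists u.
  have S0 : 0 <= S.
    by apply: le_trans (le_S t0 _); rewrite ?lexx ?t01 // y0 // t00 (le_trans t01).
  have : S <= y t0 + S / 2.
    apply: ge_sup; first by case: hS.
    move=> _ [u /= /andP[u0 u1] <-]; apply: step => //.
    - exact: le_trans t1T.
    - by rewrite (le_trans _ dt) // lerD2r.
    - by move=> x /andP[x0 x1]; apply: le_S; rewrite x0 (le_trans x1).
  have := le_S t1; rewrite lexx t01 => /(_ isT) h1 h2; lra.
have all_m j t : 0 <= t <= T -> t <= j%:R * tau -> y t <= 2 ^+ j * y 0.
  elim: j t => [|j IH] t /andP[t0 tT].
    rewrite mul0r => t0'; have -> : t = 0 by apply/eqP; rewrite eq_le t0 t0'.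
    by rewrite expr0 mul1r.
  move=> tj; have [tj'|tj'] := leP t (j%:R * tau).
    rewrite (le_trans (IH t _ tj')) ?t0 // exprS -mulrA ler_peMl ?ler1n //.
    by rewrite mulr_ge0 ?exprn_ge0 // y0 // lexx (le_trans t0).
  have j0 : 0 <= j%:R * tau by rewrite mulr_ge0 // ltW.
  have jT : j%:R * tau <= T by rewrite (le_trans (ltW tj')).
  rewrite (le_trans (one (j%:R * tau) t j0 (ltW tj') tT _)) //.
    by move: tj; rewrite -natr1 mulrDl mul1r addrC -lerBlDr.
  by rewrite exprS -mulrA ler_wpM2l // IH // j0.
move=> t /andP[t0 tT]; apply: all_m; first by rewrite t0.
exact: le_trans Tm.
Qed.

Lemma gsol0 (A : pred int) T a : A 0 = false -> gsol A T a (fun _ _ => 0 : C).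
Proof.
move=> A0; split => //; first by move=> t _; exact: l2b_cn0.
move=> k; have -> : (fun t : R => k%:~R * Fn A (fun=> 0 : C) k t) = (fun=> 0 : C).
  by apply/funext => t; rewrite /Fn kdv_nonlin0 mulr0; case: ifP; rewrite mulr0.
exact: cprim_cst.
Qed.

Definition bnd_s s T (v : R -> fseq R) B := forall t, 0 <= t <= T ->
  l2b (fun k => wt s k * cn (v t k)) B.

Lemma hs_norm_triangle s f g h a b : h 0 = 0 -> (forall k, cn (h k) <= cn (f k) + cn (g k)) ->
  0 <= a -> 0 <= b ->
  l2b (fun k => wt s k * cn (f k)) a -> l2b (fun k => wt s k * cn (g k)) b ->
  hs_norm s h <= a + b.
Proof.
move=> h0 hfg a0 b0 hf hg; apply: hs_norm_le; first exact: addr_ge0.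
apply: l2bD hf hg _ => // k; rewrite mulr_ge0 ?wt_ge0 ?cn_ge0 //=.
by rewrite -mulrDr ler_wpM2l ?wt_ge0.
Qed.

Lemma gsol_lipschitz s a B T : 0 <= s -> 0 <= a -> 0 <= B -> 0 <= T -> exists2 L : R, 0 <= L &
  forall (A : pred int) (w v : R -> fseq R), gsol A T a v -> gsol A T a w ->
    bnd_s s T v B -> bnd_s s T w B ->
    forall t, 0 <= t <= T -> hs_norm s (fsub (w t) (v t)) <= L * hs_norm s (fsub (w 0) (v 0)).
Proof.
move=> s0 a0 B0 T0.
(* With d = e = Z and t = B the master estimate yields eta (Z + Z B) = Z/2. *)
have eta0 : 0 < (2 * (1 + B))^-1 by rewrite invr_gt0 mulr_gt0 // ltr_pwDl.
have [tau tau0 ME] := master_estimate s0 a0 eta0.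
pose m := (Num.Def.trunc (T / tau)).+1.
have Tm : T <= m%:R * tau by rewrite -ler_pdivrMr // ltW // truncnS_gt.
exists (2 ^+ m); first exact: exprn_ge0.
move=> A w v hv hw bv bw.
have [_ v0 hva _] := hv; have [_ w0 hwa _] := hw.
have z0 u : 0 <= u <= T -> fsub (w u) (v u) 0 = 0.
  by move=> hu; rewrite /fsub v0 // w0 // subrr.
have zB u : 0 <= u <= T -> l2b (fun k => wt s k * cn (fsub (w u) (v u) k)) (B + B).
  move=> hu; apply: l2bD (bw u hu) (bv u hu) _ => // k.
  by rewrite mulr_ge0 ?wt_ge0 ?cn_ge0 //= -mulrDr ler_wpM2l ?wt_ge0 // cnB.
apply: (doubling (y := fun t => hs_norm s (fsub (w t) (v t))) tau0 Tm).
- exists (B + B) => t tT; apply: hs_norm_le; [exact: addr_ge0|exact: zB].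
- by move=> t _; exact: hs_norm_ge0.
move=> t0 t1 Z t00 t01 t1T dt Z0 hZ.
have inT u : t0 <= u <= t1 -> 0 <= u <= T.
  by move=> /andP[u0 u1]; rewrite (le_trans t00) ?(le_trans u1).
have zZ u : t0 <= u <= t1 -> l2b (fun k => wt s k * cn (fsub (w u) (v u) k)) Z.
  move=> hu; have := l2b_hs_norm_of (z0 u (inT u hu)) (zB u (inT u hu)).
  apply: l2b_le => [|k]; first by rewrite hs_norm_ge0 hZ.
  by rewrite mulr_ge0 ?wt_ge0 ?cn_ge0 /=.
have sl u : t0 <= u <= t1 -> slotd s true (w u) (v u) a B Z Z.
  move=> hu; have uT := inT u hu; split => //=.
  - by split; [exact: hwa|exact: bw].
  - by split; [exact: hva|exact: bv].
  - exact: (l2b_wt0 s0 (z0 u uT) Z0 (zZ u hu)).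
  - exact: zZ.
have := ME A T w v t0 t1 B Z Z T0 hv hw (And3 B0 Z0 Z0) t00 t01 t1T dt sl.
have -> : (2 * (1 + B))^-1 * (Z + Z * B) = Z / 2.
  by field; rewrite gt_eqF // ltr_pwDl.
move=> inc; have t0I : 0 <= t0 <= T by rewrite t00 (le_trans t01).
have t1I : 0 <= t1 <= T by rewrite t1T (le_trans t00).
apply: (hs_norm_triangle (f := fsub (w t0) (v t0))
   (g := fun k => (w t1 k - v t1 k) - (w t0 k - v t0 k))).
- exact: z0.
- by move=> k; rewrite /fsub -[X in cn X <= _](subrKC (w t0 k - v t0 k)) cnD.
- exact: hs_norm_ge0.
- by rewrite divr_ge0.
- exact: (l2b_hs_norm_of (z0 t0 t0I) (zB t0 t0I)).
- exact: inc.
Qed.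

Lemma gsol_single_slot s (A : pred int) T a (w : R -> fseq R) u Z : gsol A T a w ->
  0 <= u <= T -> 0 <= a -> 0 <= Z -> l2b (fun k => wt s k * cn (w u k)) Z ->
  slotd s true (w u) (fun=> 0) a Z a Z.
Proof. by move=> [_ _ ha _] uT a0 Z0 hZ; apply: slotd_0 => //; exact: ha. Qed.

(** Comparison with the zero solution: d = a is the H^0 bound and t = e = Z, so the increment is at
    most eta (1 + a) Z with a time step governed by [a]. The bound [B] only makes the suprema
    finite; [L] does not depend on it. *)
Lemma gsol_apriori s a T : 0 <= s -> 0 <= a -> 0 <= T -> exists2 L : R, 0 <= L &
  forall (A : pred int) (w : R -> fseq R), gsol A T a w ->
    (exists2 B, 0 <= B & bnd_s s T w B) ->
    forall t, 0 <= t <= T -> hs_norm s (w t) <= L * hs_norm s (w 0).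
Proof.
move=> s0 a0 T0.
have eta0 : 0 < (2 * (1 + a))^-1 by rewrite invr_gt0 mulr_gt0 // ltr_pwDl.
have [tau tau0 ME] := master_estimate s0 a0 eta0.
pose m := (Num.Def.trunc (T / tau)).+1.
have Tm : T <= m%:R * tau by rewrite -ler_pdivrMr // ltW // truncnS_gt.
exists (2 ^+ m); first exact: exprn_ge0.
move=> A w hw [B B0 bw]; have [A0 w0 hwa _] := hw.
apply: (doubling (y := fun t => hs_norm s (w t)) tau0 Tm).
- by exists B => t tT; apply: hs_norm_le => //; exact: bw.
- by move=> t _; exact: hs_norm_ge0.
move=> t0 t1 Z t00 t01 t1T dt Z0 hZ.
have inT u : t0 <= u <= t1 -> 0 <= u <= T.
  by move=> /andP[u0 u1]; rewrite (le_trans t00) ?(le_trans u1).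
have sl u : t0 <= u <= t1 -> slotd s true (w u) (fun=> 0) a Z a Z.
  move=> hu; apply: (gsol_single_slot hw) => //; first exact: inT.
  have := l2b_hs_norm_of (w0 u (inT u hu)) (bw u (inT u hu)).
  apply: l2b_le => [|k]; first by rewrite hs_norm_ge0 hZ.
  by rewrite mulr_ge0 ?wt_ge0 ?cn_ge0 /=.
have := ME A T w (fun _ _ => 0) t0 t1 Z a Z T0 (gsol0 T a A0) hw (And3 Z0 a0 Z0) t00 t01 t1T dt sl.
have -> : (2 * (1 + a))^-1 * (Z + a * Z) = Z / 2.
  by field; rewrite gt_eqF // ltr_pwDl.
move=> inc; have t0I : 0 <= t0 <= T by rewrite t00 (le_trans t01).
have t1I : 0 <= t1 <= T by rewrite t1T (le_trans t00).
apply: (hs_norm_triangle (f := w t0) (g := fun k => (w t1 k - 0) - (w t0 k - 0))).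
- exact: w0.
- by move=> k; rewrite !subr0 -[X in cn X <= _](subrKC (w t0 k)) cnD.
- exact: hs_norm_ge0.
- by rewrite divr_ge0.
- exact: (l2b_hs_norm_of (w0 t0 t0I) (bw t0 t0I)).
- exact: inc.
Qed.

(** Again a comparison with zero, now with d = a and t = e = B; [tau] is chosen before [A], which
    makes the modulus common to all truncations. *)
Lemma gsol_equicont s a B T : 0 <= s -> 0 <= a -> 0 <= B -> 0 <= T ->
  forall e, 0 < e -> exists2 tau : R, 0 < tau &
  forall (A : pred int) (w : R -> fseq R), gsol A T a w -> bnd_s s T w B ->
    forall t0 t1, 0 <= t0 <= T -> 0 <= t1 <= T -> `|t1 - t0| <= tau ->
     l2b (fun k => wt s k * cn (w t1 k - w t0 k)) e.
Proof.
move=> s0 a0 B0 T0 e e0.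
have c0 : 0 < B + a * B + 1 by rewrite ltr_wpDl // addr_ge0 // mulr_ge0.
have [tau tau0 ME] := master_estimate s0 a0 (divr_gt0 e0 c0).
exists tau => // A w hw bw t0 t1; have [A0 w0 hwa _] := hw.
wlog t01 : t0 t1 / t0 <= t1.
  move=> H; case: (leP t0 t1) => [/H//|/ltW t10 h0 h1]; rewrite distrC => h.
  have -> : (fun k => wt s k * cn (w t1 k - w t0 k)) = (fun k => wt s k * cn (w t0 k - w t1 k)).
    by apply/funext => k; rewrite cnBC.
  exact: H.
move=> /andP[t00 _] /andP[_ t1T]; rewrite ger0_norm ?subr_ge0 // => dt.
have inT u : t0 <= u <= t1 -> 0 <= u <= T.
  by move=> /andP[u0 u1]; rewrite (le_trans t00) ?(le_trans u1).
have sl u : t0 <= u <= t1 -> slotd s true (w u) (fun=> 0) a B a B.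
  by move=> hu; apply: (gsol_single_slot hw) => //; [exact: inT|apply: bw; exact: inT].
have := ME A T w (fun _ _ => 0) t0 t1 B a B T0 (gsol0 T a A0) hw (And3 B0 a0 B0) t00 t01 t1T dt sl.
apply: l2b_le => [|k]; last by rewrite !subr0 mulr_ge0 ?wt_ge0 ?cn_ge0 /=.
rewrite mulr_ge0 ?divr_ge0 ?(ltW e0) ?(ltW c0) ?addr_ge0 ?mulr_ge0 //=.
rewrite mulrAC ler_pdivrMr // ler_wpM2l ?(ltW e0) //; lra.
Qed.

End SobolevNorms.

(** * Galerkin approximations *)

Section UltraLimits.
Variable R : realType.
Notation C := (R[i]).
Variable U : set_system nat.
Hypothesis UU : UltraFilter U.

Lemma ultra_em (P : set nat) : U P \/ U (~` P).
Proof. exact: in_ultra_setVsetC. Qed.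

Definition ulim (z : nat -> C) (l : C) := forall e, 0 < e -> U [set n | cn (z n - l) <= e].

Lemma ulim_cst c : ulim (fun=> c) c.
Proof.
move=> e e0; apply: filterS (@filterT _ U _) => n _ /=.
by rewrite subrr cn0 ltW.
Qed.

Lemma ulimD z w l m : ulim z l -> ulim w m -> ulim (fun n => z n + w n) (l + m).
Proof.
move=> hz hw e e0; have e2 : 0 < e / 2 by rewrite divr_gt0.
apply: filterS2 (hz _ e2) (hw _ e2) => n /= h1 h2.
have -> : z n + w n - (l + m) = (z n - l) + (w n - m) by ring.
by rewrite (le_trans (cnD _ _)) // [e]splitr lerD.
Qed.

Lemma ulimM z w l m : ulim z l -> ulim w m -> ulim (fun n => z n * w n) (l * m).
Proof.
move=> hz hw e e0; have c0 : 0 < cn l + cn m + 1 by rewrite ltr_wpDl // addr_ge0 ?cn_ge0.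
have e1 : 0 < e / (cn l + cn m + 1) by rewrite divr_gt0.
have e2 : 0 < Num.min 1 (e / (cn l + cn m + 1)) by rewrite lt_min ltr01.
apply: filterS2 (hz _ e1) (hw _ e2) => n /= h1; rewrite le_min => /andP[h2 h3].
rewrite (le_trans (cn_prod2B _ _ _ _)) // [cn (z n - l) * _]mulrC.
have w1 : cn (w n) <= cn m + 1.
  by rewrite -(subrKC m (w n)) (le_trans (cnD _ _)) // lerD2l.
apply: (@le_trans _ _ ((cn m + 1) * (e / (cn l + cn m + 1)) + cn l * (e / (cn l + cn m + 1)))).
  by apply: lerD; apply: ler_pM; rewrite ?cn_ge0.
apply: ler_of_eq; field; by rewrite gt_eqF.
Qed.

Lemma ulim_sum (I : Type) (r : seq I) (z : I -> nat -> C) (l : I -> C) :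
  (forall i, ulim (z i) (l i)) -> ulim (fun n => \sum_(i <- r) z i n) (\sum_(i <- r) l i).
Proof.
move=> h; elim: r => [|i r IH].
  by rewrite big_nil (_ : (fun n => _) = fun=> 0); [exact: ulim_cst|apply/funext => n; rewrite big_nil].
rewrite big_cons (_ : (fun n => _) = fun n => z i n + \sum_(j <- r) z j n); first exact: ulimD.
by apply/funext => n; rewrite big_cons.
Qed.

Lemma ulim_conj z l : ulim z l -> ulim (fun n => conjc (z n)) (conjc l).
Proof.
move=> hz e /hz; apply: filterS => n /=; rewrite -[X in _ -> cn X <= _](rmorphB (@conjc R)).
by rewrite cn_conj.
Qed.

Lemma ulim_near z l B : ulim z l -> (forall e, 0 < e -> U [set n | cn (z n) <= B + e]) -> cn l <= B.
Proof.
move=> hz hB; apply/ler_addgt0Pr => e e0; have e2 : 0 < e / 2 by rewrite divr_gt0.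
have [n [/= h1 h2]] := filter_ex (filterI (hz _ e2) (hB _ e2)).
rewrite -(subrKC (z n) l) (le_trans (cnD _ _)) // (cnBC l).
apply: le_trans (lerD h2 h1) _; rewrite -addrA -splitr //.
Qed.

Lemma ulim_le z l B : ulim z l -> U [set n | cn (z n) <= B] -> cn l <= B.
Proof.
move=> hz hB; apply: ulim_near hz _ => e e0; apply: filterS hB => n /= h.
by rewrite (le_trans h) // lerDl ltW.
Qed.

Lemma ulim_uniq z l m : ulim z l -> ulim z m -> l = m.
Proof.
move=> hl hm; apply/eqP; rewrite -subr_eq0; apply/eqP; apply: cn_eq0; apply/eqP.
rewrite eq_le cn_ge0 andbT; apply/ler_addgt0Pr => e e0.
have e2 : 0 < e / 2 by rewrite divr_gt0.
have [n [/= h1 h2]] := filter_ex (filterI (hl _ e2) (hm _ e2)).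
rewrite (le_trans (cn_distD (z n) _ _)) // add0r [e]splitr (cnBC l) lerD //.
Qed.

(** The limit is the supremum of the c with c <= x n for [U]-almost all n; since an ultrafilter
    decides every set, exceeding it by e is excluded almost everywhere. *)
Lemma ulim_real (x : nat -> R) B : (forall n, `|x n| <= B) ->
  exists l : R, forall e, 0 < e -> U [set n | `|x n - l| <= e].
Proof.
move=> hB; pose S := [set c : R | U [set n | c <= x n]].
have hS : has_sup S.
  split.
    exists (- B); apply: filterS (@filterT _ U _) => n _ /=.
    by have := hB n; rewrite ler_norml => /andP[].
  exists B => c hc; have [n /= h] := filter_ex hc.
  by rewrite (le_trans h) // (le_trans (ler_norm _)).
exists (sup S) => e e0.
have [c Sc hc] := sup_adherent e0 hS.
have h2 : U [set n | x n < sup S + e].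
  case: (ultra_em [set n | x n < sup S + e]) => // h.
  have : S (sup S + e) by apply: filterS h => n /=; move/negP; rewrite -leNgt.
  by move=> /(sup_upper_bound hS); rewrite gerDl leNgt e0.
apply: filterS2 Sc h2 => n /= h3 h4; rewrite ler_norml; apply/andP; split; lra.
Qed.

Lemma ulim_ex (z : nat -> C) B : (forall n, cn (z n) <= B) -> exists l, ulim z l.
Proof.
move=> hB.
have [a ha] := ulim_real (fun n => le_trans (cn_Re (z n)) (hB n)).
have [b hb] := ulim_real (fun n => le_trans (cn_Im (z n)) (hB n)).
exists (Complex a b) => e e0; have e2 : 0 < e / 2 by rewrite divr_gt0.
apply: filterS2 (ha _ e2) (hb _ e2) => n /= h1 h2.
by rewrite (le_trans (cn_le_ReIm _)) // ReD ImD ReN ImN /= [e]splitr lerD.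
Qed.

End UltraLimits.

(** * The energy identity for the truncated system *)

Section Energy.
Variable R : realType.
Notation C := (R[i]).
Variable N : nat.
Implicit Types (x y : fseq R).

Definition lowf : pred int := fun k => (k != 0) && (`|k| <= N%:Z).

Definition supp x := forall k, ~~ lowf k -> x k = 0.

(** A polynomial vector field in finitely many coordinates; on supported sequences it agrees with
    the equation, see [fldE]. *)
Definition fld x k (tau : R) : C :=
  if lowf k then k%:~R * (Complex 0 2^-1 * \sum_(k1 <- bx N) nt x k tau k1) else 0.

Lemma supp_bx x k : supp x -> k \notin bx N -> x k = 0.
Proof. by move=> sx; rewrite mem_bx => h; apply: sx; rewrite /lowf (negPf h) andbF. Qed.

Lemma big_bx_reflect (c : int) (f : int -> C) :
  (forall k, k \notin bx N -> f k = 0) -> (forall k, c - k \notin bx N -> f k = 0) ->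
  \sum_(k <- bx N) f (c - k) = \sum_(k <- bx N) f k.
Proof.
move=> f0 f1.
have E (g : int -> C) : (forall k, c - k \notin bx N -> g k = 0) ->
    \sum_(k <- bx N) g k = \sum_(k <- Sb c N) g k.
  move=> g0; rewrite /Sb big_filter (bigID (fun k : int => `|c - k| <= N%:Z)) /= [X in _ + X]big1 ?addr0 //.
  by move=> k; rewrite -mem_bx => /g0.
rewrite (E f) // E; first exact: Sb_reflect.
by move=> k; exact: f0.
Qed.

(** With k2 = - k1 - k3 the phase is -3 k1 k2 k3, so [G] is symmetric in the three frequencies. The
    sums weighted by k1, k2 and k3 are therefore equal, and they add up to zero. *)
Lemma fld_energy x tau : supp x -> (forall k, x (- k) = conjc (x k)) ->
  \sum_(k <- bx N) conjc (x k) * fld x k tau = 0.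
Proof.
move=> sx cx.
pose G (k1 k3 : int) := EE (3 * k1 * k3 * (k1 + k3)) tau * x k1 * x k3 * x (- k1 - k3).
pose S := \sum_(k3 <- bx N) \sum_(k1 <- bx N) k3%:~R * G k1 k3.
have Gsym k1 k3 : G k1 k3 = G k3 k1.
  rewrite /G; have -> : 3 * k3 * k1 * (k3 + k1) = 3 * k1 * k3 * (k1 + k3) by ring.
  have -> : - k3 - k1 = - k1 - k3 by ring.
  ring.
have Grefl k1 k3 : G (- k3 - k1) k3 = G k1 k3.
  rewrite /G; have -> : 3 * (- k3 - k1) * k3 * (- k3 - k1 + k3) = 3 * k1 * k3 * (k1 + k3) by ring.
  have -> : - (- k3 - k1) - k3 = k1 by ring.
  have -> : - k1 - k3 = - k3 - k1 by ring.
  ring.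
have S1 : S = \sum_(k3 <- bx N) \sum_(k1 <- bx N) k1%:~R * G k1 k3.
  rewrite /S exchange_big /=; apply: eq_bigr => k1 _; apply: eq_bigr => k3 _.
  by rewrite Gsym.
have S2 : S = - S - S.
  rewrite {1}S1 {1}S1 /S -!sumrN -big_split; apply: eq_bigr => k3 _ /=.
  rewrite -!sumrN -big_split /=.
  rewrite -(big_bx_reflect (c := - k3)); first last.
  - by move=> k h; rewrite /G (_ : - k - k3 = - k3 - k) ?(supp_bx sx h) ?mulr0 //; ring.
  - by move=> k h; rewrite /G (supp_bx sx h) !(mulr0, mul0r).
  by apply: eq_bigr => k1 _; rewrite Grefl intrD !intrN; ring.
have S0 : S = 0.
  have : 3 * S = 0.
    have -> : 3 * S = S + (S + S) by ring.
    by rewrite {1}S2; ring.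
  by move/eqP; rewrite mulf_eq0 pnatr_eq0 /= => /eqP.
have -> : \sum_(k <- bx N) conjc (x k) * fld x k tau =
   - (Complex 0 2^-1 * S).
  transitivity (\sum_(k <- bx N) (conjc (x (- k)) * fld x (- k) tau)).
    rewrite -(big_bx_reflect (c := 0)) => [|k h|k h].
    - by apply: eq_bigr => k _; rewrite sub0r.
    - by rewrite (supp_bx sx h) conjc0 mul0r.
    - by rewrite -cx -[- k]sub0r (supp_bx sx h) mul0r.
  rewrite /S mulr_sumr -sumrN; apply: eq_bigr => k _; rewrite cx conjcK.
  rewrite mulr_sumr -sumrN /fld; case: ifP => [_|/negbT h]; last first.
    have -> : x k = 0 by rewrite -[x k]conjcK -cx (sx _ h) conjc0.
    rewrite mul0r big1 // => k1 _; rewrite /G; have -> : x k = 0.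
      by rewrite -[x k]conjcK -cx (sx _ h) conjc0.
    by rewrite !(mulr0, mul0r, oppr0).
  rewrite !mulr_sumr; apply: eq_bigr => k1 _; rewrite /nt /G -/(EE _ _) intrN.
  have -> : 3 * - k * k1 * (- k - k1) = 3 * k1 * k * (k1 + k) by ring.
  have -> : - k1 - k = - k - k1 by ring.
  ring.
by rewrite S0 mulr0 oppr0.
Qed.

Lemma fld_conj x k tau : supp x -> (forall k, x (- k) = conjc (x k)) ->
  fld x (- k) tau = conjc (fld x k tau).
Proof.
move=> sx cx; rewrite /fld /lowf oppr_eq0 normrN; case: ifP => _; last by rewrite conjc0.
rewrite (_ : \sum_(k1 <- bx N) nt x (- k) tau k1 = \sum_(k1 <- bx N) nt x (- k) tau (0 - k1)); last first.
  rewrite (big_bx_reflect (c := 0)) // => k1 h; first by rewrite /nt (supp_bx sx h) mulr0 mul0r.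
  have -> : nt x (- k) tau k1 = 0; last by [].
  by rewrite /nt -[x k1]conjcK -cx -[- k1]sub0r (supp_bx sx h) conjc0 mulr0 mul0r.
rewrite [RHS]rmorphM rmorphM rmorph_sum /= rmorph_int intrN.
rewrite (_ : \sum_(k1 <- bx N) nt x (- k) tau (0 - k1) = \sum_(i <- bx N) conjc (nt x k tau i)).
  by rewrite mulNr -mulrN -mulNr; congr (_ * (_ * _)); apply/eqP; rewrite eq_complex /= oppr0 !eqxx.
apply: eq_bigr => k1 _; rewrite /nt !rmorphM /= sub0r.
have -> : - k - - k1 = - (k - k1) by ring.
rewrite !cx; congr (_ * _ * _); rewrite /cexpi /=.
have -> : 3%:~R * (- k)%:~R * (- k1)%:~R * (- (k - k1))%:~R * tau =
  - (3%:~R * k%:~R * k1%:~R * (k - k1)%:~R * tau) :> R by rewrite !intrN; ring.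
by rewrite cosN sinN.
Qed.

End Energy.

(** * Primitives recognised from forward increments *)

Section OneSided.
Variable R : realType.
Notation C := (R[i]).

(* Only forward increments starting at [s] are needed: these pass to the limit from Euler and
   Galerkin approximations. *)
Lemma rprim_onesided (T K : R) (f g : R -> R) : 0 <= T -> bnd_on 0 T g -> 0 <= K ->
  (forall s t, 0 <= s <= T -> 0 <= t <= T -> `|f t - f s| <= K * `|t - s|) ->
  (forall e, 0 < e -> exists2 d, 0 < d & forall s t, 0 <= s <= T -> 0 <= t <= T ->
     `|t - s| < d -> `|g t - g s| <= e) ->
  (forall e, 0 < e -> exists2 d, 0 < d & forall s t, 0 <= s -> s <= t -> t <= T ->
     t - s < d -> `|f t - f s - (t - s) * g s| <= e * (t - s)) ->
  rprim T f g.
Proof.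
move=> T0 bg K0 lf gu hf.
have mg := unif_cont_measurable T0 gu.
have mf : measurable_fun `[0, T] f.
  apply: unif_cont_measurable => // e e0.
  exists (e / (K + 1)); first by rewrite divr_gt0 // ltr_wpDl.
  move=> s t hs ht; rewrite ltr_pdivlMr ?ltr_wpDl // => h.
  apply: le_trans (lf s t hs ht) (le_trans _ (ltW h)).
  by rewrite mulrC ler_wpM2l // lerDl.
apply: rprim_ofP => // e e0.
have [d1 d10 hd1] := hf _ (divr_gt0 e0 (ltr0n _ 2)).
have [d2 d20 hd2] := gu _ (divr_gt0 e0 (ltr0n _ 2)).
exists (Num.min d1 d2); first by rewrite lt_min d10.
move=> s t s0 st tT; rewrite lt_min => /andP[h1 h2].
have sI : 0 <= s <= T by rewrite s0 (le_trans st).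
have ms : measurable_fun `[s, t] g by exact: measurable_sub mg.
have bs : bnd_on s t g by exact: bnd_sub bg.
have -> : f t - f s - Rintegral (@lebesgue_measure R) `[s, t] g =
   (f t - f s - (t - s) * g s) + Rintegral (@lebesgue_measure R) `[s, t] (fun u => g s - g u).
  rewrite RintegralB // ?Rint_cst //; last 2 first.
  - by apply: (@bnd_integrable _ _ _ (fun=> g s)) => //; exists `|g s|.
  - exact: bnd_integrable.
  by rewrite addrA [g s * _]mulrC subrK.
rewrite (le_trans (ler_normD _ _)) //.
have -> : e * (t - s) = e / 2 * (t - s) + e / 2 * (t - s) by field.
apply: lerD; first exact: hd1.
apply: Rint_abs_le => //; first exact: measurable_funB.
move=> u /andP[su ut]; rewrite distrC; apply: hd2 => //.
  by rewrite (le_trans s0) ?(le_trans ut).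
by rewrite ger0_norm ?subr_ge0 // (le_lt_trans _ h2) // lerB.
Qed.

Lemma cprim_onesided (T K B : R) (f g : R -> C) : 0 <= T -> 0 <= K ->
  (forall t, 0 <= t <= T -> cn (g t) <= B) ->
  (forall s t, 0 <= s <= T -> 0 <= t <= T -> cn (f t - f s) <= K * `|t - s|) ->
  (forall e, 0 < e -> exists2 d, 0 < d & forall s t, 0 <= s <= T -> 0 <= t <= T ->
     `|t - s| < d -> cn (g t - g s) <= e) ->
  (forall e, 0 < e -> exists2 d, 0 < d & forall s t, 0 <= s -> s <= t -> t <= T ->
     t - s < d -> cn (f t - f s - ((t - s)%:C)%C * g s) <= e * (t - s)) ->
  cprim T f g.
Proof.
move=> T0 K0 bg lf gu hf; split.
- apply: (rprim_onesided T0 _ K0).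
  + by exists B => t tT; exact: le_trans (cn_Re _) (bg t tT).
  + by move=> s t hs ht; rewrite -ReN -ReD; exact: le_trans (cn_Re _) (lf s t hs ht).
  + move=> e /gu[d d0 hd]; exists d => // s t hs ht h; rewrite -ReN -ReD.
    exact: le_trans (cn_Re _) (hd s t hs ht h).
  + move=> e /hf[d d0 hd]; exists d => // s t s0 st tT h.
    apply: le_trans (le_trans (cn_Re _) (hd s t s0 st tT h)).
    by rewrite !(ReD, ReN, ReM) /= mul0r subr0.
- apply: (rprim_onesided T0 _ K0).
  + by exists B => t tT; exact: le_trans (cn_Im _) (bg t tT).
  + by move=> s t hs ht; rewrite -ImN -ImD; exact: le_trans (cn_Im _) (lf s t hs ht).
  + move=> e /gu[d d0 hd]; exists d => // s t hs ht h; rewrite -ImN -ImD.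
    exact: le_trans (cn_Im _) (hd s t hs ht h).
  + move=> e /hf[d d0 hd]; exists d => // s t s0 st tT h.
    apply: le_trans (le_trans (cn_Im _) (hd s t s0 st tT h)).
    by rewrite !(ImD, ImN, ImM) /= mul0r addr0.
Qed.

Lemma cexpi_lip (T c s t : R) : 0 <= s <= T -> 0 <= t <= T ->
  cn (cexpi (c * t) - cexpi (c * s)) <= `|c| * `|t - s|.
Proof.
wlog st : s t / s <= t.
  move=> H; case: (leP s t) => [/H//|/ltW ts hs ht]; rewrite cnBC [`|t - s|]distrC; exact: H.
move=> /andP[s0 _] /andP[t0 tT]; rewrite [`|t - s|]ger0_norm ?subr_ge0 //.
apply: (cprim_cn_le (cprim_exp c (le_trans t0 tT)) s0 st tT) => u _.
by rewrite cnM cn_imag cn_cexpi mulr1.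
Qed.

End OneSided.

(** * The Euler scheme for the truncated system *)

Section Euler.
Variable R : realType.
Notation C := (R[i]).
Variables (N : nat) (T : R) (x0 : fseq R).
Hypotheses (T0 : 0 < T) (sx0 : supp N x0) (cx0 : forall k, x0 (- k) = conjc (x0 k)).

Definition nrg (x : fseq R) : R := \sum_(k <- bx N) cn (x k) ^+ 2.

Lemma nrg_ge0 x : 0 <= nrg x.
Proof. by apply: sumr_ge0 => k _; rewrite sqr_ge0. Qed.

(** The added 1 is the room left for the growth of the energy along the Euler steps. *)
Definition rho : R := Num.sqrt (nrg x0 + 1).

Lemma rho_sqr : rho ^+ 2 = nrg x0 + 1.
Proof. by rewrite sqr_sqrtr // addr_ge0 // nrg_ge0. Qed.

Lemma rho0 : 0 <= rho. Proof. exact: sqrtr_ge0. Qed.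

Definition inball (x : fseq R) :=
  [/\ supp N x, forall k, x (- k) = conjc (x k) & forall k, cn (x k) <= rho].

Lemma nrg_inball x : supp N x -> (forall k, x (- k) = conjc (x k)) ->
  nrg x <= nrg x0 + 1 -> inball x.
Proof.
move=> sx cx hx; split => // k; have [kb|/(supp_bx sx) ->] := boolP (k \in bx N); last first.
  by rewrite cn0 rho0.
rewrite -(@ler_pXn2r _ 2) ?nnegrE ?cn_ge0 ?rho0 // rho_sqr; apply: le_trans hx.
have := ler_sum_subset (f := fun k => cn (x k) ^+ 2) (L := [:: k]) (L' := bx N).
rewrite big_seq1; apply => //; first by move=> j; rewrite sqr_ge0.
by move=> j; rewrite inE => /eqP ->.
Qed.

Definition fK : R := N%:R * ((2 * N).+1%:R * rho ^+ 2).
(** [6 * N%:R ^+ 3] bounds the phase 3 k k1 (k - k1), as |k - k1| <= 2N where it matters; [2 * rho]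
    is the Lipschitz constant of the product of two coordinates. *)
Definition fL : R := N%:R * ((2 * N).+1%:R * (6 * N%:R ^+ 3 * rho ^+ 2 + 2 * rho)).

Lemma fK0 : 0 <= fK.
Proof. by apply: mulr_ge0 => //; apply: mulr_ge0 => //; exact: sqr_ge0. Qed.

Lemma fL0 : 0 <= fL.
Proof.
have r0 := rho0; apply: mulr_ge0 => //; apply: mulr_ge0 => //; apply: addr_ge0; last exact: mulr_ge0.
by apply: mulr_ge0 (sqr_ge0 _); apply: mulr_ge0 => //; exact: exprn_ge0.
Qed.

Lemma sum_bx_le (f : int -> C) B : {in bx N, forall k, cn (f k) <= B} ->
  cn (\sum_(k <- bx N) f k) <= (2 * N).+1%:R * B.
Proof.
move=> h; rewrite (le_trans (cn_sum _ _ _)) //.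
apply: (@le_trans _ _ (\sum_(k <- bx N) B)); first by rewrite big_seq [leRHS]big_seq; apply: ler_sum.
by rewrite big_const_seq iter_addr_0 count_predT size_map size_iota mulr_natl.
Qed.

Lemma lowf_le k : lowf N k -> `|k|%:~R <= N%:R :> R.
Proof. by move=> /andP[_ h]; rewrite -[leRHS]/((N%:Z)%:~R) ler_int. Qed.

Lemma fld_bnd x k tau : inball x -> cn (fld N x k tau) <= fK.
Proof.
move=> [_ _ bx_]; rewrite /fld; case: ifP => [kl|_]; last by rewrite cn0 fK0.
rewrite cnM cn_int cnM cn_half; apply: ler_pM; rewrite ?mulr_ge0 ?cn_ge0 ?ler0z ?lowf_le //.
have h : cn (\sum_(k1 <- bx N) nt x k tau k1) <= (2 * N).+1%:R * rho ^+ 2.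
  by apply: sum_bx_le => k1 _; rewrite cn_nt expr2; apply: ler_pM; rewrite ?cn_ge0.
by rewrite -[leRHS]mul1r; apply: ler_pM; rewrite ?cn_ge0 // invf_le1 // ler1n.
Qed.

Lemma fld_lip x y k tau sg D : inball x -> inball y -> 0 <= tau <= T -> 0 <= sg <= T ->
  (forall j, cn (x j - y j) <= D) ->
  cn (fld N x k tau - fld N y k sg) <= fL * (D + `|tau - sg|).
Proof.
move=> [_ _ bx_] [_ _ by_] ht hs hD.
have D0 : 0 <= D := le_trans (cn_ge0 _) (hD 0).
rewrite /fld; case: ifP => [kl|_]; last by rewrite subrr cn0 mulr_ge0 ?fL0 ?addr_ge0.
rewrite -!mulrBr cnM cn_int cnM cn_half -sumrB.
have h : cn (\sum_(k1 <- bx N) (nt x k tau k1 - nt y k sg k1)) <=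
   (2 * N).+1%:R * ((6 * N%:R ^+ 3 * rho ^+ 2 + 2 * rho) * (D + `|tau - sg|)).
  apply: sum_bx_le => k1 k1b.
  set c := (3 * k * k1 * (k - k1))%:~R : R.
  have c_le : `|c| <= 6 * N%:R ^+ 3.
    rewrite /c -intr_norm.
    have -> : 6 * N%:R ^+ 3 = (6 * (N%:Z * N%:Z * N%:Z))%:~R :> R.
      by rewrite !intrM -[(N%:Z)%:~R]/(N%:R); ring.
    rewrite ler_int !normrM; move/andP: kl => [_ hk]; rewrite mem_bx in k1b.
    have h1 : `|k - k1| <= 2 * N%:Z by lia.
    have : `|k| * `|k1| * `|k - k1| <= N%:Z * N%:Z * (2 * N%:Z).
      by apply: ler_pM; rewrite ?mulr_ge0 //; apply: ler_pM.
    have -> : `|3 : int| = 3 by [].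
    rewrite -!mulrA; move: (`|k| * (`|k1| * `|k - k1|)) => p hp; lia.
  have -> : nt x k tau k1 - nt y k sg k1 =
     (cexpi (c * tau) - cexpi (c * sg)) * (x k1 * x (k - k1)) +
     cexpi (c * sg) * (x k1 * x (k - k1) - y k1 * y (k - k1)) by rewrite /nt -/c; ring.
  have h1 := cexpi_lip c hs ht.
  have h2 : cn (x k1 * x (k - k1)) <= rho ^+ 2 by rewrite cnM expr2; apply: ler_pM; rewrite ?cn_ge0.
  have h3 : cn (x k1 * x (k - k1) - y k1 * y (k - k1)) <= D * rho + rho * D.
    rewrite (le_trans (cn_prod2B _ _ _ _)) //.
    by apply: lerD; apply: ler_pM; rewrite ?cn_ge0.
  rewrite (le_trans (cnD _ _)) // [X in X + _]cnM [X in _ + X]cnM cn_cexpi mul1r.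
  apply: (@le_trans _ _ (6 * N%:R ^+ 3 * `|tau - sg| * rho ^+ 2 + (D * rho + rho * D))).
    apply: lerD => //; apply: ler_pM; rewrite ?cn_ge0 // (le_trans h1) //.
    by rewrite ler_wpM2r.
  have r0 := rho0; have a0 : 0 <= 6 * N%:R ^+ 3 * rho ^+ 2 :> R.
    by apply: mulr_ge0 (sqr_ge0 _); apply: mulr_ge0 => //; exact: exprn_ge0.
  have := mulr_ge0 a0 D0; have := mulr_ge0 r0 (normr_ge0 (tau - sg)).
  move: (6 * N%:R ^+ 3) (`|tau - sg|) => p q; lra.
have -> : fL * (D + `|tau - sg|) = N%:R * ((2 * N).+1%:R *
    ((6 * N%:R ^+ 3 * rho ^+ 2 + 2 * rho) * (D + `|tau - sg|))) by rewrite /fL; ring.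
apply: ler_pM; rewrite ?mulr_ge0 ?cn_ge0 ?ler0z ?lowf_le //.
rewrite -[leRHS]mul1r; apply: ler_pM; rewrite ?cn_ge0 ?invf_le1 ?ler1n //.
Qed.

Fixpoint eul (h : R) (j : nat) : fseq R :=
  if j is j'.+1 then fun k => eul h j' k + (h%:C)%C * fld N (eul h j') k (j'%:R * h) else x0.

Definition fB : R := (2 * N).+1%:R * fK ^+ 2.

Lemma fB0 : 0 <= fB. Proof. by rewrite mulr_ge0 // sqr_ge0. Qed.

Lemma conjcD (z w : C) : conjc (z + w) = conjc z + conjc w.
Proof. exact: rmorphD. Qed.

Lemma conjcM (z w : C) : conjc (z * w) = conjc z * conjc w.
Proof. exact: rmorphM. Qed.

Lemma cn_sqrD (z w : C) : cn (z + w) ^+ 2 = cn z ^+ 2 + 2 * complex.Re (conjc z * w) + cn w ^+ 2.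
Proof. by rewrite !cn_sqr /cabs2; case: z w => p q [r u] /=; ring. Qed.

(** The cross term vanishes by [fld_energy], so one step changes the energy to second order in h
    only, and upwards. *)
Lemma nrg_step (x : fseq R) h tau : inball x -> 0 <= h ->
  nrg x <= nrg (fun k => x k + (h%:C)%C * fld N x k tau) <= nrg x + h ^+ 2 * fB.
Proof.
move=> hb h0; have [sx cx _] := hb.
have -> : nrg (fun k => x k + (h%:C)%C * fld N x k tau) =
   nrg x + h ^+ 2 * \sum_(k <- bx N) cn (fld N x k tau) ^+ 2.
  rewrite /nrg; under eq_bigr do rewrite cn_sqrD.
  rewrite !big_split /= -mulr_sumr; congr (_ + _).
    rewrite -Re_sum (_ : \sum_(k <- bx N) _ = (h%:C)%C * \sum_(k <- bx N) conjc (x k) * fld N x k tau).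
      by rewrite fld_energy // mulr0 /= mulr0 addr0.
    by rewrite mulr_sumr; apply: eq_bigr => k _; ring.
  by rewrite mulr_sumr; apply: eq_bigr => k _; rewrite cnM cn_real exprMn real_normK ?num_real.
have s0 : 0 <= \sum_(k <- bx N) cn (fld N x k tau) ^+ 2 by apply: sumr_ge0 => k _; rewrite sqr_ge0.
rewrite lerDl mulr_ge0 ?sqr_ge0 //= lerD2l ler_wpM2l ?sqr_ge0 //.
apply: (@le_trans _ _ (\sum_(k <- bx N) fK ^+ 2)).
  by apply: ler_sum => k _; rewrite ler_pXn2r ?nnegrE ?cn_ge0 ?fK0 // fld_bnd.
by rewrite big_const_seq iter_addr_0 count_predT size_map size_iota /fB mulr_natl.
Qed.

(** After j steps the energy has grown by at most j h^2 fB <= T h fB <= 1, so the iterates never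
    leave the ball on which [fB] was computed. *)
Lemma eul_inv h j : 0 <= h -> j%:R * h <= T -> T * h * fB <= 1 ->
  inball (eul h j) /\ nrg x0 <= nrg (eul h j) <= nrg x0 + j%:R * h ^+ 2 * fB.
Proof.
move=> h0; elim: j => [|j IH] jT hT /=.
  rewrite !mul0r addr0 lexx; split => //; apply: nrg_inball => //; by rewrite lerDl.
have jT' : j%:R * h <= T by rewrite (le_trans _ jT) // ler_wpM2r // ler_nat.
have [hb /andP[e1 e2]] := IH jT' hT.
have [sx cx _] := hb.
have /andP[s1 s2] := nrg_step (j%:R * h) hb h0.
have e3 : nrg (fun k => eul h j k + (h%:C)%C * fld N (eul h j) k (j%:R * h)) <=
    nrg x0 + j.+1%:R * h ^+ 2 * fB.
  rewrite (le_trans s2) // -natr1 mulrDl mul1r mulrDl addrA lerD2r //.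
split; last by rewrite e3 andbT (le_trans e1).
apply: nrg_inball.
- move=> k hk; rewrite (sx k hk) /fld (negPf hk) mulr0 addr0 //.
- by move=> k; rewrite cx fld_conj // conjcD conjcM conjc_real.
rewrite (le_trans e3) // lerD2l (le_trans _ hT) //.
by rewrite ler_wpM2r ?fB0 // expr2 mulrA ler_wpM2r.
Qed.

Lemma eul_incr h i m k : 0 <= h -> (i + m)%:R * h <= T -> T * h * fB <= 1 ->
  cn (eul h (i + m) k - eul h i k) <= m%:R * h * fK.
Proof.
move=> h0; elim: m => [|m IH] imT hT; first by rewrite addn0 subrr cn0 !mul0r.
have imT' : (i + m)%:R * h <= T by rewrite (le_trans _ imT) // ler_wpM2r // ler_nat addnS.
rewrite addnS /= addrAC (le_trans (cnD _ _)) // -natr1 !mulrDl mul1r lerD ?IH //.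
rewrite cnM cn_real ger0_norm // ler_wpM2l // fld_bnd //.
by have [] := eul_inv h0 imT' hT.
Qed.

(** Since step i the field has changed by at most fL (fK + 1) m h: the state has moved by fK m h and
    the time by m h. *)
Lemma eul_incr2 h i m k : 0 <= h -> (i + m)%:R * h <= T -> T * h * fB <= 1 ->
  cn (eul h (i + m) k - eul h i k - ((m%:R * h)%:C)%C * fld N (eul h i) k (i%:R * h)) <=
    fL * (fK + 1) * (m%:R * h) ^+ 2.
Proof.
move=> h0; elim: m => [|m IH] imT hT.
  by rewrite addn0 subrr mul0r rmorph0 mul0r subr0 cn0 expr0n mulr0.
have imT' : (i + m)%:R * h <= T by rewrite (le_trans _ imT) // ler_wpM2r // ler_nat addnS.
have iT : i%:R * h <= T by rewrite (le_trans _ imT') // ler_wpM2r // ler_nat leq_addr.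
have [hb _] := eul_inv h0 imT' hT; have [hi _] := eul_inv h0 iT hT.
have q0 n : 0 <= n%:R * h by rewrite mulr_ge0.
have tb n : n%:R * h <= T -> 0 <= n%:R * h <= T by move=> ->; rewrite q0.
have fd D := @fld_lip _ _ k _ _ D hb hi (tb _ imT') (tb _ iT).
rewrite addnS /=.
set f1 := fld N (eul h (i + m)) k _; set f0 := fld N (eul h i) k _.
have -> : eul h (i + m) k + (h%:C)%C * f1 - eul h i k - ((m.+1%:R * h)%:C)%C * f0 =
   (eul h (i + m) k - eul h i k - ((m%:R * h)%:C)%C * f0) + (h%:C)%C * (f1 - f0).
  by rewrite -natr1 mulrDl mul1r rmorphD; ring.
rewrite (le_trans (cnD _ _)) //.
apply: (@le_trans _ _ (fL * (fK + 1) * (m%:R * h) ^+ 2 + h * (fL * (m%:R * h * fK + m%:R * h)))).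
  apply: lerD; first exact: IH.
  rewrite cnM cn_real ger0_norm // ler_wpM2l // (le_trans (fd _ (fun l => eul_incr l h0 imT' hT))) //.
  by rewrite -mulrBl -natrB ?leq_addr // addKn ger0_norm.
have c0 : 0 <= fL * (fK + 1) by rewrite mulr_ge0 ?fL0 // addr_ge0 // fK0.
have -> : m.+1%:R * h = m%:R * h + h by rewrite -natr1 mulrDl mul1r.
have := mulr_ge0 c0 (mulr_ge0 h0 h0); have := mulr_ge0 c0 (mulr_ge0 (q0 m) h0).
move: (fL) (fK) (m%:R * h) => p q x; nra.
Qed.

End Euler.

(** * Convergence of the Euler scheme *)

Section Galerkin.
Variable R : realType.
Notation C := (R[i]).

(** Along such an ultrafilter every bounded sequence converges, so all frequencies and all times are
    treated at once, without extracting subsequences. *)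
Lemma ultra_above_eventually : exists U : set_system nat, UltraFilter U /\
  forall P : set nat, (exists n0, forall n, (n0 <= n)%N -> P n) -> U P.
Proof.
have [U [UU hU]] := @ultraFilterLemma nat (@eventually) _; exists U; split => // P [n0 hP].
by apply: hU; exists n0.
Qed.

Variable U : set_system nat.
Hypotheses (UU : UltraFilter U)
  (Uinf : forall P : set nat, (exists n0, forall n, (n0 <= n)%N -> P n) -> U P).
Variables (N : nat) (T : R) (x0 : fseq R).
Hypotheses (T0 : 0 < T) (sx0 : supp N x0) (cx0 : forall k, x0 (- k) = conjc (x0 k)).

Let B := fB N x0.
(** The offset that makes the step size satisfy the condition T h fB <= 1 of [eul_inv] for every
    n. *)
Let n0 := (Num.Def.trunc (T * T * B)).+1.
Definition hh (n : nat) : R := T / (n + n0)%:R.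
Definition idx (n : nat) (t : R) : nat := Num.Def.trunc (t / hh n).
(** A step function in time rather than an interpolation; its jumps are of order [hh n] and
    disappear in the limit. *)
Definition xs (n : nat) (t : R) : fseq R := eul N x0 (hh n) (idx n t).

Let n0pos n : 0 < (n + n0)%:R :> R.
Proof. by rewrite ltr0n addn_gt0 orbT. Qed.

Lemma hh_gt0 n : 0 < hh n.
Proof. by rewrite divr_gt0. Qed.

Let n0le n : n0%:R <= (n + n0)%:R :> R.
Proof. by rewrite ler_nat leq_addl. Qed.

Lemma hh_leT n : hh n <= T.
Proof.
rewrite /hh ler_pdivrMr ?n0pos // ler_peMr ?(ltW T0) //.
by apply: le_trans (n0le n); rewrite ler1n.
Qed.

Lemma hh_B n : T * hh n * B <= 1.
Proof.
rewrite /hh mulrA mulrAC ler_pdivrMr // mul1r ltW //.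
by apply: (lt_le_trans _ (n0le n)); exact: truncnS_gt.
Qed.

Lemma hh_small e : 0 < e -> U [set n | hh n <= e].
Proof.
move=> e0; apply: Uinf; exists (Num.Def.trunc (T / e)).+1 => n hn /=.
rewrite ler_pdivrMr // mulrC -ler_pdivrMr // ltW // (lt_le_trans (truncnS_gt _)) //.
by rewrite ler_nat (leq_trans hn) // leq_addr.
Qed.

Lemma idxP n t : 0 <= t -> (idx n t)%:R * hh n <= t < (idx n t)%:R * hh n + hh n.
Proof.
move=> t0; have h0 := hh_gt0 n.
have /andP[h1 h2] := truncn_itv (divr_ge0 t0 (ltW h0)).
rewrite -ler_pdivlMr // h1 /=.
by move: h2; rewrite ltr_pdivrMr // -natr1 mulrDl mul1r.
Qed.

Lemma idx_leT n t : 0 <= t <= T -> (idx n t)%:R * hh n <= T.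
Proof. by move=> /andP[t0 tT]; have /andP[h _] := idxP n t0; exact: le_trans tT. Qed.

Lemma xs_inv n t : 0 <= t <= T ->
  inball N x0 (xs n t) /\ nrg N x0 <= nrg N (xs n t) <= nrg N x0 + T * hh n * B.
Proof.
move=> tT; have [hb /andP[e1 e2]] := eul_inv sx0 cx0 (ltW (hh_gt0 n)) (idx_leT n tT) (hh_B n).
split; first exact: hb.
rewrite e1 /= (le_trans e2) // lerD2l ler_wpM2r ?fB0 // expr2 mulrA ler_wpM2r ?(ltW (hh_gt0 n)) //.
exact: idx_leT.
Qed.

Let K := fK N x0.
Let L := fL N x0.
Let K0 : 0 <= K := fK0 N x0.
Let L0 : 0 <= L := fL0 N x0.

Lemma xs_incr n s t k : 0 <= s -> s <= t -> t <= T ->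
  cn (xs n t k - xs n s k) <= K * (t - s) + hh n * K.
Proof.
move=> s0 st tT; have h0 := hh_gt0 n.
have tI : 0 <= t <= T by rewrite tT (le_trans s0).
have ij : (idx n s <= idx n t)%N by apply: le_truncn; rewrite ler_wpM2r // invr_ge0 ltW.
have := @eul_incr R N T x0 sx0 cx0 (hh n) (idx n s) (idx n t - idx n s) k (ltW h0).
rewrite subnKC // => /(_ (idx_leT n tI) (hh_B n)) /le_trans; apply.
have /andP[s1 s2] := idxP n s0; have /andP[t1 t2] := idxP n (le_trans s0 st).
rewrite natrB // mulrBl -/K.
have : (idx n t)%:R * hh n - (idx n s)%:R * hh n <= (t - s) + hh n by lra.
move=> /(ler_wpM2r K0) /le_trans; apply.
by rewrite mulrDl [K * _]mulrC.
Qed.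

Definition cquad : R := L * (K + 1).

Lemma cquad0 : 0 <= cquad.
Proof. by rewrite mulr_ge0 // addr_ge0. Qed.

(** Errors of order [hh n] from rounding s and t to the grid: in the square of the time difference,
    in the time at which the field is evaluated, and in the length multiplying it. *)
Definition crest : R := 3 * T * cquad + 2 * T * L + K.

Lemma xs_incr2 n s t k : 0 <= s -> s <= t -> t <= T ->
  cn (xs n t k - xs n s k - ((t - s)%:C)%C * fld N (xs n s) k s) <=
    cquad * (t - s) ^+ 2 + hh n * crest.
Proof.
move=> s0 st tT; have h0 := hh_gt0 n; have hT := hh_leT n.
have tI : 0 <= t <= T by rewrite tT (le_trans s0).
have sI : 0 <= s <= T by rewrite s0 (le_trans st).
have ij : (idx n s <= idx n t)%N by apply: le_truncn; rewrite ler_wpM2r // invr_ge0 ltW.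
have := @eul_incr2 R N T x0 T0 sx0 cx0 (hh n) (idx n s) (idx n t - idx n s) k (ltW h0).
rewrite subnKC // => /(_ (idx_leT n tI) (hh_B n)).
have /andP[s1 s2] := idxP n s0; have /andP[t1 t2] := idxP n (le_trans s0 st).
have [ib _] := xs_inv n sI.
have iI : 0 <= (idx n s)%:R * hh n <= T by rewrite (idx_leT n sI) mulr_ge0 // ltW.
have f1 : cn (fld N (xs n s) k ((idx n s)%:R * hh n) - fld N (xs n s) k s) <= L * hh n.
  have z0 j : cn (xs n s j - xs n s j) <= 0 by rewrite subrr cn0.
  rewrite (le_trans (fld_lip T0 k ib ib iI sI z0)) // add0r ler_wpM2l //.
  by rewrite ler0_norm; lra.
have f2 : cn (fld N (xs n s) k s) <= K by exact: fld_bnd.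
rewrite natrB //; set d := ((idx n t)%:R - (idx n s)%:R) * hh n.
have d0 : 0 <= d by rewrite mulr_ge0 ?(ltW h0) // subr_ge0 ler_nat.
have dle : d <= (t - s) + hh n by rewrite /d mulrBl; lra.
have dge : (t - s) - hh n <= d by rewrite /d mulrBl; lra.
rewrite -/(xs n t) -/(xs n s) => m1.
set g1 := fld N (xs n s) k _ in m1 f1; set g0 := fld N (xs n s) k s in f1 f2 *.
have -> : xs n t k - xs n s k - ((t - s)%:C)%C * g0 =
   (xs n t k - xs n s k - (d%:C)%C * g1) + (d%:C)%C * (g1 - g0) + ((d - (t - s))%:C)%C * g0.
  by rewrite !rmorphB; ring.
rewrite (le_trans (cnD _ _)) // (le_trans (lerD (cnD _ _) (lexx _))) //.
rewrite !cnM !cn_real (ger0_norm d0).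
have a1 : d * cn (g1 - g0) <= (2 * T) * (L * hh n).
  apply: ler_pM; rewrite ?cn_ge0 //; lra.
have a2 : `|d - (t - s)| * cn g0 <= hh n * K.
  apply: ler_pM; rewrite ?cn_ge0 ?normr_ge0 //.
  by rewrite ler_norml; apply/andP; split; lra.
apply: (le_trans (lerD (lerD m1 a1) a2)); rewrite -/L -/K -/cquad /crest.
have a3 : d ^+ 2 <= (t - s) ^+ 2 + 3 * T * hh n.
  apply: (@le_trans _ _ (((t - s) + hh n) ^+ 2)).
    by rewrite ler_pXn2r ?nnegrE // addr_ge0 ?subr_ge0 // ltW.
  rewrite sqrrD -addrA lerD2l.
  have x1 : (t - s) * hh n <= T * hh n by rewrite ler_wpM2r ?(ltW h0) //; lra.
  have x2 : hh n ^+ 2 <= T * hh n by rewrite expr2 ler_wpM2r ?(ltW h0).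
  rewrite mulr2n; lra.
have := ler_wpM2l cquad0 a3; rewrite mulrDr => a4.
apply: (le_trans (lerD (lerD a4 (lexx _)) (lexx _))).
by apply: ler_of_eq; ring.
Qed.

Lemma ulim_fld (z : nat -> fseq R) (l : fseq R) k tau :
  (forall j, ulim U (fun n => z n j) (l j)) ->
  ulim U (fun n => fld N (z n) k tau) (fld N l k tau).
Proof.
move=> h; rewrite /fld; case: (lowf N k); last exact: ulim_cst.
apply: ulimM; first exact: ulim_cst.
apply: ulimM; first exact: ulim_cst.
apply: ulim_sum => k1; apply: ulimM; last exact: h.
by apply: ulimM; [exact: ulim_cst|exact: h].
Qed.

Lemma nrgE (x : fseq R) : ((nrg N x)%:C)%C = \sum_(k <- bx N) x k * conjc (x k).
Proof.
rewrite /nrg rmorph_sum; apply: eq_bigr => k _ /=; rewrite cn_sqr /cabs2; case: (x k) => a b.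
by apply/eqP; rewrite eq_complex /=; apply/andP; split; apply/eqP; ring.
Qed.

Lemma galerkin_exists : exists v : R -> fseq R,
  [/\ v 0 = x0, forall t, 0 <= t <= T -> inball N x0 (v t) /\ nrg N (v t) = nrg N x0 &
      forall k, cprim T (fun t => v t k) (fun t => fld N (v t) k t)].
Proof.
have ex t k : exists l, 0 <= t <= T -> ulim U (fun n => xs n t k) l.
  case: (boolP (0 <= t <= T)) => tT; last by exists 0.
  have hb n : cn (xs n t k) <= rho N x0 by have [[_ _ h] _] := xs_inv n tT.
  by have [l hl] := ulim_ex UU hb; exists l.
pose v t k := projT1 (cid (ex t k)).
have hv t k : 0 <= t <= T -> ulim U (fun n => xs n t k) (v t k).
  exact: (projT2 (cid (ex t k))).
have vball t : 0 <= t <= T -> inball N x0 (v t).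
  move=> tT; split.
  - move=> k hk; apply: (ulim_uniq UU (hv t k tT)).
    rewrite (_ : (fun n => _) = (fun=> 0)); first exact: ulim_cst.
    by apply/funext => n; have [[h _ _] _] := xs_inv n tT; exact: h.
  - move=> k; apply: (ulim_uniq UU (hv t (- k) tT)).
    rewrite (_ : (fun n => _) = (fun n => conjc (xs n t k))); first by apply: ulim_conj; exact: hv.
    by apply/funext => n; have [[_ h _] _] := xs_inv n tT; exact: h.
  - move=> k; apply: (ulim_le UU (hv t k tT)); apply: filterS (@filterT _ U _) => n _ /=.
    by have [[_ _ h] _] := xs_inv n tT.
have lip s t k : 0 <= s <= T -> 0 <= t <= T -> cn (v t k - v s k) <= K * `|t - s|.
  wlog st : s t / s <= t.
    move=> H; case: (leP s t) => [/H//|/ltW ts hs ht]; rewrite cnBC [`|t - s|]distrC; exact: H.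
  move=> hs ht; have /andP[s0 _] := hs; have /andP[_ tT] := ht.
  have hz : ulim U (fun n => xs n t k - xs n s k) (v t k - v s k).
    rewrite (_ : (fun n => _) = (fun n => xs n t k + (-1) * xs n s k)); last first.
      by apply/funext => n; rewrite mulN1r.
    by rewrite -[- v s k]mulN1r; apply: ulimD (hv _ _ ht) _ => //; apply: ulimM (hv _ _ hs) => //; exact: ulim_cst.
  rewrite ger0_norm ?subr_ge0 //; apply: (ulim_near UU hz) => e e0.
  have e1 : 0 < e / (K + 1) by rewrite divr_gt0 // ltr_wpDl.
  apply: filterS (hh_small e1) => n /=; rewrite ler_pdivlMr ?ltr_wpDl // => hn.
  rewrite (le_trans (xs_incr n k s0 st tT)) // lerD2l (le_trans _ hn) //.
  by rewrite ler_wpM2l ?(ltW (hh_gt0 n)) // lerDl.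
exists v; split.
- apply/funext => k; have I0 : 0 <= (0 : R) <= T by rewrite lexx ltW.
  apply: (ulim_uniq UU (hv 0 k I0)); rewrite (_ : (fun n => _) = (fun=> x0 k)); first exact: ulim_cst.
  by apply/funext => n; rewrite /xs /idx mul0r truncn0.
- move=> t tT; split; first exact: vball.
  (* The energy of [xs n t] tends to that of [v t], being polynomial in the coordinates, and to that
     of [x0] by the two bounds of [xs_inv]. *)
  apply: complexI; apply: (@ulim_uniq _ U UU (fun n => ((nrg N (xs n t))%:C)%C)).
    rewrite nrgE; under eq_fun do rewrite nrgE.
    apply: ulim_sum => k; apply: ulimM; first exact: hv.
    by apply: ulim_conj; exact: hv.
  move=> e e0; have B0 : 0 <= T * B by rewrite mulr_ge0 ?(ltW T0) ?fB0.
  have e1 : 0 < e / (T * B + 1) by rewrite divr_gt0 // ltr_wpDl.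
  apply: filterS (hh_small e1) => n /=; rewrite ler_pdivlMr ?ltr_wpDl // => hn.
  have [_ /andP[h1 h2]] := xs_inv n tT.
  rewrite -rmorphB cn_real ger0_norm ?subr_ge0 // lerBlDl (le_trans h2) // lerD2l.
  by rewrite (le_trans _ hn) // mulrDr mulr1 mulrAC mulrC lerDl (ltW (hh_gt0 n)).
- move=> k; apply: (cprim_onesided (K := K) (B := K) (ltW T0) K0).
  + by move=> t tT; apply: fld_bnd; exact: vball.
  + by move=> s t; exact: lip.
  + move=> e e0; have c0 : 0 < L * (K + 1) + 1 by rewrite ltr_wpDl // cquad0.
    exists (e / (L * (K + 1) + 1)); first by rewrite divr_gt0.
    move=> s t hs ht; rewrite ltr_pdivlMr // => h.
    rewrite (le_trans (fld_lip T0 k (vball t ht) (vball s hs) ht hs (fun j => lip s t j hs ht))) //.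
    rewrite (le_trans _ (ltW h)) // -/L.
    have := normr_ge0 (t - s); move: (`|t - s|) (L) (K) => x p q; lra.
  + move=> e e0; have [d d0 hd] := small_of_quad 0 e0 cquad0; exists d => // s t s0 st tT dt.
    apply: le_trans (hd (t - s) _ dt); last by rewrite subr_ge0.
    have sI : 0 <= s <= T by rewrite s0 (le_trans st).
    have tI : 0 <= t <= T by rewrite tT (le_trans s0).
    have hz : ulim U (fun n => xs n t k - xs n s k - ((t - s)%:C)%C * fld N (xs n s) k s)
        (v t k - v s k - ((t - s)%:C)%C * fld N (v s) k s).
      rewrite (_ : (fun n => _) = (fun n => xs n t k + (-1) * xs n s k + (- ((t - s)%:C)%C) * fld N (xs n s) k s)); last first.
        by apply/funext => n; rewrite mulN1r mulNr.
      rewrite -[- v s k]mulN1r -mulNr; apply: ulimD => //.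
        by apply: ulimD => //; [exact: hv|apply: ulimM => //; [exact: ulim_cst|exact: hv]].
      by apply: ulimM => //; [exact: ulim_cst|apply: ulim_fld => j; exact: hv].
    apply: (ulim_near UU hz) => eps eps0.
    have c0 : 0 <= crest.
      have t0 := ltW T0; rewrite /crest addr_ge0 // addr_ge0 //; last exact: mulr_ge0 (mulr_ge0 _ _) _.
      exact: mulr_ge0 (mulr_ge0 _ _) cquad0.
    have e1 : 0 < eps / (crest + 1) by rewrite divr_gt0 // ltr_wpDl.
    apply: filterS (hh_small e1) => n /=; rewrite ler_pdivlMr ?ltr_wpDl // => hn.
    rewrite (le_trans (xs_incr2 n k s0 st tT)) // lerD2l (le_trans _ hn) //.
    by rewrite ler_wpM2l ?(ltW (hh_gt0 n)) // lerDl.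
Qed.

End Galerkin.

(** * Finitely supported sequences *)

Section FiniteSupport.
Variable R : realType.
Notation C := (R[i]).
Implicit Types (x v w : fseq R).

Lemma csum_lim_uniq (f : int -> C) l m : csum_lim f l -> csum_lim f m -> l = m.
Proof.
move=> hl hm; apply/eqP; rewrite -subr_eq0; apply/eqP; apply: cn_eq0; apply/eqP.
rewrite eq_le cn_ge0 andbT; apply: csum_lim_le (csum_limB hl hm) _ => L _.
by rewrite big1 // => k _; rewrite subrr cn0.
Qed.

Lemma csum_limZ (c : C) (f : int -> C) l : csum_lim f l -> csum_lim (fun k => c * f k) (c * l).
Proof.
move=> hl e e0; have c0 : 0 < cn c + 1 by rewrite ltr_wpDl ?cn_ge0.
have [M hM] := hl _ (divr_gt0 e0 c0); exists M => S uS sS.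
rewrite -mulr_sumr -mulrBr cnM; have := hM S uS sS; rewrite ler_pdivlMr //.
by apply: le_trans; rewrite mulrC ler_wpM2l ?cn_ge0 // lerDl.
Qed.

Variable N : nat.

Lemma l2b_nrg x : supp N x -> l2b (fun k => cn (x k)) (Num.sqrt (nrg N x)).
Proof.
move=> sx L uL; rewrite sqr_sqrtr ?nrg_ge0 // /nrg.
rewrite (bigID (mem (bx N))) /= [X in _ + X]big1 ?addr0; last first.
  by move=> k kN; rewrite (supp_bx sx kN) cn0 expr0n.
rewrite -big_filter; apply: ler_sum_subset; rewrite ?filter_uniq //.
  by move=> k; rewrite sqr_ge0.
by move=> k; rewrite mem_filter => /andP[].
Qed.

Lemma hs_norm0E x : supp N x -> hs_norm 0 x = Num.sqrt (nrg N x).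
Proof.
move=> sx; have x0 : x 0 = 0 by apply: sx; rewrite /lowf eqxx.
have lx := l2b_nrg sx; apply/eqP; rewrite eq_le; apply/andP; split.
  by apply: hs_norm_le; rewrite ?sqrtr_ge0 // wt0E.
have h := l2b_hs_norm_of (s := 0) x0 (Z := Num.sqrt (nrg N x)); rewrite wt0E in h.
have := h lx (bx N) (bx_uniq N).
by rewrite -[X in _ -> _ <= X](ger0_norm (hs_norm_ge0 0 x)) -sqrtr_sqr => /ler_wsqrtr.
Qed.

Lemma nt_supp x k tau k1 : supp N x -> nt x k tau k1 = if k1 \in bx N then nt x k tau k1 else 0.
Proof. by move=> sx; case: ifP => // /negbT kN; rewrite /nt (supp_bx sx kN) mulr0 mul0r. Qed.

Lemma kdv_nonlin_supp x k tau : supp N x -> kdv_nonlin x k tau = \sum_(k1 <- bx N) nt x k tau k1.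
Proof.
move=> sx; have x0 : x 0 = 0 by apply: sx; rewrite /lowf eqxx.
apply: csum_lim_uniq (kdv_nonlin_lim k tau (sqrtr_ge0 _) (l2b_nrg sx) x0) _.
rewrite [X in csum_lim X _](_ : _ = fun k1 => if k1 \in bx N then nt x k tau k1 else 0).
  exact: csum_lim_fin (bx_uniq N).
by apply/funext => k1; exact: nt_supp.
Qed.

Lemma fldE x k tau : supp N x -> fld N x k tau = k%:~R * Fn (lowf N) x k tau.
Proof.
by move=> sx; rewrite /fld /Fn; case: ifP => _; rewrite ?mulr0 // kdv_nonlin_supp.
Qed.

(** This bound depends on N: it only supplies the finiteness that [gsol_apriori] asks for, whose
    constant is uniform in N. *)
Lemma supp_l2b_wt x s a : 0 <= a -> supp N x -> l2b (fun k => cn (x k)) a ->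
  l2b (fun k => wt s k * cn (x k)) ((\sum_(k <- bx N) wt s k) * a).
Proof.
move=> a0 sx hx; have W0 : 0 <= \sum_(k <- bx N) wt s k by apply: sumr_ge0 => k _; exact: wt_ge0.
apply: (l2b_le _ _ (l2b_scale (\sum_(k <- bx N) wt s k) hx)) => [|k].
  by rewrite lexx mulr_ge0.
 rewrite mulr_ge0 ?wt_ge0 ?cn_ge0 //=.
have [kN|kN] := boolP (k \in bx N); last by rewrite (supp_bx sx kN) cn0 !mulr0.
rewrite ler_wpM2r ?cn_ge0 //.
have := ler_sum_subset (f := wt s) (L := [:: k]) (L' := bx N); rewrite big_seq1; apply => //.
  by move=> j; exact: wt_ge0.
by move=> j; rewrite inE => /eqP ->.
Qed.

End FiniteSupport.

(** * Galerkin solutions with uniform H^s bounds *)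

Section GalerkinApproximation.
Variable R : realType.

Lemma galerkin_gsol (N : nat) (T : R) (x0 : fseq R) : 0 < T -> supp N x0 ->
  (forall k, x0 (- k) = conjc (x0 k)) ->
  exists v : R -> fseq R, [/\ v 0 = x0, gsol (lowf N) T (hs_norm 0 x0) v,
    forall t, 0 <= t <= T -> supp N (v t),
    forall t k, 0 <= t <= T -> v t (- k) = conjc (v t k) &
    forall t, 0 <= t <= T -> hs_norm 0 (v t) = hs_norm 0 x0].
Proof.
move=> T0 sx cx; have [U [UU Uinf]] := ultra_above_eventually.
have [v [v0 hv hp]] := galerkin_exists UU Uinf T0 sx cx.
have sv t : 0 <= t <= T -> supp N (v t) by move=> /hv[[]].
have nv t : 0 <= t <= T -> hs_norm 0 (v t) = hs_norm 0 x0.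
  by move=> tT; rewrite (hs_norm0E (sv t tT)) (hs_norm0E sx); have [_ ->] := hv t tT.
exists v; split => //; last by move=> t k /hv[[]].
split; first by rewrite /lowf eqxx.
- by move=> t tT; apply: sv; rewrite // /lowf eqxx.
- by move=> t tT; rewrite -(nv t tT) (hs_norm0E (sv t tT)); exact: l2b_nrg (sv t tT).
- move=> k; apply: cprim_eq (hp k) => // [|t tT]; first exact: ltW.
  exact: fldE (sv t tT).
Qed.

Definition trunc (N : nat) (x : fseq R) : fseq R := fun k => if lowf N k then x k else 0.

Lemma supp_trunc N x : supp N (trunc N x).
Proof. by move=> k /negPf kN; rewrite /trunc kN. Qed.

Lemma trunc_conj N x : (forall k, x (- k) = conjc (x k)) ->
  forall k, trunc N x (- k) = conjc (trunc N x k).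
Proof.
by move=> cx k; rewrite /trunc /lowf oppr_eq0 normrN; case: ifP => _; rewrite ?cx ?conjc0.
Qed.

Lemma cn_trunc_le N x k : cn (trunc N x k) <= cn (x k).
Proof. by rewrite /trunc; case: ifP; rewrite ?cn0 ?cn_ge0. Qed.

Lemma hs_norm_trunc s N x : x 0 = 0 -> (hs_norm2 s x < +oo)%E ->
  hs_norm s (trunc N x) <= hs_norm s x.
Proof.
move=> x0 hx; apply: hs_norm_le; rewrite ?hs_norm_ge0 //.
apply: l2b_le (l2b_hs_norm x0 hx) => [|k]; first by rewrite hs_norm_ge0 lexx.
by rewrite mulr_ge0 ?wt_ge0 ?cn_ge0 //= ler_wpM2l ?wt_ge0 // cn_trunc_le.
Qed.

Lemma gsol_mono (A : pred int) (T a b : R) v : 0 <= a <= b -> gsol A T a v -> gsol A T b v.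
Proof.
move=> ab [A0 v0 va vp]; split => // t tT; apply: l2b_le (va t tT) => // k.
by rewrite cn_ge0 lexx.
Qed.

Lemma galerkin_bounded (s T : R) : 0 <= s -> 0 < T -> forall v0 : fseq R, inHs s v0 ->
  exists2 B, 0 <= B & forall N, exists v : R -> fseq R,
   [/\ v 0 = trunc N v0, gsol (lowf N) T (hs_norm 0 v0) v, bnd_s s T v B,
    forall t k, 0 <= t <= T -> v t (- k) = conjc (v t k) &
    forall t, 0 <= t <= T -> hs_norm 0 (v t) = hs_norm 0 (v 0)].
Proof.
move=> s0 T0 x [x0 [cx hx]].
have h0x : (hs_norm2 0 x < +oo)%E.
  have h := l2b_wt0 s0 x0 (hs_norm_ge0 s x) (l2b_hs_norm x0 hx).
  apply: (@hs_norm2_lty _ 0 x (hs_norm s x)); apply: l2b_le h => [|k].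
    by rewrite hs_norm_ge0 lexx.
  by rewrite wt0 mul1r cn_ge0 lexx.
have a0 := hs_norm_ge0 0 x.
have [L L0 hL] := gsol_apriori s0 a0 (ltW T0).
exists (L * hs_norm s x) => [|N]; first by rewrite mulr_ge0 // hs_norm_ge0.
have [v [v0 hv sv cv nv]] := galerkin_gsol T0 (@supp_trunc N x) (trunc_conj N cx).
have {}hv : gsol (lowf N) T (hs_norm 0 x) v.
  by apply: gsol_mono hv; rewrite hs_norm_ge0 hs_norm_trunc.
have [_ vz va _] := hv.
exists v; split => //; last by move=> t tT; rewrite nv // v0.
have bv : bnd_s s T v ((\sum_(k <- bx N) wt s k) * hs_norm 0 x).
  by move=> t tT; apply: supp_l2b_wt => //; [exact: sv|exact: va].
move=> t tT; apply: l2b_le (l2b_hs_norm_of (vz t tT) (bv t tT)) => [|k]; last first.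
  by rewrite mulr_ge0 ?wt_ge0 ?cn_ge0 /=.
rewrite hs_norm_ge0 /= (le_trans (hL _ _ hv _ t tT)) //.
  exists ((\sum_(k <- bx N) wt s k) * hs_norm 0 x) => //.
  by rewrite mulr_ge0 // sumr_ge0 // => k _; exact: wt_ge0.
by rewrite v0 ler_wpM2l // hs_norm_trunc.
Qed.

End GalerkinApproximation.

(** * Passage to the limit and conclusion *)

Section Compactness.
Variable R : realType.
Notation C := (R[i]).
Implicit Types (z v w : fseq R).

(** Beyond m the H^s bound leaves at most D/(m+1)^s <= e/2 in H^0; the 2m + 1 coordinates below are
    small by assumption and contribute the other half. *)
Lemma l2b_of_low (s D e : R) : 0 < s -> 0 <= D -> 0 < e -> exists m, exists2 d : R, 0 < d &
  forall z, l2b (fun k => wt s k * cn (z k)) D -> {in bx m, forall k, cn (z k) <= d} ->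
    l2b (fun k => cn (z k)) e.
Proof.
move=> s0 D0 e0; pose X := 2 * D / e + 1.
have X0 : 0 < X by rewrite ltr_wpDl // divr_ge0 ?mulr_ge0 // ltW.
pose m := Num.Def.trunc (X `^ s^-1); exists m.
pose W := (m.+1%:R : R) `^ s.
have XW : X <= W.
  have -> : X = (X `^ s^-1) `^ s by rewrite -powRrM mulVf ?gt_eqF // powRr1 // ltW.
  apply: ge0_ler_powR; rewrite ?nnegrE ?powR_ge0 ?ler0n ?(ltW s0) //.
  by rewrite ltW // truncnS_gt.
have W0 : 0 < W := lt_le_trans X0 XW.
have d0 : 0 < e / 2 / (2 * m).+1%:R by rewrite !divr_gt0.
exists (e / 2 / (2 * m).+1%:R) => // z hz low; have hd : e / 2 = (2 * m).+1%:R * (e / 2 / (2 * m).+1%:R) by rewrite [RHS]mulrC divfK ?gt_eqF.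
move: (e / 2 / (2 * m).+1%:R) hd d0 low => d hd d0 low.
have e2 : 0 <= e / 2 by rewrite divr_ge0 // ltW.
rewrite [e]splitr; apply: (@l2bD _ (fun k => if k \in bx m then d else 0)
   (fun k => W^-1 * (wt s k * cn (z k)))) => //.
- move=> L uL; apply: (@le_trans _ _ (\sum_(k <- bx m) d ^+ 2)).
    rewrite (bigID (mem (bx m))) /= [X in _ + X]big1 ?addr0; last first.
      by move=> k /negPf ->; rewrite expr0n.
    rewrite (eq_bigr (fun=> d ^+ 2)) => [|k ->//].
    rewrite -big_filter; apply: ler_sum_subset; rewrite ?filter_uniq //.
      by move=> k; rewrite sqr_ge0.
    by move=> k; rewrite mem_filter => /andP[].
  rewrite big_const_seq iter_addr_0 count_predT size_map size_iota -(mulr_natl (d ^+ 2)).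
  rewrite hd exprMn ler_wpM2r ?sqr_ge0 // expr2 ler_peMl ?ler0n // ler1n //.
- apply: (l2b_le _ _ (l2b_scale W^-1 hz)) => [|k]; last first.
    by rewrite !mulr_ge0 ?wt_ge0 ?cn_ge0 ?invr_ge0 ?(ltW W0) /=.
  rewrite mulr_ge0 ?invr_ge0 ?(ltW W0) //= mulrC ler_pdivrMr //.
  apply: (le_trans _ (ler_wpM2l e2 XW)); rewrite /X mulrDr mulr1.
  have -> : e / 2 * (2 * D / e) = D by field; rewrite gt_eqF.
  by rewrite lerDl.
- move=> k; rewrite cn_ge0 /=; case: ifP => kb.
    rewrite (le_trans (low k kb)) // lerDl !mulr_ge0 ?wt_ge0 ?cn_ge0 ?invr_ge0 ?(ltW W0) //.
  rewrite add0r mulrA ler_peMl ?cn_ge0 // mulrC ler_pdivlMr // mul1r.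
  apply: ge0_ler_powR; rewrite ?nnegrE ?ler0n ?ler0z ?(ltW s0) //.
  rewrite -[leLHS]/((m.+1%:Z)%:~R) ler_int; move: kb; rewrite mem_bx; lia.
Qed.

Lemma FnB_le0 A w v a d k tau : 0 <= a -> 0 <= d ->
  l2b (fun j => cn (w j)) a -> l2b (fun j => cn (v j)) a -> l2b (fun j => cn (w j - v j)) d ->
  w 0 = 0 -> v 0 = 0 -> cn (Fn A w k tau - Fn A v k tau) <= 2 * cw (R := R) 0 * a * d.
Proof.
move=> a0 d0 wa va wv w0 v0.
have E (f : int -> R) : (fun k => wt 0 k * f k) = f by apply/funext => j; rewrite wt0 mul1r.
have sl : slotd 0 true w v a a d d by rewrite /slotd /slotb !E.
have := FnB_le A k tau (lexx _) (And4 a0 a0 d0 d0) sl w0 v0.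
rewrite wt0 mul1r => /le_trans; apply; apply: ler_of_eq; ring.
Qed.

Lemma Fn_le A v a k tau : 0 <= a -> l2b (fun j => cn (v j)) a -> v 0 = 0 ->
  cn (Fn A v k tau) <= 2 * cw (R := R) 0 * a * a.
Proof.
move=> a0 va v0; have F0 : Fn A (fun=> 0 : C) k tau = 0.
  by rewrite /Fn kdv_nonlin0 mulr0; case: ifP.
rewrite -[Fn A v k tau]subr0 -F0; apply: FnB_le0 => //; first exact: l2b_cn0.
by under eq_fun do rewrite subr0.
Qed.

(* Undoing the interaction representation: [tw t (v t)] are the Fourier coefficients of [u(t)]. *)
Definition tw (t : R) v : fseq R := fun k => cexpi ((- (k * k * k))%:~R * t) * v k.

Lemma cn_tw t v k : cn (tw t v k) = cn (v k).
Proof. by rewrite /tw cnM cn_cexpi mul1r. Qed.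

(** By 3 k k1 k2 = k^3 - k1^3 - k2^3 the phases depending on k1 are absorbed into the arguments, and
    only one in k remains. *)
Lemma Fn_tw A v a k tau : 0 <= a -> l2b (fun j => cn (v j)) a -> v 0 = 0 ->
  Fn A v k tau = cexpi ((k * k * k)%:~R * tau) * Fn A (tw tau v) k 0.
Proof.
move=> a0 va v0; rewrite /Fn; case: ifP => _; last by rewrite mulr0.
rewrite mulrCA; congr (_ * _).
have ta : l2b (fun j => cn (tw tau v j)) a by under eq_fun do rewrite cn_tw.
have t0 : tw tau v 0 = 0 by rewrite /tw v0 mulr0.
apply: csum_lim_uniq (kdv_nonlin_lim k tau a0 va v0) _.
have := csum_limZ (cexpi ((k * k * k)%:~R * tau)) (kdv_nonlin_lim k 0 a0 ta t0).
congr (csum_lim _ _); apply/funext => k1; rewrite /nt /tw mulr0.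
have -> : 3 * k * k1 * (k - k1) = k * k * k + (- (k1 * k1 * k1) + - ((k - k1) * (k - k1) * (k - k1))).
  by ring.
rewrite [in RHS]intrD [in RHS]intrD !mulrDl !cexpiD.
have -> : cexpi (0 : R) = 1 by rewrite /cexpi cos0 sin0.
ring.
Qed.

(** The phases in k1 are not equicontinuous, but [tw t (v t)] is so in H^0: its low frequencies by
    [gsol_equicont] and bounded phases, its high ones by the H^s bound. *)
Lemma Fn_modulus (s a B T : R) k : 0 < s -> 0 <= a -> 0 <= B -> 0 <= T -> forall e, 0 < e ->
  exists2 d, 0 < d & forall (A : pred int) (v : R -> fseq R), gsol A T a v -> bnd_s s T v B ->
    forall t0 t1, 0 <= t0 <= T -> 0 <= t1 <= T -> `|t1 - t0| <= d ->
      cn (Fn A (v t1) k t1 - Fn A (v t0) k t0) <= e.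
Proof.
move=> s0 a0 B0 T0 e e0; pose K := 2 * cw (R := R) 0 * a.
have K0 : 0 <= K by rewrite mulr_ge0 // mulr_ge0 // cw_ge0.
have e1 : 0 < e / 2 / (K + 1) by rewrite divr_gt0 ?divr_gt0 // ltr_wpDl.
have [m [d1 d10 hlow]] := l2b_of_low s0 (addr_ge0 B0 B0) e1.
have [d2 d20 heq] := gsol_equicont (lexx 0) a0 a0 T0 (divr_gt0 d10 (ltr0n _ 2)).
(* The first term controls the phases j^3 with |j| <= m inside [tw], the second the phase k^3 in
   front of the nonlinearity. *)
pose M := m%:R ^+ 3 * a + (`|k|%:~R) ^+ 3 * (K * a) : R.
have M0 : 0 <= M.
  by apply: addr_ge0; apply: mulr_ge0; rewrite ?exprn_ge0 ?ler0z // mulr_ge0.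
pose e3 := Num.min (d1 / 2) (e / 2).
have e30 : 0 < e3 by rewrite lt_min !divr_gt0.
exists (Num.min d2 (e3 / (M + 1))); first by rewrite lt_min d20 divr_gt0 // ltr_wpDl.
move=> A v hv bv t0 t1 h0 h1; rewrite le_min => /andP[dt2]; rewrite ler_pdivlMr ?ltr_wpDl //.
rewrite le_min => /andP[dt3 dt4].
have [A0 vz va _] := hv.
have cube (j : int) : `|(j * j * j)%:~R : R| = (`|j|%:~R) ^+ 3.
  by rewrite -intr_norm !normrM !intrM; ring.
have dtM x : 0 <= x <= M -> x * `|t1 - t0| <= `|t1 - t0| * (M + 1).
  by move=> /andP[x0 xM]; have := normr_ge0 (t1 - t0); move: (`|t1 - t0|) => y y0; nra.
have phase c : cn (cexpi (c * t1) - cexpi (c * t0)) <= `|c| * `|t1 - t0| := cexpi_lip c h0 h1.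
pose W0 := tw t0 (v t0); pose W1 := tw t1 (v t1).
have Wd : l2b (fun j => cn (W1 j - W0 j)) (e / 2 / (K + 1)).
  apply: (hlow (fun j => W1 j - W0 j)).
    apply: l2bD (bv t1 h1) (bv t0 h0) _ => // j.
    by rewrite mulr_ge0 ?wt_ge0 ?cn_ge0 //= -mulrDr ler_wpM2l ?wt_ge0 // (le_trans (cnB _ _)) // !cn_tw.
  move=> j jm; have -> : W1 j - W0 j = cexpi ((- (j * j * j))%:~R * t1) * (v t1 j - v t0 j) +
     (cexpi ((- (j * j * j))%:~R * t1) - cexpi ((- (j * j * j))%:~R * t0)) * v t0 j.
    by rewrite /W1 /W0 /tw; ring.
  rewrite (le_trans (cnD _ _)) // [d1]splitr cnM cn_cexpi mul1r; apply: lerD.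
    have := l2b_sup j (divr_ge0 (ltW d10) (ler0n _ 2)) (heq A v hv _ t0 t1 h0 h1 dt2).
    rewrite wt0 mul1r; apply => t tT; apply: l2b_le (va t tT) => [|i]; first by rewrite a0 lexx.
    by rewrite wt0 mul1r cn_ge0 lexx.
  rewrite cnM; apply: (@le_trans _ _ ((`|j|%:~R) ^+ 3 * `|t1 - t0| * a)).
    apply: ler_pM; rewrite ?cn_ge0 //; last exact: l2b_sup (va t0 h0).
    by rewrite (le_trans (phase _)) // intrN normrN cube.
  apply: le_trans dt3; rewrite mulrAC; apply: dtM; rewrite mulr_ge0 ?exprn_ge0 ?ler0z //=.
  rewrite /M; apply: (@le_trans _ _ (m%:R ^+ 3 * a)); last first.
    by rewrite lerDl mulr_ge0 ?exprn_ge0 ?ler0z // mulr_ge0.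
  rewrite ler_wpM2r // ler_pXn2r ?nnegrE ?ler0z ?ler0n //.
  by rewrite -[leRHS]/((m%:Z)%:~R) ler_int -mem_bx.
have Wa t : 0 <= t <= T -> l2b (fun j => cn (tw t (v t) j)) a.
  by move=> tT; under eq_fun do rewrite cn_tw; exact: va.
have Wz t : 0 <= t <= T -> tw t (v t) 0 = 0 by move=> tT; rewrite /tw vz // mulr0.
rewrite (Fn_tw A k t1 a0 (va t1 h1) (vz t1 h1)) (Fn_tw A k t0 a0 (va t0 h0) (vz t0 h0)) -/W0 -/W1.
have split_prod (c1 c0 F1 F0 : C) : c1 * F1 - c0 * F0 = c1 * (F1 - F0) + (c1 - c0) * F0 by ring.
rewrite split_prod.
rewrite (le_trans (cnD _ _)) // [e]splitr cnM cn_cexpi mul1r; apply: lerD.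
  have := FnB_le0 A k 0 a0 (ltW e1) (Wa t1 h1) (Wa t0 h0) Wd (Wz t1 h1) (Wz t0 h0).
  move/le_trans; apply; rewrite -/K mulrA ler_pdivrMr ?ltr_wpDl //.
  by rewrite mulrC ler_wpM2l ?divr_ge0 ?(ltW e0) // lerDl.
rewrite cnM; apply: (@le_trans _ _ ((`|k|%:~R) ^+ 3 * `|t1 - t0| * (K * a))).
  apply: ler_pM; rewrite ?cn_ge0 //; first by rewrite (le_trans (phase _)) // cube.
  by apply: Fn_le => //; [exact: Wa|exact: Wz].
apply: le_trans dt4; rewrite mulrAC; apply: dtM.
rewrite /M lerDr; apply/andP; split; last by apply: mulr_ge0 => //; exact: exprn_ge0.
by apply: mulr_ge0; [rewrite exprn_ge0 ?ler0z|exact: mulr_ge0].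
Qed.

End Compactness.

(** * The limit of the Galerkin solutions *)

Section Limit.
Variable R : realType.
Notation C := (R[i]).
Implicit Types (z v w : fseq R).

Lemma cprim_id T (c : C) : 0 <= T -> cprim T (fun t => (t%:C)%C * c) (fun=> c).
Proof.
move=> T0; have h : cprim T (fun t => (t%:C)%C) (fun=> 1).
  split; last exact: rprim_cst.
  split => /=; [exact: measurable_id|exact: measurable_cst|by exists 1 => t _; rewrite normr1|].
  by move=> t /andP[t0 _]; rewrite Rint_cst // subr0 mul1r add0r.
apply: cprim_eq (cprimM T0 h (cprim_cst T c)) => // t _.
by rewrite mulr0 addr0 mul1r.
Qed.

Lemma cprim_expand T (f F : R -> C) s t e : cprim T f F -> 0 <= s -> s <= t -> t <= T ->
  (forall u, s <= u <= t -> cn (F u - F s) <= e) ->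
  cn (f t - f s - ((t - s)%:C)%C * F s) <= e * (t - s).
Proof.
move=> hf s0 st tT he; have T0 : 0 <= T := le_trans (le_trans s0 st) tT.
have := cprim_cn_le (cprimB T0 hf (cprim_id (F s) T0)) s0 st tT he.
by congr (cn _ <= _); rewrite rmorphB; ring.
Qed.

Variable U : set_system nat.
Hypotheses (UU : UltraFilter U)
  (Uinf : forall P : set nat, (exists n0, forall n, (n0 <= n)%N -> P n) -> U P).

Lemma ulim_l2b (c : int -> R) (z : nat -> fseq R) (l : fseq R) B :
  (forall k, ulim U (fun n => z n k) (l k)) ->
  (forall n, l2b (fun k => c k * cn (z n k)) B) -> l2b (fun k => c k * cn (l k)) B.
Proof.
move=> hz hB L uL.
have E (x : fseq R) : ((\sum_(k <- L) (c k * cn (x k)) ^+ 2)%:C)%C =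
    \sum_(k <- L) ((c k ^+ 2)%:C)%C * (x k * conjc (x k)).
  rewrite rmorph_sum; apply: eq_bigr => k _ /=; rewrite exprMn cn_sqr /cabs2.
  by case: (x k) => p q; apply/eqP; rewrite eq_complex /=; apply/andP; split; apply/eqP; ring.
have S0 (x : fseq R) : 0 <= \sum_(k <- L) (c k * cn (x k)) ^+ 2.
  by apply: sumr_ge0 => k _; rewrite sqr_ge0.
rewrite -[leLHS](ger0_norm (S0 l)) -cn_real.
apply: (@ulim_le _ U UU (fun n => ((\sum_(k <- L) (c k * cn (z n k)) ^+ 2)%:C)%C)).
  rewrite E; under eq_fun do rewrite E.
  apply: ulim_sum => k; apply: ulimM; first exact: ulim_cst.
  by apply: ulimM; [exact: hz|apply: ulim_conj; exact: hz].
apply: filterS (@filterT _ U _) => n _ /=.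
by rewrite cn_real ger0_norm //; exact: hB.
Qed.

Lemma ulim_low (z : nat -> fseq R) (l : fseq R) (L : seq int) d : 0 < d ->
  (forall k, ulim U (fun n => z n k) (l k)) ->
  U [set n | {in L, forall k, cn (z n k - l k) <= d}].
Proof.
move=> d0 hz; elim: L => [|k L IH]; first by apply: filterS (@filterT _ U _) => n _ k.
apply: filterS2 (hz k d d0) IH => n /= h1 h2 j; rewrite in_cons => /predU1P[->//|]; exact: h2.
Qed.

Lemma ulim_l2 (s B e : R) (z : nat -> fseq R) (l : fseq R) : 0 < s -> 0 <= B -> 0 < e ->
  (forall k, ulim U (fun n => z n k) (l k)) ->
  (forall n, l2b (fun k => wt s k * cn (z n k)) B) ->
  U [set n | l2b (fun k => cn (z n k - l k)) e].
Proof.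
move=> s0 B0 e0 hz hB; have hl := ulim_l2b hz hB.
have [m [d d0 hlow]] := l2b_of_low s0 (addr_ge0 B0 B0) e0.
apply: filterS (ulim_low (bx m) d0 hz) => n /= h.
apply: (hlow (fun k => z n k - l k)) => //; apply: l2bD (hB n) hl _ => // k.
by rewrite mulr_ge0 ?wt_ge0 ?cn_ge0 //= -mulrDr ler_wpM2l ?wt_ge0 // cnB.
Qed.

Definition allf : pred int := fun k => k != 0.

Variables (s T a B : R) (vn : nat -> R -> fseq R).
Hypotheses (s0 : 0 < s) (T0 : 0 < T) (a0 : 0 <= a) (B0 : 0 <= B)
  (hv : forall n, gsol (lowf n) T a (vn n)) (hb : forall n, bnd_s s T (vn n) B).

Lemma ulim_Fn t k (l : fseq R) : 0 <= t <= T ->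
  (forall k, ulim U (fun n => vn n t k) (l k)) ->
  ulim U (fun n => Fn (lowf n) (vn n t) k t) (Fn allf l k t).
Proof.
move=> tT hl e e0; have K0 : 0 <= 2 * cw (R := R) 0 * a by rewrite mulr_ge0 // mulr_ge0 // cw_ge0.
have e1 : 0 < e / (2 * cw (R := R) 0 * a + 1) by rewrite divr_gt0 // ltr_wpDl.
have la : l2b (fun k => cn (l k)) a.
  have := @ulim_l2b (fun=> 1) (fun n => vn n t) l a hl.
  have E (f : fseq R) : (fun k => 1 * cn (f k)) = (fun k => cn (f k)) by apply/funext => j; rewrite mul1r.
  rewrite E; apply => n; rewrite E; have [_ _ va _] := hv n; exact: va.
have l0 : l 0 = 0.
  apply: (ulim_uniq UU (hl 0)); rewrite (_ : (fun n => _) = fun=> 0); first exact: ulim_cst.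
  by apply/funext => n; have [_ v0 _ _] := hv n; exact: v0.
(* Once n >= |k| the truncation no longer acts on the output frequency k. *)
have h1 : U [set n | (`|k| <= n%:Z)%R] by apply: Uinf; exists `|k|%N => n hn /=; lia.
apply: filterS2 h1 (ulim_l2 s0 B0 e1 hl (fun n => hb n tT)) => n /= kn hn.
have -> : Fn (lowf n) (vn n t) k t = Fn allf (vn n t) k t by rewrite /Fn /lowf /allf kn andbT.
have [_ v0 va _] := hv n.
rewrite (le_trans (FnB_le0 allf k t a0 (ltW e1) (va t tT) la hn (v0 t tT) l0)) //.
by rewrite mulrA ler_pdivrMr ?ltr_wpDl // mulrC ler_wpM2l ?(ltW e0) // lerDl.
Qed.

(** No limit is taken under an integral: the first-order expansions of [cprim_expand] hold with an
    error uniform in n, pass to the limit at fixed times, and characterise primitives by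
    [cprim_onesided]. *)
Lemma gsol_limit : exists v : R -> fseq R,
  [/\ gsol allf T a v, bnd_s s T v B &
      forall t k, 0 <= t <= T -> ulim U (fun n => vn n t k) (v t k)].
Proof.
have ex t k : exists l, 0 <= t <= T -> ulim U (fun n => vn n t k) l.
  case: (boolP (0 <= t <= T)) => tT; last by exists 0.
  have hk n : cn (vn n t k) <= a by have [_ _ va _] := hv n; exact: l2b_sup (va t tT).
  by have [l hl] := ulim_ex UU hk; exists l.
pose v t k := projT1 (cid (ex t k)).
have hl t k : 0 <= t <= T -> ulim U (fun n => vn n t k) (v t k) := projT2 (cid (ex t k)).
have hF t k tT := ulim_Fn k tT (fun j => hl t j tT).
have kF t k : 0 <= t <= T ->
    ulim U (fun n => k%:~R * Fn (lowf n) (vn n t) k t) (k%:~R * Fn allf (v t) k t).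
  by move=> tT; apply: ulimM; [exact: ulim_cst|exact: hF].
pose K (k : int) : R := `|k|%:~R * (2 * cw (R := R) 0 * a * a).
have K0 k : 0 <= K k by apply: mulr_ge0; rewrite ?ler0z // !mulr_ge0 // cw_ge0.
have Kb n t k : 0 <= t <= T -> cn (k%:~R * Fn (lowf n) (vn n t) k t) <= K k.
  move=> tT; have [_ v0 va _] := hv n.
  by rewrite cnM cn_int ler_wpM2l ?ler0z // Fn_le //; [exact: va|exact: v0].
have mod_n k e : 0 < e -> exists2 d, 0 < d & forall n t0 t1, 0 <= t0 <= T -> 0 <= t1 <= T ->
    `|t1 - t0| <= d -> cn (k%:~R * Fn (lowf n) (vn n t1) k t1 - k%:~R * Fn (lowf n) (vn n t0) k t0) <= e.
  move=> e0; have k1 : 0 < `|k|%:~R + 1 :> R by rewrite ltr_wpDl // ler0z.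
  have [d d0 hd] := Fn_modulus k s0 a0 B0 (ltW T0) (divr_gt0 e0 k1).
  exists d => // n t0 t1 h0 h1 dt; rewrite -mulrBr cnM cn_int.
  have := hd _ _ (hv n) (hb n) t0 t1 h0 h1 dt; rewrite ler_pdivlMr // => /(le_trans _); apply.
  by rewrite mulrC ler_wpM2l ?cn_ge0 // lerDl.
have ulimB (x y : nat -> C) (p q : C) : ulim U x p -> ulim U y q -> ulim U (fun n => x n - y n) (p - q).
  move=> hx hy; rewrite -[- q]mulN1r; under eq_fun do rewrite -mulN1r.
  by apply: ulimD => //; apply: ulimM => //; exact: ulim_cst.
have always (P : set nat) : (forall n, P n) -> U P.
  by move=> h; apply: filterS (@filterT _ U _).
exists v; split => //.
- split => //.
  + move=> t tT; apply: (ulim_uniq UU (hl t 0 tT)).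
    rewrite (_ : (fun n => _) = fun=> 0); first exact: ulim_cst.
    by apply/funext => n; have [_ v0 _ _] := hv n; exact: v0.
  + move=> t tT; have := @ulim_l2b (fun=> 1) (fun n => vn n t) (v t) a (fun k => hl t k tT).
    have E (f : fseq R) : (fun k => 1 * cn (f k)) = (fun k => cn (f k)).
      by apply/funext => j; rewrite mul1r.
    by rewrite E; apply => n; rewrite E; have [_ _ va _] := hv n; exact: va.
  move=> k; apply: (cprim_onesided (K := K k) (B := K k) (ltW T0) (K0 k)).
  + move=> t tT; apply: (ulim_le UU (kF t k tT)); apply: always => n; exact: Kb.
  + move=> x y; wlog xy : x y / x <= y.
      move=> H; case: (leP x y) => [/H//|/ltW yx hx hy]; rewrite cnBC [`|y - x|]distrC; exact: H.
    move=> hx hy; rewrite ger0_norm ?subr_ge0 //.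
    apply: (ulim_le UU (ulimB _ _ _ _ (hl y k hy) (hl x k hx))); apply: always => n /=.
    have [_ _ _ vp] := hv n; have /andP[x0 _] := hx; have /andP[_ yT] := hy.
    apply: (cprim_cn_le (vp k) x0 xy yT) => u /andP[xu uy]; apply: Kb.
    by rewrite (le_trans x0) ?(le_trans uy).
  + move=> e e0; have [d d0 hd] := mod_n k e e0; exists d => // x y hx hy xy.
    apply: (ulim_le UU (ulimB _ _ _ _ (kF y k hy) (kF x k hx))); apply: always => n /=.
    exact: hd (ltW xy).
  + move=> e e0; have [d d0 hd] := mod_n k e e0; exists d => // x y x0 xy yT dxy.
    have hx : 0 <= x <= T by rewrite x0 (le_trans xy).
    have hy : 0 <= y <= T by rewrite yT (le_trans x0).
    have hlim := ulimB _ _ _ _ (ulimB _ _ _ _ (hl y k hy) (hl x k hx))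
      (ulimM UU (ulim_cst UU (((y - x)%:C)%C)) (kF x k hx)).
    apply: (ulim_le UU hlim); apply: always => n /=; have [_ _ _ vp] := hv n.
    apply: (cprim_expand (vp k)) => // u /andP[xu uy]; apply: hd => //.
      by rewrite (le_trans x0) ?(le_trans uy).
    by rewrite ger0_norm ?subr_ge0 // (le_trans _ (ltW dxy)) // lerD2r.
- by move=> t tT; apply: (ulim_l2b (fun k => hl t k tT)) => n; exact: hb.
Qed.

End Limit.

Section Existence.
Variable R : realType.

Lemma gsol_exists (s T : R) (v0 : fseq R) : 0 < s -> 0 < T -> inHs s v0 ->
  exists v : R -> fseq R, [/\ v 0 = v0, gsol allf T (hs_norm 0 v0) v,
    exists2 B, 0 <= B & bnd_s s T v B,
    forall t k, 0 <= t <= T -> v t (- k) = conjc (v t k) &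
    forall t, 0 <= t <= T -> hs_norm 0 (v t) = hs_norm 0 v0].
Proof.
move=> s0 T0 hv0; have [z0 [c0 _]] := hv0.
have [U [UU Uinf]] := ultra_above_eventually.
have [B B0 hN] := galerkin_bounded (ltW s0) T0 hv0.
have [vn hvn] := choice hN.
have a0 := hs_norm_ge0 0 v0.
have gn n : gsol (lowf n) T (hs_norm 0 v0) (vn n) by have [] := hvn n.
have bn n : bnd_s s T (vn n) B by have [] := hvn n.
have [v [gv bv lv]] := gsol_limit UU Uinf s0 T0 a0 B0 gn bn.
have I0 : 0 <= (0 : R) <= T by rewrite lexx ltW.
have v0E : v 0 = v0.
  apply/funext => k; apply: (ulim_uniq UU (lv 0 k I0)) => e e0.
  apply: Uinf; exists `|k|%N => n hn /=; have [-> _ _ _ _] := hvn n.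
  rewrite /trunc /lowf; case: eqVneq => [->|_] /=; first by rewrite z0 subrr cn0 ltW.
  have -> : `|k| <= n%:Z by lia.
  by rewrite subrr cn0 ltW.
exists v; split => //; first by exists B.
- move=> t k tT; apply: (ulim_uniq UU (lv t (- k) tT)).
  rewrite (_ : (fun n => _) = (fun n => conjc (vn n t k))); first by apply: ulim_conj; exact: lv.
  by apply/funext => n; have [_ _ _ cv _] := hvn n; exact: cv.
have vz t : 0 <= t <= T -> v t 0 = 0 by have [_ h _ _] := gv; exact: h.
have va t : 0 <= t <= T -> l2b (fun k => cn (v t k)) (hs_norm 0 v0) by have [_ _ h _] := gv; exact: h.
have vna n t : 0 <= t <= T -> l2b (fun k => cn (vn n t k)) (hs_norm 0 v0) by have [_ _ h _] := gn n; exact: h.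
have vnz n t : 0 <= t <= T -> vn n t 0 = 0 by have [_ h _ _] := gn n; exact: h.
(* Symmetric in t and u, hence an equality: strong H^0 convergence at both times transfers the
   conserved norm of [vn n]. *)
have le_norm t u : 0 <= t <= T -> 0 <= u <= T -> hs_norm 0 (v t) <= hs_norm 0 (v u).
  move=> tT uT; apply/ler_addgt0Pr => e e0; have e2 : 0 < e / 2 by rewrite divr_gt0.
  have ht := ulim_l2 UU s0 B0 e2 (fun k => lv t k tT) (fun n => bn n t tT).
  have hu := ulim_l2 UU s0 B0 e2 (fun k => lv u k uT) (fun n => bn n u uT).
  have [n [/= h1 h2]] := filter_ex (filterI ht hu).
  have [_ _ _ _ nn] := hvn n.
  apply: (@le_trans _ _ (hs_norm 0 (vn n t) + e / 2)).
    apply: (hs_norm_triangle (f := vn n t) (g := fun k => vn n t k - v t k)) => //.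
    - exact: vz.
    - by move=> k; rewrite -[X in cn X <= _](subKr (vn n t k)) cnB.
    - exact: hs_norm_ge0.
    - exact: ltW.
    - apply: (l2b_hs_norm_of (Z := hs_norm 0 v0)); rewrite ?wt0E; [exact: vnz|exact: vna].
    - by rewrite (wt0E (fun k => vn n t k - v t k)).
  rewrite nn // -(nn u) // [X in _ <= _ + X]splitr addrA lerD2r.
  apply: (hs_norm_triangle (f := v u) (g := fun k => vn n u k - v u k)) => //.
  - exact: vnz.
  - by move=> k; rewrite -[X in cn X <= _](subrKC (v u k)) cnD.
  - exact: hs_norm_ge0.
  - exact: ltW.
  - apply: (l2b_hs_norm_of (Z := hs_norm 0 v0)); rewrite ?wt0E; [exact: vz|exact: va].
  - by rewrite (wt0E (fun k => vn n u k - v u k)).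
by move=> t tT; apply/eqP; rewrite eq_le -{2}v0E -{1}v0E !le_norm.
Qed.

End Existence.

(** * The integral form of the equation *)

Section Solutions.
Variable R : realType.
Notation C := (R[i]).
Implicit Types (v w : R -> fseq R).

Lemma rprim_Rint (T : R) (g : R -> R) : 0 <= T -> measurable_fun `[0, T] g -> bnd_on 0 T g ->
  rprim T (fun t => Rintegral (@lebesgue_measure R) `[0, t] g) g.
Proof.
move=> T0 mg bg; have [K hK] := bg.
have K0 : 0 <= K by apply: le_trans (hK 0 _); rewrite ?normr_ge0 // lexx.
split => //; last by move=> t tT; rewrite set_itv1 Rintegral_set1 add0r.
apply: unif_cont_measurable => // e e0; have K1 : 0 < K + 1 by rewrite ltr_wpDl.
exists (e / (K + 1)); first by rewrite divr_gt0.
move=> s t; wlog st : s t / s <= t.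
  move=> H; case: (leP s t) => [/H//|/ltW ts hs ht].
  by rewrite distrC [X in _ -> X <= _]distrC; exact: H.
move=> /andP[s0 sT] /andP[t0 tT]; rewrite ltr_pdivlMr // => h.
rewrite Rint_split //; [|exact: measurable_sub mg|exact: bnd_sub bg].
apply: (@le_trans _ _ (K * (t - s))).
  apply: Rint_abs_le => //; first exact: measurable_sub mg.
  by move=> u /andP[su ut]; apply: hK; rewrite (le_trans s0) // (le_trans ut).
rewrite (le_trans _ (ltW h)) // ger0_norm ?subr_ge0 // mulrC ler_wpM2l ?subr_ge0 // lerDl //.
Qed.

Lemma cprim_incr (T : R) (f g F : R -> C) : cprim T f F -> cprim T g F ->
  forall t, 0 <= t <= T -> f t - f 0 = g t - g 0.
Proof.
move=> [[_ _ _ fr] [_ _ _ fi]] [[_ _ _ gr] [_ _ _ gi]] t tT.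
apply/eqP; rewrite eq_complex ReD ReN ImD ImN [complex.Re (g t - _)]ReD [complex.Im (g t - _)]ImD.
rewrite ReN ImN (fr t tT) (fi t tT) (gr t tT) (gi t tT).
move: (Rintegral _ _ _) (Rintegral _ _ _) (complex.Re _) (complex.Im _) (complex.Re _) (complex.Im _).
by move=> p q x y z u; apply/andP; split; apply/eqP; ring.
Qed.

Variables (T a : R) (w : R -> fseq R).
Hypotheses (T0 : 0 <= T) (a0 : 0 <= a) (w0 : forall t, 0 <= t <= T -> w t 0 = 0)
  (wa : forall t, 0 <= t <= T -> l2b (fun k => cn (w t k)) a)
  (mw : forall k, cmeas T (fun t => w t k)).

Lemma cmeas_kdv_nonlin k : cmeas T (fun t => kdv_nonlin (w t) k t).
Proof.
have mn n : cmeas T (fun t => \sum_(k1 <- bx n) nt (w t) k t k1).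
  apply: cmeas_sum => k1; apply: cmeasM (mw _); apply: cmeasM (mw _).
  by have [] := cmeas_prim (cprim_exp ((3 * k * k1 * (k - k1))%:~R) T0).
have hlim t : 0 <= t <= T -> forall e, 0 < e -> exists M, forall n, (M <= n)%N ->
    cn (kdv_nonlin (w t) k t - \sum_(k1 <- bx n) nt (w t) k t k1) <= e.
  move=> tT e e0; have [M hM] := kdv_nonlin_lim k t a0 (wa tT) (w0 tT) e0.
  by exists M => n Mn; apply: hM; [exact: bx_uniq|exact: bx_sub].
split.
- apply: (measurable_fun_cvg (h := fun n t => complex.Re (\sum_(k1 <- bx n) nt (w t) k t k1))).
    by move=> n; have [] := mn n.
  move=> t; rewrite /= in_itv /= => tT; apply/cvgrPdist_le => /= e e0.
  have [M hM] := hlim t tT e e0; exists M => // n /= Mn.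
  apply: le_trans (hM n Mn); apply: le_trans (cn_Re _).
  by rewrite ReD ReN.
- apply: (measurable_fun_cvg (h := fun n t => complex.Im (\sum_(k1 <- bx n) nt (w t) k t k1))).
    by move=> n; have [] := mn n.
  move=> t; rewrite /= in_itv /= => tT; apply/cvgrPdist_le => /= e e0.
  have [M hM] := hlim t tT e e0; exists M => // n /= Mn.
  apply: le_trans (hM n Mn); apply: le_trans (cn_Im _).
  by rewrite ImD ImN.
Qed.

Lemma cint_prim k : cprim T
  (fun t => Complex 0 (2%:R^-1 * k%:~R) * cint t (fun tau => kdv_nonlin (w tau) k tau))
  (fun t => k%:~R * Fn allf (w t) k t).
Proof.
have [mr mi] := cmeas_kdv_nonlin k.
have bd t : 0 <= t <= T -> cn (kdv_nonlin (w t) k t) <= a * a.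
  by move=> tT; exact: csum_lim_le (kdv_nonlin_lim k t a0 (wa tT) (w0 tT)) (sumle_nt k t a0 (wa tT)).
have h : cprim T (fun t => cint t (fun tau => kdv_nonlin (w tau) k tau))
    (fun t => kdv_nonlin (w t) k t).
  split; apply: rprim_Rint => //; exists (a * a) => t tT.
    by rewrite (le_trans (cn_Re _)) // bd.
  by rewrite (le_trans (cn_Im _)) // bd.
apply: cprim_eq (cprimZ (Complex 0 (2%:R^-1 * k%:~R)) T0 h) => // t _.
rewrite /Fn /allf; case: eqVneq => [->|k0] /=.
  have -> : Complex 0 (2^-1 * 0%:~R) = 0 :> C by rewrite mulr0z mulr0.
  by rewrite mul0r mulr0.
rewrite mulrA intC; congr (_ * _).
by apply/eqP; rewrite eq_complex /=; apply/andP; split; apply/eqP; ring.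
Qed.

End Solutions.

(** * Solutions in the integral and in the primitive sense; uniqueness *)

Section Conversion.
Variable R : realType.
Notation C := (R[i]).
Variables (T : R).
Hypothesis T0 : 0 < T.
Let T0' : 0 <= T := ltW T0.
Let I0 : 0 <= (0 : R) <= T.
Proof. by rewrite lexx. Qed.

Lemma cint0 (g : R -> C) : cint 0 g = 0.
Proof. by rewrite /cint set_itv1 !Rintegral_set1. Qed.

Lemma solution_gsol (v0 : fseq R) (w : R -> fseq R) : is_solution T v0 w ->
  exists2 a, 0 <= a & gsol allf T a w /\ w 0 = v0.
Proof.
move=> [[hw [mw [M hM]]] eqw].
have M0 : 0 <= M by rewrite -lee_fin; exact: le_trans (hs_norm2_ge0 0 (w 0)) (hM 0 I0).
have a0 := sqrtr_ge0 M; exists (Num.sqrt M) => //.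
have w0 t : 0 <= t <= T -> w t 0 = 0 by move=> /hw[].
have wa t : 0 <= t <= T -> l2b (fun k => cn (w t k)) (Num.sqrt M).
  by move=> tT; rewrite -wt0E; apply: hs_norm2_le (w0 t tT); rewrite sqr_sqrtr // hM.
have wE : w 0 = v0.
  by apply/funext => k; apply/eqP; rewrite -subr_eq0 eqw // cint0 mulr0.
split => //; split => //.
move=> k; have := cprimD T0' (cprim_cst T (v0 k)) (cint_prim T0' a0 w0 wa mw k).
by apply: cprim_eq => // t tT; [rewrite -eqw // subrKC|rewrite add0r].
Qed.

Lemma gsol_solution a (v : R -> fseq R) : 0 <= a -> gsol allf T a v ->
  (forall t k, 0 <= t <= T -> v t (- k) = conjc (v t k)) -> is_solution T (v 0) v.
Proof.
move=> a0 [_ vz va vp] cv.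
have mv k : cmeas T (fun t => v t k) by have [] := cmeas_prim (vp k).
split.
  split; [move=> t tT|split => //].
    split; [exact: vz|split; first by move=> k; exact: cv].
    by apply: (@hs_norm2_lty _ _ _ a); rewrite wt0E; exact: va.
  by exists (a ^+ 2) => t tT; apply: hs_norm2_ge; rewrite wt0E; exact: va.
move=> k t tT; rewrite (cprim_incr (vp k) (cint_prim T0' a0 vz va mv k) tT).
by rewrite cint0 mulr0 subr0.
Qed.

(** At s = 0 the bound [B] of [gsol_lipschitz] is the H^0 bound itself, so any bounded solution can
    be compared; a + b serves both. *)
Lemma gsol_unique a b (v w : R -> fseq R) : 0 <= a -> 0 <= b -> gsol allf T a v ->
  gsol allf T b w -> v 0 = w 0 -> forall t, 0 <= t <= T -> w t = v t.
Proof.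
move=> a0 b0 gv gw vw t tT.
have c0 : 0 <= a + b := addr_ge0 a0 b0.
have {}gv : gsol allf T (a + b) v by apply: gsol_mono gv; rewrite a0 lerDl.
have {}gw : gsol allf T (a + b) w by apply: gsol_mono gw; rewrite b0 lerDr.
have [_ vz va _] := gv; have [_ wz wa _] := gw.
have [L L0 hL] := gsol_lipschitz (lexx 0) c0 c0 T0'.
have bv : bnd_s 0 T v (a + b) by move=> u uT; rewrite wt0E; exact: va.
have bw : bnd_s 0 T w (a + b) by move=> u uT; rewrite wt0E; exact: wa.
have := hL _ w v gv gw bv bw t tT.
have -> : fsub (w 0) (v 0) = fun=> 0 by apply/funext => k; rewrite /fsub vw subrr.
have h00 : hs_norm 0 (fun=> 0 : C) <= 0.
  by apply: hs_norm_le; rewrite ?wt0E //; exact: l2b_cn0.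
move=> h; have {}h : hs_norm 0 (fsub (w t) (v t)) <= 0.
  by rewrite (le_trans h) // mulr_ge0_le0.
have z0 : fsub (w t) (v t) 0 = 0 by rewrite /fsub vz // wz // subrr.
have lz : l2b (fun k => wt 0 k * cn (fsub (w t) (v t) k)) (a + b + (a + b)).
  apply: l2bD (bw t tT) (bv t tT) _ => // k.
  by rewrite mulr_ge0 ?wt_ge0 ?cn_ge0 //= -mulrDr ler_wpM2l ?wt_ge0 // cnB.
have := l2b_hs_norm_of z0 lz; rewrite wt0E => lz'.
apply/funext => k; apply/eqP; rewrite -subr_eq0; apply/eqP/cn_eq0/eqP.
rewrite eq_le cn_ge0 andbT; apply: le_trans h.
exact: (l2b_sup k (hs_norm_ge0 _ _) lz').
Qed.

Lemma hs_norm0_le s (v0 : fseq R) : 0 <= s -> inHs s v0 -> hs_norm 0 v0 <= hs_norm s v0.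
Proof.
move=> s0 [z0 [_ h]]; apply: hs_norm_le; first exact: hs_norm_ge0.
by rewrite wt0E; exact: l2b_wt0 s0 z0 (hs_norm_ge0 s v0) (l2b_hs_norm z0 h).
Qed.

End Conversion.

Theorem theorem5p5 (R : realType) (s T : R) :
  2^-1 < s -> 0 < T ->
  (forall v0 : fseq R, inHs s v0 ->
     exists v : R -> fseq R,
       [/\ is_solution T v0 v,
           (forall w : R -> fseq R, is_solution T v0 w ->
              forall t, 0 <= t <= T -> w t = v t),
           cont_Hs s T v &
           (forall t, 0 <= t <= T -> hs_norm2 0 (v t) = hs_norm2 0 v0)]) /\
  (exists L : R -> R,
     forall (v0 w0 : fseq R) (v w : R -> fseq R),
       inHs s v0 -> inHs s w0 -> is_solution T v0 v -> is_solution T w0 w ->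
       forall t, 0 <= t <= T ->
         hs_norm s (fsub (w t) (v t)) <=
           L (hs_norm s v0 + hs_norm s w0) * hs_norm s (fsub w0 v0)).
Proof.
move=> s_gt T0; have s0 : 0 < s by apply: lt_trans s_gt; rewrite invr_gt0.
have s0' := ltW s0; have T0' := ltW T0.
split.
  move=> v0 hv0; have [v [vE gv [B B0 bv] cv nv]] := gsol_exists s0 T0 hv0.
  have [z0 [_ h0]] := hv0; have a0 := hs_norm_ge0 0 v0.
  have [_ vz va _] := gv.
  exists v; split.
  - by rewrite -vE; exact: gsol_solution gv cv.
  - move=> w /(solution_gsol T0)[b b0 [gw wE]]; apply: (gsol_unique T0 a0 b0 gv gw).
    by rewrite vE wE.
  - split => [t tT|t0 t0T e e0].
      split; [exact: vz|split; first by move=> k; exact: cv].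
      exact: hs_norm2_lty (bv t tT).
    have e2 : 0 < e / 2 by rewrite divr_gt0.
    have [d d0 hd] := gsol_equicont s0' a0 B0 T0' e2.
    exists d => // t tT dt; apply: (@le_lt_trans _ _ (e / 2)).
      by apply: hs_norm_le; [exact: ltW|exact: hd gv bv _ _ t0T tT (ltW dt)].
    by rewrite ltr_pdivrMr // ltr_pMr // ltr1n.
  - move=> t tT; have f0 : (hs_norm2 0 v0 < +oo)%E.
      have := l2b_wt0 s0' z0 (hs_norm_ge0 s v0) (l2b_hs_norm z0 h0).
      by rewrite -wt0E; exact: hs_norm2_lty.
    have ft : (hs_norm2 0 (v t) < +oo)%E.
      by have := va t tT; rewrite -wt0E; exact: hs_norm2_lty.
    by rewrite -(hs_norm_sqr f0) -(hs_norm_sqr ft) nv.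
(* L is built one value r at a time and then assembled by [choice]; for r < 0 there are no data. *)
suff H (r : R) : exists L : R, forall (v0 w0 : fseq R) (v w : R -> fseq R),
    hs_norm s v0 + hs_norm s w0 = r ->
    inHs s v0 -> inHs s w0 -> is_solution T v0 v -> is_solution T w0 w ->
    forall t, 0 <= t <= T -> hs_norm s (fsub (w t) (v t)) <= L * hs_norm s (fsub w0 v0).
  have [L hL] := choice H; exists L => v0 w0 v w hv0 hw0 hv hw t tT.
  exact: hL hv0 hw0 hv hw t tT.
have [r0|r0] := leP 0 r; last first.
  exists 0 => v0 w0 v w rE; exfalso; move: r0.
  by rewrite -rE ltNge addr_ge0 // hs_norm_ge0.
have [K K0 hK] := gsol_apriori s0' r0 T0'.
have [L L0 hL] := gsol_lipschitz s0' r0 (mulr_ge0 K0 r0) T0'.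
exists L => v0 w0 v w rE hv0 hw0 hv hw t tT.
(* A given solution is only bounded in H^0; by uniqueness it coincides with the constructed one,
   whose H^s norm is at most [K * r]. *)
have good (x0 : fseq R) (x : R -> fseq R) : hs_norm s x0 <= r -> inHs s x0 -> is_solution T x0 x ->
    exists y : R -> fseq R, [/\ y 0 = x0, gsol allf T r y, bnd_s s T y (K * r) & y t = x t].
  move=> xr hx0 hx; have [y [yE gy by_ _ _]] := gsol_exists s0 T0 hx0.
  have n0 := hs_norm0_le s0' hx0.
  have gr : gsol allf T r y.
    by apply: gsol_mono gy; rewrite hs_norm_ge0 (le_trans n0).
  have [_ yz _ _] := gr.
  exists y; split => //.
    move=> u uT; have [B _ bB] := by_.
    apply: l2b_le (l2b_hs_norm_of (yz u uT) (bB u uT)) => [|k]; last first.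
      by rewrite mulr_ge0 ?wt_ge0 ?cn_ge0 /=.
    by rewrite hs_norm_ge0 (le_trans (hK _ _ gr by_ u uT)) // yE ler_wpM2l.
  have [b b0 [gx xE]] := solution_gsol T0 hx.
  apply: (gsol_unique T0 b0 r0 gx gr) => //; by rewrite xE yE.
have vr : hs_norm s v0 <= r by rewrite -rE lerDl hs_norm_ge0.
have wr : hs_norm s w0 <= r by rewrite -rE lerDr hs_norm_ge0.
have [y [<- gy by_ <-]] := good v0 v vr hv0 hv.
have [x [<- gx bx_ <-]] := good w0 w wr hw0 hw.
exact: (hL _ _ _ gy gx by_ bx_).
Qed.
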